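(* Let $n>1$, $1\le k\le n$, and let $\Phi\in L^{\infty}(\mathbb{M}_{n})$ be an admissible very badly approximable matrix function. Suppose there is $\Psi\in\mathcal{A}_{k}^{n}$ such that \[\int_{\mathbb{T}}\operatorname{trace}(\Phi(\zeta)\Psi(\zeta))\,d\boldsymbol{m}(\zeta)=t_{0}(\Phi)+\ldots+t_{n}(\Phi).\] If $t_{k-1}(\Phi)>0$, then $\Phi$ has order $k$ and the zero matrix function is a best approximant to $\Phi$ in $H^\infty(\mathbb{M}_n)$ under the $L^{\infty}(\boldsymbol{S}_{1}^{n})$-norm.
   Context: $\mathbb{T}$ is the unit circle, $\boldsymbol{m}$ normalized Lebesgue measure. $\mathbb{M}_{n,k}$: complex $n\times k$ matrices with operator norm, $\mathbb{M}_n=\mathbb{M}_{n,n}$. For a matrix $A$, $s_j(A)=\inf\{\|A-B\|:\operatorname{rank}B\le j\}$ for all $j\ge0$ (so $s_j(A)=0$ for $j\ge n$ when $A$ is $n\times n$); $\boldsymbol{S}_1^{n,k}$ is $\mathbb{M}_{n,k}$ with trace norm $\sum_j s_j(A)$. For a function space $X$ on $\mathbb{T}$ ($L^p,H^p,H^p_0=\{f\in H^p:\hat f(0)=0\}$), $X(\mathbb{M}_{n,k})$ (resp. $X(\boldsymbol{S}_1^{n,k})$) consists of matrix functions with entries in $X$, normed by the $X$-norm of the pointwise operator (resp. trace) norm. For $1\le k\le n$: $\mathcal{A}_k^{n}=\{\Psi\in H^1_0(\mathbb{M}_{n}):\|\Psi\|_{L^1(\mathbb{M}_{n})}\le1,\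 \operatorname{rank}\Psi\le k\text{ a.e.}\}$, $\sigma_k(\Phi)=\sup_{\Psi\in\mathcal{A}_k^{n}}|\int_{\mathbb{T}}\operatorname{trace}(\Phi\Psi)\,d\boldsymbol{m}|$; $H_\Phi^{\{k\}}:H^2(\mathbb{M}_{n,k})\to L^2(\boldsymbol{S}_1^{n,k})/H^2(\boldsymbol{S}_1^{n,k})$ maps $F$ to the coset of $\Phi F$ (quotient norm); a maximizing vector of $T$ is a nonzero $x$ with $\|Tx\|=\|T\|\|x\|$. $\Phi$ has order $\ell$ if $\ell$ is the smallest number such that $H_\Phi^{\{\ell\}}$ has a maximizing vector and $\sigma_\ell(\Phi)=\inf_{F\in H^\infty(\mathbb{M}_n)}\|\Phi-F\|_{L^\infty(\boldsymbol{S}_1^n)}$. Superoptimal approximation: $\Omega_0(\Phi)$ is the set of $F\in H^\infty(\mathbb{M}_n)$ minimizing $\operatorname{ess\,sup}_\zeta\|\Phi(\zeta)-F(\zeta)\|$, $\Omega_j(\Phi)$ the set of $F\in\Omega_{j-1}(\Phi)$ minimizing $\operatorname{ess\,sup}_\zeta s_j(\Phi(\zeta)-F(\zeta))$; for $F\in\Omega_{n-1}(\Phi)$, $t_j(\Phi)=\operatorname{ess\,sup}_\zeta s_j((\Phi-F)(\zeta))$, $j\ge0$ (in particular $t_n(\Phi)=0$); $\Phi$ is very badly approximable if the zero function belongs to $\Omega_{n-1}(\Phi)$. The Hankel operator is $H_\Phi f=\mathbb{P}_-(\Phi f)$ on $H^2(\mathbb{C}^n)$; $\Phi$ is admissible if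 $\|H_\Phi\|_{\rm e}$ (distance to compact operators) is strictly less than the smallest nonzero superoptimal singular value of $\Phi$. *)

(* Defs.v *)
(* Functions on the unit circle T are
   represented as functions of the angle variable theta in [0,1]
   (zeta = exp(2 pi i theta)); normalized Lebesgue measure m on T is
   Lebesgue measure on [0,1].  Complex numbers are R[i] over R : realType. *)
From HB Require Import structures.
From mathcomp Require Import all_boot all_order all_algebra.
From mathcomp Require Import all_classical all_reals all_analysis.
From mathcomp Require Import complex.
From Stdlib Require Import ClassicalEpsilon.

Set Implicit Arguments.
Unset Strict Implicit.
Unset Printing Implicit Defensive.

Import Order.TTheory GRing.Theory Num.Theory.
Local Open Scope classical_set_scope.
Local Open Scope ring_scope.

Section Defs.
Variable R : realType.
Local Notation C := (R[i]).

Definition cabs (z : C) : R := Num.sqrt (complex.Re z ^+ 2 + complex.Im z ^+ 2).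

Definition vnorm (p : nat) (v : 'cV[C]_p) : R := Num.sqrt (\sum_(i < p) cabs (v i 0) ^+ 2).

Definition opnorm (m p : nat) (A : 'M[C]_(m, p)) : R :=
  sup [set vnorm (A *m v) | v in [set v : 'cV[C]_p | vnorm v <= 1]].

Definition sing (m p : nat) (j : nat) (A : 'M[C]_(m, p)) : R :=
  inf [set opnorm (A - B) | B in [set B : 'M[C]_(m, p) | (\rank B <= j)%N]].

Definition trnorm (m p : nat) (A : 'M[C]_(m, p)) : R :=
  \sum_(j < minn m p) sing j A.

Definition T01 : set R := `[0%R, 1%R]%classic.
Local Notation leb := (@lebesgue_measure R).

Definition cmeas (f : R -> C) : Prop :=
  measurable_fun T01 (fun t => complex.Re (f t)) /\
  measurable_fun T01 (fun t => complex.Im (f t)).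

Definition cint (f : R -> C) : C :=
  (Rintegral leb T01 (fun t => complex.Re (f t)))%:C%C +
  'i%C * (Rintegral leb T01 (fun t => complex.Im (f t)))%:C%C.

Definition expi (x : R) : C := Complex (cos x) (sin x).

Definition fourier (f : R -> C) (k : int) : C :=
  cint (fun t => f t * expi (- (2 * pi * k%:~R * t))).

Definition esssup (g : R -> R) : \bar R :=
  ereal_inf [set x : \bar R | leb (T01 `&` [set t | (x < (g t)%:E)%E]) = 0%E].

Definition inL1 (f : R -> C) : Prop :=
  cmeas f /\ (\int[leb]_(t in T01) (cabs (f t))%:E < +oo)%E.
Definition inL2 (f : R -> C) : Prop :=
  cmeas f /\ (\int[leb]_(t in T01) (cabs (f t) ^+ 2)%:E < +oo)%E.
Definition inLinf (f : R -> C) : Prop :=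
  cmeas f /\ (esssup (fun t => cabs (f t)) < +oo)%E.

Definition inH1_0 (f : R -> C) : Prop :=
  inL1 f /\ forall k : int, k <= 0 -> fourier f k = 0.
Definition inH2 (f : R -> C) : Prop :=
  inL2 f /\ forall k : int, k < 0 -> fourier f k = 0.
Definition inHinf (f : R -> C) : Prop :=
  inLinf f /\ forall k : int, k < 0 -> fourier f k = 0.

Definition MF (m p : nat) := R -> 'M[C]_(m, p).

Definition entrywise (X : (R -> C) -> Prop) (m p : nat) (F : MF m p) : Prop :=
  forall (i : 'I_m) (j : 'I_p), X (fun t => F t i j).
Arguments entrywise X {m p} F.

Definition L1nrm (m p : nat) (N : 'M[C]_(m, p) -> R) (F : MF m p) : R :=
  fine (\int[leb]_(t in T01) (N (F t))%:E).
Definition L2nrm (m p : nat) (N : 'M[C]_(m, p) -> R) (F : MF m p) : R :=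
  Num.sqrt (fine (\int[leb]_(t in T01) (N (F t) ^+ 2)%:E)).
Definition Linfnrm (m p : nat) (N : 'M[C]_(m, p) -> R) (F : MF m p) : R :=
  fine (esssup (fun t => N (F t))).

Definition vnormM (m : nat) (A : 'M[C]_(m, 1)) : R := vnorm A.

Definition Pminus (n : nat) (f : MF n 1) : MF n 1 :=
  epsilon (inhabits (fun _ => 0))
    (fun g : MF n 1 => entrywise inL2 g /\
       forall (i : 'I_n) (k : int),
         fourier (fun t => g t i 0) k =
         (if k < 0 then fourier (fun t => f t i 0) k else 0)).

Definition Hankel (n : nat) (Phi : MF n n) (f : MF n 1) : MF n 1 :=
  Pminus (fun t => Phi t *m f t).

Definition H2vec (n : nat) (f : MF n 1) : Prop := entrywise inH2 f.

Definition compact_op (n : nat) (K : MF n 1 -> MF n 1) : Prop :=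
  (forall f, H2vec f ->
     entrywise inL2 (K f) /\
     forall (i : 'I_n) (k : int), 0 <= k -> fourier (fun t => K f t i 0) k = 0) /\
  (forall (a : C) f g, H2vec f -> H2vec g ->
     L2nrm (@vnormM n) (fun t => K (fun s => a *: f s + g s) t - (a *: K f t + K g t)) = 0) /\
  (forall f g, H2vec f -> H2vec g -> L2nrm (@vnormM n) (fun t => f t - g t) = 0 ->
     L2nrm (@vnormM n) (fun t => K f t - K g t) = 0) /\
  (forall u : nat -> MF n 1,
     (forall j, H2vec (u j) /\ L2nrm (@vnormM n) (u j) <= 1) ->
     exists phi : nat -> nat, (forall j, (phi j < phi j.+1)%N) /\
       forall e : R, 0 < e -> exists N : nat, forall p q : nat, (N <= p)%N -> (N <= q)%N ->
         L2nrm (@vnormM n) (fun t => K (u (phi p)) t - K (u (phi q)) t) < e).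

Definition hankel_essnorm (n : nat) (Phi : MF n n) : R :=
  inf [set sup [set L2nrm (@vnormM n) (fun t => Hankel Phi f t - K f t)
                | f in [set f : MF n 1 | H2vec f /\ L2nrm (@vnormM n) f <= 1]]
       | K in [set K | compact_op K]].

Fixpoint Omega (n : nat) (Phi : MF n n) (j : nat) : set (MF n n) :=
  match j with
  | 0 => [set F | entrywise inHinf F /\
           forall G, entrywise inHinf G ->
             (esssup (fun t => sing 0 (Phi t - F t)) <=
              esssup (fun t => sing 0 (Phi t - G t)))%E]
  | j'.+1 => [set F | Omega Phi j' F /\
           forall G, Omega Phi j' G ->
             (esssup (fun t => sing j'.+1 (Phi t - F t)) <=
              esssup (fun t => sing j'.+1 (Phi t - G t)))%E]
  end.

Definition tsv (n : nat) (Phi : MF n n) (j : nat) : R :=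
  let F := epsilon (inhabits (fun _ => 0)) (Omega Phi n.-1) in
  fine (esssup (fun t => sing j (Phi t - F t))).

Definition very_badly_approximable (n : nat) (Phi : MF n n) : Prop :=
  Omega Phi n.-1 (fun _ => 0).

Definition admissible (n : nat) (Phi : MF n n) : Prop :=
  forall j : nat, tsv Phi j <> 0 -> hankel_essnorm Phi < tsv Phi j.

Definition Acal (n k : nat) (Psi : MF n n) : Prop :=
  entrywise inH1_0 Psi /\ L1nrm (@opnorm n n) Psi <= 1 /\
  leb (T01 `&` [set t | (k < \rank (Psi t))%N]) = 0%E.

Definition sigma (n k : nat) (Phi : MF n n) : R :=
  sup [set cabs (cint (fun t => \tr (Phi t *m Psi t))) | Psi in Acal k].

Definition distS1 (n : nat) (Phi : MF n n) : R :=
  inf [set Linfnrm (@trnorm n n) (fun t => Phi t - F t) | F in entrywise inHinf].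

(* quotient norm of H_Phi^{k} F in L^2(S_1^{n,k}) / H^2(S_1^{n,k}) *)
Definition Hk_qnorm (n k : nat) (Phi : MF n n) (F : MF n k) : R :=
  inf [set L2nrm (@trnorm n k) (fun t => Phi t *m F t - G t) | G in entrywise inH2].

Definition Hk_norm (n k : nat) (Phi : MF n n) : R :=
  sup [set Hk_qnorm Phi F
       | F in [set F : MF n k | entrywise inH2 F /\ L2nrm (@opnorm n k) F <= 1]].

Definition maximizing_vector (n k : nat) (Phi : MF n n) (F : MF n k) : Prop :=
  entrywise inH2 F /\ L2nrm (@opnorm n k) F <> 0 /\
  Hk_qnorm Phi F = Hk_norm k Phi * L2nrm (@opnorm n k) F.

Definition order_cond (n : nat) (Phi : MF n n) (l : nat) : Prop :=
  (exists F : MF n l, maximizing_vector Phi F) /\ sigma l Phi = distS1 Phi.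

Definition has_order (n : nat) (Phi : MF n n) (k : nat) : Prop :=
  (1 <= k)%N /\ order_cond Phi k /\
  forall l : nat, (1 <= l)%N -> (l < k)%N -> ~ order_cond Phi l.

End Defs.

(* Main.v *)
(** Off a null set [sing j (Phi t) <= t_j], and [|tr (A B)|] is at most
    [(s_0(A) + .. + s_(r-1)(A)) |B|] when [rank B <= r].  Pairing [Phi] with
    elements of [Acal l] thus gives [sigma_l <= t_0 + .. + t_(l-1)]; the extremal
    [Psi] forces [t_j = 0] for [j >= k], and with [S = t_0 + .. + t_(k-1)] one gets
    [sigma_k = S], [sigma_l < S] for [l < k], and [|Phi|_{L^oo(S_1)} = S = dist],
    since subtracting an [H^oo] function does not change the pairing with [Psi].
    For the maximizing vector, factor [Psi = F G] with [F] in [H^2(M_{n,k})], [G]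
    in [H^2_0(M_{k,n})] and [|F|^2, |G|^2 <= |Psi|]: for [Q] in [H^2],
    [S = int tr ((Phi F - Q) G) <= |Phi F - Q|_{L^2(S_1)}], whereas
    [|Phi F|_{L^2(S_1)} <= S |F|], so that [F] is maximizing.

    The factorization is a Wold decomposition.  Let [s = |Psi|^(1/2)],
    [U = Psi / s] and [M] the closed shift-invariant subspace of [L^2(C^n)] spanned
    by the columns of [U].  An orthonormal basis of the orthogonal
    complement of [z M] in [M] is pointwise orthonormal, hence has at most [k] elements, which form
    the columns of a matrix [Theta] with [U = Theta Theta^* U]; one takes
    [F = z^-1 s Theta] and [G = z Theta^* U]. *)
Require Import Defs.
From HB Require Import structures.
From mathcomp Require Import all_boot all_order all_algebra.
From mathcomp Require Import all_classical all_reals all_analysis.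
From mathcomp Require Import complex.
From mathcomp Require Import ring lra measurable_realfun.

Set Implicit Arguments.
Unset Strict Implicit.
Unset Printing Implicit Defensive.

Import Order.TTheory GRing.Theory Num.Theory.
Import numFieldNormedType.Exports.
Local Open Scope classical_set_scope.
Local Open Scope ring_scope.

(** * Complex modulus and semi-inner product spaces *)

(** The classical factorization of [Psi] divides by an outer function of modulus [|Psi|^(1/2)]. Here
    the divisor [s] is only a measurable function: neither [s] nor [U] need be analytic, and [M]
    lies in L^2, not in H^2. What survives is that [s m], for [m] in [M], has no Fourier coefficient
    of index at most 0, because [s U = Psi]. This fact does two jobs. It puts [s Theta] in H^2_0,
    and it disposes of the part of [M] that lies in every [z^j M]: extracting powers of [z] moves
    any coefficient to an index at most 0. Analyticity of [Theta^* U] comes from the other side, the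
    orthogonality of the columns of [Theta] to [z^j M] for [j > 0].

    Global identities become pointwise ones through injectivity of the Fourier transform on L^1,
    obtained from polynomials in a cosine that approximate indicators of arcs. Since [sing] is a
    distance to matrices of low rank, the trace inequality also requires a comparison of these
    distances with an orthonormal eigenbasis of [A^* A]. *)

Section Modulus.
Variable R : realType.
Local Notation C := (R[i]).
Implicit Types (z w : C).

Lemma cabsE z : (cabs z)%:C%C = `|z|.
Proof. by rewrite normc_def. Qed.

Lemma cabsr (x : R) : cabs x%:C%C = `|x|.
Proof. by rewrite /cabs /= expr0n addr0 sqrtr_sqr. Qed.

Lemma cabs_ge0 z : 0 <= cabs z.
Proof. exact: sqrtr_ge0. Qed.

Lemma cabsM z w : cabs (z * w) = cabs z * cabs w.
Proof. by apply: complexI; rewrite rmorphM /= !cabsE normrM. Qed.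

Lemma cabsD z w : cabs (z + w) <= cabs z + cabs w.
Proof. by rewrite -lecR rmorphD /= !cabsE ler_normD. Qed.

Lemma cabs0 : cabs (0 : C) = 0.
Proof. by apply: complexI; rewrite cabsE normr0. Qed.

Lemma cabs1 : cabs (1 : C) = 1.
Proof. by apply: complexI; rewrite cabsE normr1. Qed.

Lemma cabsN z : cabs (- z) = cabs z.
Proof. by apply: complexI; rewrite !cabsE normrN. Qed.

Lemma cabsJ z : cabs (z^*)%C = cabs z.
Proof. by apply: complexI; rewrite !cabsE normcJ. Qed.

Lemma cabs_eq0 z : cabs z = 0 -> z = 0.
Proof. by move=> h; apply/eqP; rewrite -normr_eq0 -cabsE h. Qed.

Lemma sqr_cabs z : cabs z ^+ 2 = complex.Re z ^+ 2 + complex.Im z ^+ 2.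
Proof. by rewrite sqr_sqrtr // addr_ge0 // sqr_ge0. Qed.

Lemma sqr_cabsC z : (cabs z ^+ 2)%:C%C = z * (z^*)%C.
Proof. by rewrite rmorphXn /= cabsE sqr_normc. Qed.

Lemma cabs_ge_Re z : `|complex.Re z| <= cabs z.
Proof. by rewrite -sqrtr_sqr ler_wsqrtr // lerDl sqr_ge0. Qed.

Lemma cabs_ge_Im z : `|complex.Im z| <= cabs z.
Proof. by rewrite -sqrtr_sqr ler_wsqrtr // lerDr sqr_ge0. Qed.

Lemma cabs_le_ReIm z : cabs z <= `|complex.Re z| + `|complex.Im z|.
Proof.
rewrite -ler_sqr ?nnegrE ?cabs_ge0 ?addr_ge0 // sqr_cabs sqrrD.
rewrite !real_normK ?num_real // lerD2r lerDl.
by rewrite mulrn_wge0 // mulr_ge0.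
Qed.

Lemma ReD z w : complex.Re (z + w) = complex.Re z + complex.Re w.
Proof. by case: z => a b; case: w. Qed.

Lemma ImD z w : complex.Im (z + w) = complex.Im z + complex.Im w.
Proof. by case: z => a b; case: w. Qed.

Lemma ReN z : complex.Re (- z) = - complex.Re z.
Proof. by case: z. Qed.

Lemma ImN z : complex.Im (- z) = - complex.Im z.
Proof. by case: z. Qed.

Lemma ReM z w : complex.Re (z * w) =
  complex.Re z * complex.Re w - complex.Im z * complex.Im w.
Proof. by case: z => a b; case: w. Qed.

Lemma ImM z w : complex.Im (z * w) =
  complex.Re z * complex.Im w + complex.Im z * complex.Re w.
Proof. by case: z => a b; case: w. Qed.

Lemma ReJ z : complex.Re (z^*)%C = complex.Re z.
Proof. by case: z. Qed.

Lemma ImJ z : complex.Im (z^*)%C = - complex.Im z.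
Proof. by case: z. Qed.

Lemma conjcM z w : ((z * w)^*)%C = (z^*)%C * (w^*)%C.
Proof. exact: rmorphM. Qed.

Lemma conjcN z : ((- z)^*)%C = - (z^*)%C.
Proof. exact: rmorphN. Qed.

Lemma conjc_sum (I : Type) (r : seq I) (P : pred I) (F : I -> C) :
  ((\sum_(i <- r | P i) F i)^*)%C = \sum_(i <- r | P i) ((F i)^*)%C.
Proof. exact: rmorph_sum. Qed.

Lemma realc_sum (I : Type) (r : seq I) (P : pred I) (F : I -> R) :
  (\sum_(i <- r | P i) F i)%:C%C = \sum_(i <- r | P i) (F i)%:C%C.
Proof. exact: rmorph_sum. Qed.

Lemma realcM (x y : R) : (x * y)%:C%C = x%:C%C * y%:C%C.
Proof. exact: rmorphM. Qed.

Lemma le_sqr_ge0 (x y : R) : 0 <= x -> 0 <= y -> x ^+ 2 <= y ^+ 2 -> x <= y.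
Proof. by move=> x0 y0; rewrite ler_sqr. Qed.

Lemma eq_sqr_ge0 (x y : R) : 0 <= x -> 0 <= y -> x ^+ 2 = y ^+ 2 -> x = y.
Proof. by move=> x0 y0 /eqP; rewrite eqrXn2 // => /eqP. Qed.

Lemma complex_ext z w :
  complex.Re z = complex.Re w -> complex.Im z = complex.Im w -> z = w.
Proof. by case: z => a b; case: w => c d /= -> ->. Qed.

Lemma ReMr (x : R) z : complex.Re (x%:C%C * z) = x * complex.Re z.
Proof. by rewrite ReM /= mul0r subr0. Qed.

Lemma cabs_sum (I : Type) (r : seq I) (P : pred I) (F : I -> C) :
  cabs (\sum_(i <- r | P i) F i) <= \sum_(i <- r | P i) cabs (F i).
Proof.
elim/big_rec2: _ => [|i y1 y2 _ h]; first by rewrite cabs0.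
by apply: le_trans (cabsD _ _) _; rewrite lerD2l.
Qed.

Lemma sqr_cabsD z w : cabs (z + w) ^+ 2 <= 2 * cabs z ^+ 2 + 2 * cabs w ^+ 2.
Proof.
rewrite !sqr_cabs ReD ImD.
have := sqr_ge0 (complex.Re z - complex.Re w).
have := sqr_ge0 (complex.Im z - complex.Im w).
nra.
Qed.

End Modulus.

Lemma le0_eps (R : realType) (x : R) : (forall e, 0 < e -> x <= e) -> x <= 0.
Proof. by move=> h; apply/ler_addgt0Pl => e e0; rewrite addr0; apply: h. Qed.

(** * Projection theorem in a complete semi-inner product space *)

Section SemiInner.
Variables (R : realType) (V : lmodType R[i]).
Local Notation C := (R[i]).

(** Functions that agree almost everywhere are not identified, and square integrability is a
    predicate on them; hence a domain [D] inside [V] and a form that is only positive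
    semidefinite. *)
Record semi_inner (D : V -> Prop) (ip : V -> V -> C) : Prop := SemiInner {
  si0 : D 0;
  siL : forall a v w, D v -> D w -> D (a *: v + w);
  si_lin : forall a u v w, D u -> D v -> D w ->
    ip (a *: u + v) w = a * ip u w + ip v w;
  si_herm : forall u v, D u -> D v -> ip v u = ((ip u v)^*)%C;
  si_ge0 : forall v, D v -> 0 <= complex.Re (ip v v) }.

Definition ipq (ip : V -> V -> C) (v : V) : R := complex.Re (ip v v).

Definition si_complete (D : V -> Prop) (ip : V -> V -> C) : Prop :=
  forall u : nat -> V, (forall i, D (u i)) ->
    (forall e, 0 < e -> exists N : nat, forall i j, (N <= i)%N -> (N <= j)%N ->
       ipq ip (u i - u j) < e) ->
    exists2 l, D l & forall e, 0 < e -> exists N : nat, forall i, (N <= i)%N ->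
       ipq ip (u i - l) < e.

Definition subspace_of (D A : V -> Prop) : Prop :=
  [/\ A 0, forall a v w, A v -> A w -> A (a *: v + w) & forall v, A v -> D v].

Definition si_cl (D : V -> Prop) (ip : V -> V -> C) (A : V -> Prop) (v : V) : Prop :=
  D v /\ forall e, 0 < e -> exists2 a, A a & ipq ip (v - a) < e.

Section Theory.
Variables (D : V -> Prop) (ip : V -> V -> C) (H : semi_inner D ip).

Lemma siD v w : D v -> D w -> D (v + w).
Proof. by move=> v1 w1; rewrite -[v]scale1r; apply: (siL H). Qed.

Lemma siZ a v : D v -> D (a *: v).
Proof. by move=> v1; rewrite -[_ *: _]addr0; apply: (siL H) => //; apply: (si0 H). Qed.

Lemma siN v : D v -> D (- v).
Proof. by move=> v1; rewrite -scaleN1r; apply: siZ. Qed.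

Lemma siB v w : D v -> D w -> D (v - w).
Proof. by move=> v1 w1; apply: siD => //; apply: siN. Qed.

Lemma ipDl u v w : D u -> D v -> D w -> ip (u + v) w = ip u w + ip v w.
Proof. by move=> *; rewrite -[u]scale1r (si_lin H) // mul1r scale1r. Qed.

Lemma ip0l w : D w -> ip 0 w = 0.
Proof.
move=> w1; have := ipDl (si0 H) (si0 H) w1.
by rewrite addr0 => /eqP; rewrite -subr_eq0 opprD addNKr oppr_eq0 => /eqP.
Qed.

Lemma ipZl a u w : D u -> D w -> ip (a *: u) w = a * ip u w.
Proof.
by move=> u1 w1; rewrite -[_ *: _]addr0 (si_lin H) ?ip0l ?addr0 //; apply: (si0 H).
Qed.

Lemma ipNl u w : D u -> D w -> ip (- u) w = - ip u w.
Proof. by move=> *; rewrite -scaleN1r ipZl // mulN1r. Qed.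

Lemma ipBl u v w : D u -> D v -> D w -> ip (u - v) w = ip u w - ip v w.
Proof. by move=> *; rewrite ipDl ?ipNl //; apply: siN. Qed.

Lemma ipDr u v w : D u -> D v -> D w -> ip w (u + v) = ip w u + ip w v.
Proof.
move=> u1 v1 w1; rewrite (si_herm H (siD u1 v1) w1) ipDl // rmorphD /=.
by rewrite -!(si_herm H).
Qed.

Lemma ipZr a u w : D u -> D w -> ip w (a *: u) = (a^*)%C * ip w u.
Proof.
move=> u1 w1; rewrite (si_herm H (siZ a u1) w1) ipZl // rmorphM /=.
by rewrite -(si_herm H).
Qed.

Lemma ipNr u w : D u -> D w -> ip w (- u) = - ip w u.
Proof. by move=> u1 w1; rewrite (si_herm H (siN u1) w1) ipNl // conjcN -(si_herm H). Qed.

Lemma ipBr u v w : D u -> D v -> D w -> ip w (u - v) = ip w u - ip w v.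
Proof. by move=> *; rewrite ipDr ?ipNr //; apply: siN. Qed.

Lemma ip0r w : D w -> ip w 0 = 0.
Proof. by move=> w1; rewrite (si_herm H (si0 H) w1) ip0l // rmorph0. Qed.

Lemma ip_diag v : D v -> ip v v = (ipq ip v)%:C%C.
Proof.
move=> v1; apply: complex_ext => //=.
have /(congr1 (@complex.Im _)) := si_herm H v1 v1; rewrite ImJ => h.
by apply/eqP; rewrite -[_ == _](mulrn_eq0 _ 2) mulr2n {2}h subrr.
Qed.

Lemma ipq_ge0 v : D v -> 0 <= ipq ip v.
Proof. exact: (si_ge0 H). Qed.

Lemma ipq_sub v a c : D v -> D a ->
  ipq ip (v - c *: a) =
  ipq ip v - 2 * complex.Re ((c^*)%C * ip v a) + cabs c ^+ 2 * ipq ip a.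
Proof.
move=> v1 a1; rewrite {1}/ipq.
have ca := siZ c a1; have vca := siB v1 ca.
rewrite ipBl // !ipBr // !ipZl // !ipZr // (ip_diag a1).
rewrite mulrA -sqr_cabsC (si_herm H v1 a1).
have -> : c * (ip v a)^*%C = ((c^*)%C * ip v a)^*%C by rewrite rmorphM /= conjcK.
rewrite !ReD !ReN !ReD !ReN ReJ -rmorphM /= ; rewrite /ipq; lra.
Qed.

(** Test the hypothesis with [c = s z], where [z = ip v a] and [s] is real, then take
    [s = 1 / ipq ip a]. The case [d = ipq ip v] is Cauchy-Schwarz; a small [d] expresses the
    near-orthogonality of a minimizing sequence in the projection theorem. *)
Lemma ip_almost_orth v a d : D v -> D a ->
  (forall c, ipq ip v - d <= ipq ip (v - c *: a)) ->
  cabs (ip v a) ^+ 2 <= d * ipq ip a.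
Proof.
move=> v1 a1 h; have qa := ipq_ge0 a1.
set z := ip v a.
have hs (s : R) : (2 * s * cabs z ^+ 2 <= d + s ^+ 2 * cabs z ^+ 2 * ipq ip a).
  have := h (s%:C%C * z); rewrite ipq_sub // -/z.
  rewrite conjcM conjc_real -mulrA [(z^*)%C * z]mulrC -sqr_cabsC ReMr /=.
  rewrite cabsM cabsr exprMn real_normK ?num_real //; lra.
have d0 : 0 <= d by have := hs 0; rewrite expr0n /= !(mulr0, mul0r) addr0.
have z0 := sqr_ge0 (cabs z).
(* A vector of seminorm zero need not vanish; letting [s] be large still forces [z = 0]. *)
have [q0|qn] := eqVneq (ipq ip a) 0.
  rewrite q0 mulr0 leNgt; apply/negP => zp.
  have := hs ((d + 1) / (cabs z ^+ 2)).
  rewrite q0 mulr0 addr0 -mulrA divfK ?gt_eqF // => ?; lra.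
have qp : 0 < ipq ip a by rewrite lt0r qn.
have := hs (ipq ip a)^-1.
have -> : (ipq ip a)^-1 ^+ 2 * cabs z ^+ 2 * ipq ip a = (ipq ip a)^-1 * cabs z ^+ 2.
  by field.
move=> h1; rewrite -ler_pdivrMr // mulrC; lra.
Qed.

Lemma ip_CS v w : D v -> D w -> cabs (ip v w) ^+ 2 <= ipq ip v * ipq ip w.
Proof.
move=> v1 w1; apply: ip_almost_orth => // c; rewrite subrr.
by apply: ipq_ge0; apply: siB => //; apply: siZ.
Qed.

Lemma ipqD2 v w : D v -> D w -> ipq ip (v + w) <= 2 * ipq ip v + 2 * ipq ip w.
Proof.
move=> v1 w1; have := ipq_ge0 (siB v1 w1).
have := ipq_sub 1 v1 w1; have := ipq_sub (-1) v1 w1.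
rewrite scale1r scaleN1r opprK conjcN conjc1 /= !mulN1r !mul1r ReN cabsN cabs1.
by move=> -> -> ?; lra.
Qed.

Lemma ipqZ c a : D a -> ipq ip (c *: a) = cabs c ^+ 2 * ipq ip a.
Proof.
move=> a1; rewrite {1}/ipq ipZl ?ipZr //; last exact: siZ.
by rewrite mulrA -sqr_cabsC ReMr.
Qed.

Lemma ipqN a : D a -> ipq ip (- a) = ipq ip a.
Proof. by move=> a1; rewrite -scaleN1r ipqZ // cabsN cabs1 expr1n mul1r. Qed.

Lemma ipqD v w : D v -> D w -> Num.sqrt (ipq ip (v + w)) <=
  Num.sqrt (ipq ip v) + Num.sqrt (ipq ip w).
Proof.
move=> v1 w1.
rewrite -ler_sqr ?nnegrE ?addr_ge0 ?sqrtr_ge0 // sqr_sqrtr; last exact/ipq_ge0/siD.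
rewrite sqrrD !sqr_sqrtr ?ipq_ge0 //.
have := ipq_sub (-1) v1 w1.
rewrite scaleN1r opprK conjcN conjc1 mulN1r ReN cabsN cabs1 => ->.
rewrite -sqrtrM ?ipq_ge0 //.
have h : complex.Re (ip v w) <= Num.sqrt (ipq ip v * ipq ip w).
  apply: le_trans (ler_norm _) _; apply: le_trans (cabs_ge_Re _) _.
  rewrite -[cabs _]ger0_norm ?cabs_ge0 // -sqrtr_sqr ler_wsqrtr //.
  exact: ip_CS.
lra.
Qed.

Variables (A : V -> Prop) (sA : subspace_of D A).

Lemma sub_cl v : A v -> si_cl D ip A v.
Proof.
case: sA => A0 AL AD Av; split=> [|e e0]; first exact: AD.
by exists v => //; rewrite subrr /ipq ip0l //; apply: (si0 H).
Qed.

Lemma cl_lin a v w : si_cl D ip A v -> si_cl D ip A w -> si_cl D ip A (a *: v + w).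
Proof.
case: sA => A0 AL AD [Dv hv] [Dw hw]; split; first exact: (siL H).
move=> e e0.
(* [ipqD2] and [ipqZ] give the error [2 |a|^2 x + 2 y] with [x, y < e / k], that is, less than
   [e / 2]. *)
pose k : R := 4 * (1 + cabs a ^+ 2).
have k0 : 0 < k by rewrite /k; have := sqr_ge0 (cabs a); lra.
have [v' Av' hv'] := hv _ (divr_gt0 e0 k0).
have [w' Aw' hw'] := hw _ (divr_gt0 e0 k0).
exists (a *: v' + w'); first exact: AL.
have Dv' := AD _ Av'; have Dw' := AD _ Aw'.
rewrite opprD addrACA -scalerBr.
apply: le_lt_trans (ipqD2 _ _) _; [exact/siZ/siB|exact/siB|].
rewrite ipqZ; last exact/siB.
have : e / k * k = e by rewrite divfK // gt_eqF.
set x := ipq ip (v - v') in hv' *; set y := ipq ip _ in hw' *; set f := e / k in hv' hw' *.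
have x0 : 0 <= x by apply/ipq_ge0/siB.
have f0 : 0 < f by apply: divr_gt0.
have := sqr_ge0 (cabs a); set b := _ ^+ 2 => b0.
rewrite /k -/b => <-; nra.
Qed.

Lemma cl_orth v w : D w -> (forall a, A a -> ip a w = 0) -> si_cl D ip A v -> ip v w = 0.
Proof.
case: sA => A0 AL AD Dw h [Dv hv].
apply: cabs_eq0; apply/eqP; rewrite -sqrf_eq0 eq_le sqr_ge0 andbT.
apply: le0_eps => e e0.
have k0 : 0 < 1 + ipq ip w by have := ipq_ge0 Dw; lra.
have [a Aa ha] := hv _ (divr_gt0 e0 k0).
have Da := AD _ Aa.
have -> : ip v w = ip (v - a) w by rewrite ipBl // (h a Aa) subr0.
apply: le_trans (ip_CS (siB Dv Da) Dw) _.
have : e / (1 + ipq ip w) * (1 + ipq ip w) = e by rewrite divfK // gt_eqF.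
have := ipq_ge0 Dw; have := ipq_ge0 (siB Dv Da).
by move: ha; set x := ipq ip (v - a); set f := e / _ => ? ? ? <-; nra.
Qed.

(** A minimizing sequence in [A] is Cauchy by the parallelogram law, since midpoints stay in [A];
    its limit lies in the closure only. Orthogonality is proved approximately for the terms [u i],
    by [ip_almost_orth], and passed to the limit. *)
Lemma si_projection x : si_complete D ip -> D x ->
  exists2 y, si_cl D ip A y & forall a, A a -> ip (x - y) a = 0.
Proof.
move=> cplt Dx; case: (sA) => A0 AL AD.
pose S := [set ipq ip (x - a) | a in A].
have Slb : lbound S 0 by move=> _ [a Aa <-]; apply/ipq_ge0/siB => //; exact: AD.
have Sinf : has_inf S by split; [exists (ipq ip (x - 0)); exists 0|exists 0].
set d := inf S.
have dle a : A a -> d <= ipq ip (x - a).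
  by move=> Aa; apply: ge_inf; [case: Sinf|exists a].
pose dl (i : nat) : R := i.+1%:R^-1.
have dl0 i : 0 < dl i by rewrite invr_gt0 ltr0n.
have /choice [u hu] : forall i : nat, exists a, A a /\ ipq ip (x - a) < d + dl i.
  move=> i; have [_ [a Aa <-] h] := inf_adherent (dl0 i) Sinf.
  by exists a; split.
have Au i : A (u i) by case: (hu i).
have Du i : D (u i) by apply: AD.
have uq i : ipq ip (x - u i) < d + dl i by case: (hu i).
have dlN (e : R) : 0 < e -> exists N : nat, forall i, (N <= i)%N -> dl i < e.
  move=> e0; exists (Num.truncn e^-1) => i hi.
  rewrite /dl invf_plt ?posrE ?ltr0n //.
  apply: lt_le_trans (truncnS_gt _) _.
  by rewrite ler_nat ltnS.
have par i j : ipq ip (u i - u j) <= 2 * dl i + 2 * dl j.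
  pose v := x - u i; pose w := x - u j.
  have Dv : D v by apply: siB. have Dw : D w by apply: siB.
  have e1 : u i - u j = w - 1 *: v by rewrite /w /v scale1r opprB [RHS]addrC addrA subrK.
  have Am : A (2^-1 *: u i + 2^-1 *: u j).
    have Aj : A (2^-1 *: u j) by rewrite -[_ *: _]addr0; exact: AL.
    exact: (AL _ _ _ (Au i) Aj).
  have e2 : w - (-1) *: v = 2 *: (x - (2^-1 *: u i + 2^-1 *: u j)).
    rewrite scaleN1r opprK /v /w scalerBr scalerDr !scalerA divff ?pnatr_eq0 // !scale1r.
    by rewrite (_ : (2 : C) = 1 + 1) // scalerDl scale1r addrACA [- u j - u i]addrC -opprD.
  have := dle _ Am.
  have h2 : ipq ip (w - (-1) *: v) = 4 * ipq ip (x - (2^-1 *: u i + 2^-1 *: u j)).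
    rewrite e2 ipqZ; last by apply: siB => //; apply: AD.
    have -> : cabs (2 : C) = 2 by apply: complexI; rewrite cabsE normr_nat rmorph_nat.
    by rewrite -natrX.
  have := ipq_sub 1 Dw Dv; have := ipq_sub (-1) Dw Dv; rewrite h2 -e1.
  rewrite conjcN conjc1 !mulN1r !mul1r ReN cabsN cabs1 expr1n !mul1r => h3 -> h4.
  have := uq i; have := uq j; rewrite -/v -/w; lra.
have [y Dy hy] : exists2 l, D l & forall e, 0 < e ->
    exists N : nat, forall i, (N <= i)%N -> ipq ip (u i - l) < e.
  apply: cplt => // e e0.
  have e40 : 0 < e / 4 by rewrite divr_gt0.
  have [N hN] := dlN _ e40; exists N => i j hi hj.
  have := hN _ hi; have := hN _ hj; have := par i j; lra.
have cly : si_cl D ip A y.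
  split=> // e e0; have [N hN] := hy _ e0; exists (u N) => //.
  by rewrite -ipqN ?opprB; [apply: hN|apply: siB].
exists y => // a Aa; have Da := AD _ Aa.
apply: cabs_eq0; apply/eqP; rewrite -sqrf_eq0 eq_le sqr_ge0 andbT.
apply: le0_eps => e e0.
(* [ip (x - y) a] is split at [u i]; each half has square at most [(e / k) * ipq ip a], and
   [sqr_cabsD] doubles their sum. *)
pose k := 4 * (1 + ipq ip a); have qa := ipq_ge0 Da.
have k0 : 0 < k by rewrite /k; lra.
have [N1 hN1] := dlN _ (divr_gt0 e0 k0); have [N2 hN2] := hy _ (divr_gt0 e0 k0).
pose i := maxn N1 N2.
have h1 := hN1 i (leq_maxl _ _); have h2 := hN2 i (leq_maxr _ _).
have -> : ip (x - y) a = ip (x - u i) a + ip (u i - y) a.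
  by rewrite -ipDl ?addrA ?subrK //; apply: siB.
apply: le_trans (sqr_cabsD _ _) _.
have := ip_CS (siB (Du i) Dy) Da.
have : cabs (ip (x - u i) a) ^+ 2 <= dl i * ipq ip a.
  apply: ip_almost_orth => //; first exact: siB.
  move=> c; have : A (c *: a + u i) by apply: AL.
  move=> /dle; rewrite opprD addrA addrAC => h3; have := uq i; lra.
have : e / k * k = e by rewrite divfK // gt_eqF.
move: h1 h2; set f := e / k => h1 h2 <- h3 h4.
have : dl i * ipq ip a <= f * ipq ip a by rewrite ler_wpM2r // ltW.
have : ipq ip (u i - y) * ipq ip a <= f * ipq ip a by rewrite ler_wpM2r // ltW.
have : 0 < f by apply: divr_gt0.
rewrite /k; lra.
Qed.

End Theory.
End SemiInner.

(** * Matrix norms and singular values *)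

Section MatrixNorms.
Variable R : realType.
Local Notation C := (R[i]).

Definition adjmx (m p : nat) (A : 'M[C]_(m, p)) : 'M[C]_(p, m) :=
  \matrix_(i, j) ((A j i)^*)%C.

Lemma adjmxM m p q (A : 'M[C]_(m, p)) (B : 'M[C]_(p, q)) :
  adjmx (A *m B) = adjmx B *m adjmx A.
Proof.
apply/matrixP => i j; rewrite !mxE conjc_sum; apply: eq_bigr => k _.
by rewrite !mxE conjcM mulrC.
Qed.

Lemma adjmxK m p (A : 'M[C]_(m, p)) : adjmx (adjmx A) = A.
Proof. by apply/matrixP => i j; rewrite !mxE conjcK. Qed.

Definition vdot p (v w : 'cV[C]_p) : C := (adjmx v *m w) 0 0.

Lemma vdotE p (v w : 'cV[C]_p) : vdot v w = \sum_i ((v i 0)^*)%C * w i 0.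
Proof. by rewrite /vdot !mxE; apply: eq_bigr => i _; rewrite !mxE. Qed.

Lemma vdot_adj m p (A : 'M[C]_(m, p)) v w : vdot v (A *m w) = vdot (adjmx A *m v) w.
Proof. by rewrite /vdot adjmxM adjmxK mulmxA. Qed.

Lemma sqr_vnorm p (v : 'cV[C]_p) : vnorm v ^+ 2 = \sum_i cabs (v i 0) ^+ 2.
Proof. by rewrite sqr_sqrtr // sumr_ge0 // => i _; rewrite sqr_ge0. Qed.

Lemma vnorm_ge0 p (v : 'cV[C]_p) : 0 <= vnorm v.
Proof. exact: sqrtr_ge0. Qed.

Lemma vdotvv p (v : 'cV[C]_p) : vdot v v = (vnorm v ^+ 2)%:C%C.
Proof.
rewrite vdotE sqr_vnorm realc_sum; apply: eq_bigr => i _.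
by rewrite sqr_cabsC mulrC.
Qed.

Lemma vdot_semi_inner p :
  semi_inner (fun=> True) (fun v w : 'cV[C]_p => vdot w v).
Proof.
split=> //.
- by move=> a u v w _ _ _; rewrite /vdot mulmxDr -scalemxAr !mxE.
- move=> u v _ _; rewrite !vdotE conjc_sum; apply: eq_bigr => i _.
  by rewrite conjcM conjcK mulrC.
- by move=> v _; rewrite vdotvv /= sqr_ge0.
Qed.

Lemma ipq_vdot p (v : 'cV[C]_p) : ipq (fun v w => vdot w v) v = vnorm v ^+ 2.
Proof. by rewrite /ipq vdotvv. Qed.

Lemma cabs_vdot p (v w : 'cV[C]_p) : cabs (vdot v w) <= vnorm v * vnorm w.
Proof.
rewrite -ler_sqr ?nnegrE ?cabs_ge0 ?mulr_ge0 ?vnorm_ge0 // exprMn mulrC.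
by have := ip_CS (vdot_semi_inner p) (I : True) (I : True) (v := w) (w := v); rewrite !ipq_vdot.
Qed.

Lemma vnormD p (v w : 'cV[C]_p) : vnorm (v + w) <= vnorm v + vnorm w.
Proof.
have := ipqD (vdot_semi_inner p) (I : True) (I : True) (v := v) (w := w).
by rewrite !ipq_vdot !sqrtr_sqr !ger0_norm ?vnorm_ge0.
Qed.

Lemma vnormZ p a (v : 'cV[C]_p) : vnorm (a *: v) = cabs a * vnorm v.
Proof.
apply: eq_sqr_ge0; rewrite ?mulr_ge0 ?cabs_ge0 ?vnorm_ge0 // exprMn -!ipq_vdot.
by rewrite (ipqZ (vdot_semi_inner p)).
Qed.

Lemma vnorm0 p : vnorm (0 : 'cV[C]_p) = 0.
Proof. by rewrite -(scale0r 0) vnormZ cabs0 mul0r. Qed.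

Lemma vnorm_eq0 p (v : 'cV[C]_p) : vnorm v = 0 -> v = 0.
Proof.
move=> h; have := sqr_vnorm v; rewrite h expr0n /= => /esym/eqP.
rewrite psumr_eq0 => [/allP h1|i _]; last exact: sqr_ge0.
apply/colP => i; rewrite mxE; apply: cabs_eq0.
by have := h1 i (mem_index_enum i); rewrite /= sqrf_eq0 => /eqP.
Qed.

Lemma cabs_le_vnorm p (v : 'cV[C]_p) i : cabs (v i 0) <= vnorm v.
Proof.
rewrite -ler_sqr ?nnegrE ?cabs_ge0 ?vnorm_ge0 // sqr_vnorm (bigD1 i) //= lerDl.
by apply: sumr_ge0 => j _; exact: sqr_ge0.
Qed.

Lemma vnorm_le_sum p (v : 'cV[C]_p) : vnorm v <= \sum_i cabs (v i 0).
Proof.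
rewrite -ler_sqr ?nnegrE ?vnorm_ge0 ?sumr_ge0 // => [|i _]; last exact: cabs_ge0.
rewrite sqr_vnorm expr2 mulr_suml; apply: ler_sum => i _; rewrite expr2.
apply: ler_wpM2l; first exact: cabs_ge0.
by rewrite (bigD1 i) //= lerDl sumr_ge0 // => j _; exact: cabs_ge0.
Qed.

Lemma vnorm_isometry m p (W : 'M[C]_(m, p)) (y : 'cV[C]_p) :
  adjmx W *m W = 1%:M -> vnorm (W *m y) = vnorm y.
Proof.
move=> h; apply: eq_sqr_ge0; rewrite ?vnorm_ge0 //; apply: complexI.
by rewrite -!vdotvv vdot_adj mulmxA h mul1mx.
Qed.

(** A crude norm whose measurability follows from that of the entries; [opnorm], [sing] and [trnorm]
    are all controlled by it. *)
Definition entsum m p (A : 'M[C]_(m, p)) : R := \sum_i \sum_j cabs (A i j).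

Lemma vnorm_mulmx_entsum m p (A : 'M[C]_(m, p)) v :
  vnorm (A *m v) <= entsum A * vnorm v.
Proof.
apply: le_trans (vnorm_le_sum _) _; rewrite /entsum mulr_suml.
apply: ler_sum => i _; rewrite mxE; apply: le_trans (cabs_sum _ _ _) _.
rewrite mulr_suml; apply: ler_sum => j _; rewrite cabsM.
by rewrite ler_wpM2l ?cabs_ge0 ?cabs_le_vnorm.
Qed.

Lemma entsum_ge0 m p (A : 'M[C]_(m, p)) : 0 <= entsum A.
Proof. by rewrite sumr_ge0 // => i _; rewrite sumr_ge0 // => j _; apply: cabs_ge0. Qed.

Lemma opnorm_has_sup m p (A : 'M[C]_(m, p)) :
  has_sup [set vnorm (A *m v) | v in [set v : 'cV[C]_p | vnorm v <= 1]].
Proof.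
split; first by exists (vnorm (A *m 0)); exists 0; rewrite //= vnorm0 ler01.
exists (entsum A) => _ [v /= v1 <-]; apply: le_trans (vnorm_mulmx_entsum _ _) _.
by rewrite ler_piMr // entsum_ge0.
Qed.

Lemma vnorm_mulmx m p (A : 'M[C]_(m, p)) v : vnorm (A *m v) <= opnorm A * vnorm v.
Proof.
have [v0|vn] := eqVneq (vnorm v) 0.
  by rewrite (vnorm_eq0 v0) mulmx0 !vnorm0 mulr0.
have vp : 0 < vnorm v by rewrite lt0r vn vnorm_ge0.
rewrite -ler_pdivrMr // mulrC.
have := sup_upper_bound (opnorm_has_sup A); apply.
have cV : cabs ((vnorm v)^-1%:C%C) = (vnorm v)^-1 by rewrite cabsr ger0_norm ?invr_ge0 ?ltW.
exists ((vnorm v)^-1%:C%C *: v); rewrite /= -?scalemxAr vnormZ cV //.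
by rewrite mulVf.
Qed.

Lemma opnorm_le m p (A : 'M[C]_(m, p)) c : 0 <= c ->
  (forall v, vnorm (A *m v) <= c * vnorm v) -> opnorm A <= c.
Proof.
move=> c0 h; apply: ge_sup; first by case: (opnorm_has_sup A).
move=> _ [v /= v1 <-]; apply: le_trans (h v) _.
by rewrite ler_piMr.
Qed.

Lemma opnorm_ge0 m p (A : 'M[C]_(m, p)) : 0 <= opnorm A.
Proof.
have := sup_upper_bound (opnorm_has_sup A); apply; exists 0; rewrite /= ?vnorm0 //.
by rewrite mulmx0 vnorm0.
Qed.

Lemma opnorm_entsum m p (A : 'M[C]_(m, p)) : opnorm A <= entsum A.
Proof. by apply: opnorm_le => [|v]; [exact: entsum_ge0|exact: vnorm_mulmx_entsum]. Qed.

Lemma cabs_le_opnorm m p (A : 'M[C]_(m, p)) i j : cabs (A i j) <= opnorm A.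
Proof.
have h : vnorm (delta_mx j 0 : 'cV[C]_p) = 1.
  apply: eq_sqr_ge0; rewrite ?vnorm_ge0 // expr1n sqr_vnorm (bigD1 j) //=.
  rewrite mxE !eqxx cabs1 expr1n big1 ?addr0 // => k kj.
  by rewrite mxE (negbTE kj) /= cabs0 expr0n.
have := vnorm_mulmx A (delta_mx j 0); rewrite h mulr1; apply: le_trans.
by rewrite -colE; apply: le_trans (cabs_le_vnorm _ i); rewrite mxE.
Qed.

Lemma opnormD m p (A B : 'M[C]_(m, p)) : opnorm (A + B) <= opnorm A + opnorm B.
Proof.
apply: opnorm_le => [|v]; first by rewrite addr_ge0 ?opnorm_ge0.
rewrite mulmxDl mulrDl; apply: le_trans (vnormD _ _) _.
by rewrite lerD ?vnorm_mulmx.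
Qed.

Lemma opnormM m p q (A : 'M[C]_(m, p)) (B : 'M[C]_(p, q)) :
  opnorm (A *m B) <= opnorm A * opnorm B.
Proof.
apply: opnorm_le => [|v]; first by rewrite mulr_ge0 ?opnorm_ge0.
rewrite -mulmxA -mulrA; apply: le_trans (vnorm_mulmx _ _) _.
by rewrite ler_wpM2l ?opnorm_ge0 ?vnorm_mulmx.
Qed.

Lemma opnormZ m p a (A : 'M[C]_(m, p)) : opnorm (a *: A) = cabs a * opnorm A.
Proof.
have le1 b (B : 'M[C]_(m, p)) : opnorm (b *: B) <= cabs b * opnorm B.
  apply: opnorm_le => [|v]; first by rewrite mulr_ge0 ?opnorm_ge0 ?cabs_ge0.
  by rewrite -scalemxAl vnormZ -mulrA ler_wpM2l ?cabs_ge0 ?vnorm_mulmx.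
have [->|a0] := eqVneq a 0.
  rewrite cabs0 mul0r; apply/eqP; rewrite eq_le opnorm_ge0 andbT.
  by have := le1 0 A; rewrite cabs0 mul0r.
apply/eqP; rewrite eq_le le1 /=.
have a1 : 0 < cabs a.
  by rewrite lt0r cabs_ge0 andbT; apply/eqP => /cabs_eq0/eqP; rewrite (negbTE a0).
rewrite mulrC -ler_pdivlMr // mulrC.
have := le1 a^-1 (a *: A); rewrite scalerA mulVf // scale1r.
suff -> : cabs a^-1 = (cabs a)^-1 by [].
by apply: complexI; rewrite cabsE normfV -cabsE -rmorphV //= unitfE gt_eqF.
Qed.

Lemma opnorm_isometry m p (W : 'M[C]_(m, p)) : adjmx W *m W = 1%:M -> opnorm W <= 1.
Proof. by move=> h; apply: opnorm_le => // v; rewrite vnorm_isometry // mul1r. Qed.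

(** With [x = adjmx W *m v], the square of [vnorm x] is the product of [v] with [W *m x], a vector
    of norm [vnorm x]; Cauchy-Schwarz and a division finish. *)
Lemma vnorm_adj_isometry m p (W : 'M[C]_(m, p)) v : adjmx W *m W = 1%:M ->
  vnorm (adjmx W *m v) <= vnorm v.
Proof.
move=> h; have [-> //|xn] := eqVneq (vnorm (adjmx W *m v)) 0; first exact: vnorm_ge0.
have xp : 0 < vnorm (adjmx W *m v) by rewrite lt0r xn vnorm_ge0.
rewrite -(ler_pM2l xp) -expr2 -[leLHS]ger0_norm ?sqr_ge0 // -cabsr -vdotvv.
rewrite -vdot_adj mulmxA.
rewrite -[X in X * _](vnorm_isometry (adjmx W *m v) h) mulrC mulmxA.
exact: cabs_vdot.
Qed.

Lemma opnorm_adj_isometry m p (W : 'M[C]_(m, p)) :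
  adjmx W *m W = 1%:M -> opnorm (adjmx W) <= 1.
Proof. by move=> h; apply: opnorm_le => // v; rewrite mul1r vnorm_adj_isometry. Qed.

Lemma opnorm0 m p : opnorm (0 : 'M[C]_(m, p)) = 0.
Proof. by rewrite -(scale0r 0) opnormZ cabs0 mul0r. Qed.

Lemma opnorm_eq0 m p (A : 'M[C]_(m, p)) : opnorm A = 0 -> A = 0.
Proof.
move=> h; apply/matrixP => i j; rewrite mxE; apply/cabs_eq0/eqP.
by rewrite eq_le cabs_ge0 -h cabs_le_opnorm.
Qed.

Lemma sing_le m p j (A B : 'M[C]_(m, p)) : (\rank B <= j)%N -> sing j A <= opnorm (A - B).
Proof.
move=> rB; apply: ge_inf; last by exists B.
by exists 0 => _ [X _ <-]; apply: opnorm_ge0.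
Qed.

Lemma sing_ge m p j (A : 'M[C]_(m, p)) c :
  (forall B : 'M[C]_(m, p), (\rank B <= j)%N -> c <= opnorm (A - B)) -> c <= sing j A.
Proof.
move=> h; apply: lb_le_inf => [|_ [B rB <-]]; last exact: h.
by exists (opnorm (A - 0)); exists 0 => //=; rewrite mxrank0.
Qed.

Lemma sing_ge0 m p j (A : 'M[C]_(m, p)) : 0 <= sing j A.
Proof. by apply: sing_ge => B _; apply: opnorm_ge0. Qed.

Lemma sing_rank m p j (A : 'M[C]_(m, p)) : (\rank A <= j)%N -> sing j A = 0.
Proof.
move=> rA; apply/eqP; rewrite eq_le sing_ge0 andbT.
by apply: le_trans (sing_le _ rA) _; rewrite subrr opnorm0.
Qed.

Lemma sing_opnorm m p j (A : 'M[C]_(m, p)) : sing j A <= opnorm A.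
Proof. by rewrite -[A in leRHS]subr0; apply: sing_le; rewrite mxrank0. Qed.

(** An approximant of [B] also serves [A]. This Lipschitz bound is what makes [sing] measurable
    along a measurable matrix function. *)
Lemma sing_lip m p j (A B : 'M[C]_(m, p)) : sing j A <= sing j B + opnorm (A - B).
Proof.
rewrite -lerBlDr; apply: sing_ge => X rX; rewrite lerBlDr.
apply: le_trans (sing_le _ rX) _; apply: le_trans (opnormD _ _).
by rewrite [B - X + _]addrC addrA subrK.
Qed.

Lemma sing_mulmx m p q j (A : 'M[C]_(m, p)) (B : 'M[C]_(p, q)) :
  sing j (A *m B) <= sing j A * opnorm B.
Proof.
have [B0|Bn] := eqVneq (opnorm B) 0.
  by rewrite (opnorm_eq0 B0) mulmx0 opnorm0 mulr0 sing_rank // mxrank0.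
have Bp : 0 < opnorm B by rewrite lt0r Bn opnorm_ge0.
rewrite -ler_pdivrMr //; apply: sing_ge => X rX; rewrite ler_pdivrMr //.
apply: le_trans (opnormM _ _); rewrite mulmxBl; apply: sing_le.
by apply: leq_trans (mxrankM_maxl _ _) rX.
Qed.

Lemma trnorm_ge0 m p (A : 'M[C]_(m, p)) : 0 <= trnorm A.
Proof. by apply: sumr_ge0 => i _; apply: sing_ge0. Qed.

(** The spectral theorem lists eigenvalues in no particular order, whereas [sing] counts from the
    largest. *)
Lemma sort_ord_perm p (f : 'I_p -> R) :
  exists2 s : 'I_p -> 'I_p, injective s & forall i j : 'I_p, (i <= j)%N -> f (s j) <= f (s i).
Proof.
pose leT : rel 'I_p := fun a b => f b <= f a.
have leT_tr : transitive leT by move=> b a c h1 h2; exact: le_trans h2 h1.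
have leT_rf : reflexive leT by move=> a; rewrite /leT.
have leT_tot : total leT by move=> a b; rewrite /leT le_total.
pose t := sort_tuple leT (ord_tuple p).
exists (tnth t).
  apply/tuple_uniqP; rewrite /= sort_uniq; exact: enum_uniq.
move=> i j ij; pose x0 := tnth t i; rewrite !(tnth_nth x0).
have := sorted_leq_nth leT_tr leT_rf x0 (sort_sorted leT_tot (ord_tuple p)).
by apply => //; rewrite inE size_sort size_tuple.
Qed.

(* The squared singular values are kept real and ordered decreasingly, as the
   diagonal entries [s i ^+ 2] of [W^* A^* A W]. *)
Lemma right_singular_basis m p (A : 'M[C]_(m, p)) :
  exists (W : 'M[C]_p) (s : 'I_p -> R),
    [/\ adjmx W *m W = 1%:M, W *m adjmx W = 1%:M,
        forall y : 'cV_p, vnorm (A *m (W *m y)) ^+ 2 = \sum_i s i ^+ 2 * cabs (y i 0) ^+ 2,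
        forall i, 0 <= s i
      & forall i j : 'I_p, (i <= j)%N -> s j <= s i].
Proof.
pose H := adjmx A *m A.
have Hh : H \is hermsymmx.
  apply/is_hermitianmxP; rewrite expr0 scale1r.
  by rewrite -[LHS](adjmxK) {1}/H adjmxM adjmxK; apply/matrixP => i j; rewrite !mxE.
have /hermitian_normalmx/orthomx_spectralP := Hh.
set P := spectralmx H; set d := spectral_diag H => HE.
have uP : P \is unitarymx by apply: spectral_unitarymx.
have adjP : adjmx P = invmx P.
  by rewrite invmx_unitary //; apply/matrixP => i j; rewrite !mxE.
have [s0 s0i s0s] := sort_ord_perm (fun i => complex.Re (d 0 i)).
pose W : 'M[C]_p := \matrix_(i, j) adjmx P i (s0 j).
have Pu := spectral_unit H.
have PP : P *m adjmx P = 1%:M by rewrite adjP mulmxV.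
have WW : adjmx W *m W = 1%:M.
  apply/matrixP => i j; have /matrixP/(_ (s0 i) (s0 j)) := PP.
  rewrite !mxE (inj_eq s0i) => <-; apply: eq_bigr => k _.
  by rewrite !mxE conjcK.
have W2 : W *m adjmx W = 1%:M by apply: mulmx1C.
have WHW : adjmx W *m H *m W = diag_mx (\row_j d 0 (s0 j)).
  apply/matrixP => i j.
  have : P *m H *m adjmx P = diag_mx d.
    by rewrite HE adjP -!mulmxA mulmxV // mulmx1 !mulmxA mulmxV // mul1mx.
  move=> /matrixP/(_ (s0 i) (s0 j)).
  rewrite !mxE (inj_eq s0i) => <-; apply: eq_bigr => k _.
  rewrite !mxE; congr (_ * _); apply: eq_bigr => l _.
  by rewrite !mxE conjcK.
have nq (y : 'cV_p) : (vnorm (A *m (W *m y)) ^+ 2)%:C%C = \sum_i d 0 (s0 i) * (cabs (y i 0) ^+ 2)%:C%C.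
  rewrite -vdotvv vdot_adj /vdot adjmxM mulmxA.
  have -> : adjmx (A *m (W *m y)) *m adjmx (adjmx A) *m W *m y = adjmx y *m (adjmx W *m H *m W *m y).
    by rewrite /H !adjmxM adjmxK !mulmxA.
  rewrite WHW mxE; apply: eq_bigr => i _; rewrite !mxE (bigD1 i) //= big1 ?addr0.
    by rewrite !mxE eqxx mulr1n sqr_cabsC mulrCA [((y i 0)^*)%C * _]mulrC.
  by move=> k ki; rewrite !mxE eq_sym (negbTE ki) mul0r.
(* Each eigenvalue is the square of the norm of [A] applied to a column of [W]; taking these norms
   as singular values makes them real and nonnegative at once. *)
have dv i : d 0 (s0 i) = (vnorm (A *m (W *m delta_mx i 0)) ^+ 2)%:C%C.
  rewrite nq (bigD1 i) //= big1 ?addr0 => [|k ki].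
    by rewrite mxE !eqxx cabs1 expr1n mulr1.
  by rewrite mxE (negbTE ki) cabs0 expr0n mulr0.
exists W, (fun i => vnorm (A *m (W *m delta_mx i 0))); split; [exact: WW|exact: W2| | |].
- move=> y; apply: complexI; rewrite nq realc_sum; apply: eq_bigr => i _.
  by rewrite dv realcM.
- by move=> i; apply: vnorm_ge0.
- move=> i j ij; have := s0s _ _ ij; rewrite !dv => h.
  by apply: le_sqr_ge0; [exact: vnorm_ge0|exact: vnorm_ge0|exact: h].
Qed.

(** The dimension count of Courant and Fischer: a matrix of rank at most [i] kills a nonzero
    combination [W *m y] of the first [i + 1] right singular vectors. On it [A] stretches by at
    least [s i], because the weights of these coordinates are at least [s i ^+ 2] and the other
    coordinates vanish. *)
Lemma sing_ge_right_singular m p (A : 'M[C]_(m, p)) (W : 'M[C]_p) (s : 'I_p -> R) :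
  adjmx W *m W = 1%:M ->
  (forall y : 'cV_p, vnorm (A *m (W *m y)) ^+ 2 = \sum_i s i ^+ 2 * cabs (y i 0) ^+ 2) ->
  (forall i, 0 <= s i) ->
  (forall i j : 'I_p, (i <= j)%N -> s j <= s i) ->
  forall i : 'I_p, s i <= sing i A.
Proof.
move=> WW Aq s0 sd i; apply: sing_ge => B rB.
(* [S] embeds the first [i + 1] coordinates; [X] has [i + 1] rows and rank at most [i], which yields
   the row [c] with [c *m X = 0]. *)
pose S : 'M[C]_(i.+1, p) := \matrix_(a, b) ((a : nat) == b)%:R.
pose X : 'M[C]_(i.+1, m) := S *m (B *m W)^T.
have : kermx X != 0.
  rewrite -mxrank_eq0 mxrank_ker subn_eq0 -ltnNge ltnS.
  apply: leq_trans (mxrankM_maxr _ _) _; rewrite mxrank_tr.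
  exact: leq_trans (mxrankM_maxl _ _) rB.
case/rowV0Pn => c /sub_kermxP cX c0.
pose y : 'cV[C]_p := (c *m S)^T.
have By : B *m (W *m y) = 0.
  by apply: trmx_inj; rewrite trmx0 mulmxA trmx_mul trmxK -mulmxA.
have yE (b : 'I_p) : y b 0 = if insub (b : nat) is Some a then c 0 a else 0.
  rewrite !mxE; case: insubP => [a _ ab|nb].
    rewrite (bigD1 a) //= big1 ?addr0 ?mxE ?ab ?eqxx ?mulr1 // => k ka.
    rewrite mxE -ab; have -> : ((k : nat) == a) = false by apply/negbTE.
    by rewrite mulr0.
  rewrite big1 // => k _; rewrite mxE.
  have -> : ((k : nat) == b) = false; last by rewrite mulr0.
  by apply/negbTE; apply: contra nb => /eqP <-.
have y0 : 0 < vnorm y.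
  rewrite lt0r vnorm_ge0 andbT; apply/eqP => /vnorm_eq0 y0.
  case/negP: c0; apply/eqP/rowP => a; rewrite [RHS]mxE.
  have ha : (a < p)%N by apply: leq_trans (ltn_ord a) (ltn_ord i).
  have := yE (Ordinal ha); rewrite y0 mxE; case: insubP => /= [b _ ba|].
    by move=> ->; congr (c 0 _); apply: val_inj.
  by rewrite ltn_ord.
rewrite -(ler_pM2r y0) -[X in _ <= _ * X](vnorm_isometry y WW).
apply: le_trans (vnorm_mulmx _ _); rewrite mulmxBl By subr0.
rewrite -ler_sqr ?nnegrE ?mulr_ge0 ?vnorm_ge0 // exprMn Aq sqr_vnorm mulr_sumr.
apply: ler_sum => b _; have [bi|ib] := leqP b i.
  by apply: ler_wpM2r; rewrite ?sqr_ge0 // ler_sqr ?nnegrE // sd.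
rewrite yE; case: insubP => [a|_]; last by rewrite cabs0 expr0n !mulr0.
by rewrite ltnS leqNgt ib.
Qed.

(** Computed in a right singular basis, the trace is a sum of [p] products of a unit vector with
    [B A w], each at most [opnorm B * s i]. Only the inequality [s i <= sing i A] is required. *)
Lemma cabs_tr_le m p (A : 'M[C]_(m, p)) (B : 'M[C]_(p, m)) :
  cabs (\tr (A *m B)) <= (\sum_(j < p) sing j A) * opnorm B.
Proof.
have [W [s [WW W2 Aq s0 sd]]] := right_singular_basis A.
have sv i : vnorm (A *m (W *m delta_mx i 0)) = s i.
  apply: eq_sqr_ge0; rewrite ?vnorm_ge0 // Aq (bigD1 i) //= big1 ?addr0 => [|k ki].
    by rewrite mxE !eqxx cabs1 expr1n mulr1.
  by rewrite mxE (negbTE ki) cabs0 expr0n mulr0.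
have -> : \tr (A *m B) = \sum_i vdot (W *m delta_mx i 0) (B *m (A *m (W *m delta_mx i 0))).
  rewrite mxtrace_mulC -[B *m A]mulmx1 -W2 mulmxA mxtrace_mulC mulmxA.
  apply: eq_bigr => i _; rewrite /vdot adjmxM !mulmxA.
  have -> : adjmx (delta_mx i 0) = delta_mx 0 i :> 'rV[C]_p.
    by apply/matrixP => a b; rewrite !mxE andbC conjc_nat.
  have E (M : 'M[C]_p) : M i i = ((delta_mx 0 i : 'rV_p) *m M *m (delta_mx i 0 : 'cV_p)) 0 0.
    by rewrite -colE -rowE !mxE.
  by rewrite E !mulmxA.
apply: le_trans (cabs_sum _ _ _) _; rewrite mulr_suml; apply: ler_sum => i _.
apply: le_trans (cabs_vdot _ _) _.
have -> : vnorm (W *m delta_mx i 0) = 1.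
  rewrite vnorm_isometry //; apply: eq_sqr_ge0; rewrite ?vnorm_ge0 // expr1n.
  rewrite sqr_vnorm (bigD1 i) //= big1 ?addr0 => [|k ki]; first by rewrite mxE !eqxx cabs1 expr1n.
  by rewrite mxE (negbTE ki) cabs0 expr0n.
rewrite mul1r mulrC; apply: le_trans (vnorm_mulmx _ _) _; rewrite sv.
by rewrite ler_wpM2l ?opnorm_ge0 // (sing_ge_right_singular WW Aq).
Qed.

(** An infimum equal to 0 gives no approximant by itself. The singular basis does: the vectors of
    index at least [r] are killed by [A], so [A] factors through the first [r]. With [sing_rank],
    this turns a rank condition into a condition on a measurable function. *)
Lemma rank_sing0 m p r (A : 'M[C]_(m, p)) : sing r A = 0 -> (\rank A <= r)%N.
Proof.
move=> h; have [W [s [WW W2 Aq s0 sd]]] := right_singular_basis A.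
have [pr|rp] := leqP p r; first by apply: leq_trans pr; apply: rank_leq_col.
have sr : s (Ordinal rp) = 0.
  apply/eqP; rewrite eq_le s0 andbT -[leRHS]h.
  exact: (sing_ge_right_singular WW Aq s0 sd (Ordinal rp)).
have sz (i : 'I_p) : (r <= i)%N -> s i = 0.
  by move=> ri; apply/eqP; rewrite eq_le s0 andbT -sr sd.
have AW : A *m W = A *m W *m pid_mx r.
  apply/matrixP => i j; rewrite [RHS]mxE (bigD1 j) //= big1 ?addr0 => [|k kj].
    rewrite [pid_mx _ _ _]mxE eqxx /=; have [jr|rj] := ltnP; first by rewrite mulr1.
    rewrite mulr0; have : vnorm (A *m (W *m delta_mx j 0)) ^+ 2 = 0.
      rewrite Aq big1 // => k _; rewrite mxE; have [->|kj] := eqVneq k j.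
        by rewrite sz // expr0n mul0r.
      by rewrite cabs0 expr0n mulr0.
    move=> /eqP; rewrite sqrf_eq0 => /eqP/vnorm_eq0; rewrite mulmxA -colE.
    by move=> /colP/(_ i); rewrite mxE mxE => ->; rewrite mxE.
  by rewrite [pid_mx _ _ _]mxE (negbTE (_ : k != j :> nat)) // mulr0.
have -> : A = A *m W *m pid_mx r *m adjmx W by rewrite -AW -mulmxA W2 mulmx1.
apply: leq_trans (mxrankM_maxl _ _) _; apply: leq_trans (mxrankM_maxr _ _) _.
by rewrite rank_pid_mx // ltnW.
Qed.

(** Let the columns of [Q] be an orthonormal basis of the column space of [B]. Then [B = Q (Q^* B)],
    and [A Q] has only [\rank B] columns, so the sum in [cabs_tr_le] stops there. *)
Lemma cabs_tr_le_rank m p r (A : 'M[C]_(m, p)) (B : 'M[C]_(p, m)) :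
  (\rank B <= r)%N -> cabs (\tr (A *m B)) <= (\sum_(j < r) sing j A) * opnorm B.
Proof.
move=> rB; set r' := \rank B^T.
pose U : 'M[C]_(r', p) := schmidt (row_base B^T).
have rB' : r' = \rank B by apply: mxrank_tr.
have rp : (r' <= p)%N by rewrite /r'; apply: rank_leq_col.
have uU : U \is unitarymx by apply: schmidt_unitarymx.
have /submxP[Z BZ] : (B^T <= U)%MS.
  by rewrite (eqmx_schmidt_free (row_base_free _)) eq_row_base.
have UU : U *m adjmx U = 1%:M.
  by have /unitarymxP := uU; apply: etrans; congr mulmx; apply/matrixP => i j; rewrite !mxE.
pose Q : 'M[C]_(p, r') := U^T.
have aQ : adjmx Q = (adjmx U)^T by apply/matrixP => i j; rewrite !mxE.
have QQ : adjmx Q *m Q = 1%:M.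
  by rewrite aQ /Q -trmx_mul UU trmx1.
have BE : B = Q *m (adjmx Q *m B).
  apply: trmx_inj; rewrite !trmx_mul aQ /Q !trmxK BZ -!mulmxA (mulmxA U) UU.
  by rewrite mul1mx.
rewrite {1}BE mulmxA; apply: le_trans (cabs_tr_le _ _) _.
apply: ler_pM; rewrite ?opnorm_ge0 //.
- by apply: sumr_ge0 => i _; apply: sing_ge0.
- apply: (@le_trans _ _ (\sum_(j < r') sing j A)).
    apply: ler_sum => j _; apply: le_trans (sing_mulmx _ _ _) _.
    by rewrite ler_piMr ?sing_ge0 ?opnorm_isometry.
  rewrite (big_ord_widen r (fun j => sing j A)) ?rB' //.
  by rewrite [leRHS](bigID (fun i : 'I_r => (i < \rank B)%N)) /= lerDl sumr_ge0 // => j _; rewrite sing_ge0.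
- apply: le_trans (opnormM _ _) _.
  by rewrite ler_piMl ?opnorm_ge0 ?opnorm_adj_isometry.
Qed.

End MatrixNorms.

(** * Integrals and Fourier coefficients on the circle *)

Section ComplexIntegral.
Variable R : realType.
Local Notation C := (R[i]).
Local Notation mu := (@lebesgue_measure R).
Local Notation T := (@T01 R).
Implicit Types (f g : R -> C).

(* The Borel structure carried by [R] and the one on which [lebesgue_measure] is
   defined differ by their display; everything is transported to the latter. *)
Definition rmeas (p : R -> R) : Prop := @measurable_fun _ _ (measurableTypeR R) R T p.

Lemma measurable_T01 : @measurable _ (measurableTypeR R) T.
Proof. exact: measurable_itv. Qed.
Hint Resolve measurable_T01 : core.

Lemma mu_T01 : mu T = 1%E.
Proof. by rewrite /T01 lebesgue_measure_itv /= lte_fin ltr01 sube0. Qed.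

Definition aeT (P : R -> Prop) : Prop := {ae mu, forall t, T t -> P t}.

Lemma aeT_S (P Q : R -> Prop) : (forall t, T t -> P t -> Q t) -> aeT P -> aeT Q.
Proof. move=> h; apply: (@filterS _ _ (ae_filter_ringOfSetsType mu)) => t ht Tt; by apply: h => //; apply: ht. Qed.

Lemma aeT_I (P Q : R -> Prop) : aeT P -> aeT Q -> aeT (fun t => P t /\ Q t).
Proof.
move=> hP hQ; apply: (@filterS2 _ _ (ae_filter_ringOfSetsType mu) _ _ _ _ hP hQ) => t h1 h2 Tt.
by split; [apply: h1|apply: h2].
Qed.

Lemma aeT_W (P : R -> Prop) : (forall t, T t -> P t) -> aeT P.
Proof. by rewrite /aeT => h; apply: aeW. Qed.

Lemma aeT_nat (P : nat -> R -> Prop) : (forall i, aeT (P i)) -> aeT (fun t => forall i, P i t).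
Proof.
move=> h; have /ae_foralln : forall i, {ae mu, forall t, T t -> P i t} by exact: h.
by apply: filterS => t ht Tt i; apply: ht.
Qed.

Lemma aeT_fin (I : finType) (P : I -> R -> Prop) :
  (forall i, aeT (P i)) -> aeT (fun t => forall i, P i t).
Proof.
move=> h; have := @aeT_nat (fun j t => if insub j is Some r then P (enum_val (r : 'I_#|I|)) t else True).
have h' j : aeT (fun t => if insub j is Some r then P (enum_val (r : 'I_#|I|)) t else True).
  by case: insub => [r|]; [apply: h|apply: aeT_W].
move=> /(_ h'); apply: aeT_S => t _ ht i.
by have := ht (enum_rank i); rewrite valK enum_rankK.
Qed.

Lemma aeT_negligible (P : R -> Prop) : aeT P <-> mu.-negligible (T `&` [set t | ~ P t]).
Proof.
have -> : T `&` [set t | ~ P t] = ~` [set t | T t -> P t].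
  by apply/seteqP; split=> t /= => [[Tt nP] h|/not_implyP[]//]; apply/nP/h.
by [].
Qed.

Lemma aeT_ex (P : R -> Prop) : aeT P -> exists2 t, T t & P t.
Proof.
move=> h; apply: contrapT => nP.
have : mu.-negligible T.
  move/aeT_negligible: h; apply: negligibleS => t Tt; split=> //= Pt.
  by apply: nP; exists t.
by move=> /(negligibleP _ measurable_T01); rewrite [X in X = _]mu_T01 => /eqP; rewrite onee_eq0.
Qed.

Lemma cmeas_cst (z : C) : cmeas (fun=> z).
Proof. by split; apply: measurable_cst. Qed.

Lemma cmeasD f g : cmeas f -> cmeas g -> cmeas (fun t => f t + g t).
Proof.
move=> [f1 f2] [g1 g2]; split.
  by under eq_fun do rewrite ReD; apply: measurable_funD.
by under eq_fun do rewrite ImD; apply: measurable_funD.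
Qed.

Lemma cmeasM f g : cmeas f -> cmeas g -> cmeas (fun t => f t * g t).
Proof.
move=> [f1 f2] [g1 g2]; split.
  by under eq_fun do rewrite ReM; apply: measurable_funB; apply: measurable_funM.
by under eq_fun do rewrite ImM; apply: measurable_funD; apply: measurable_funM.
Qed.

Lemma cmeasJ f : cmeas f -> cmeas (fun t => ((f t)^*)%C).
Proof.
move=> [f1 f2]; split; first by under eq_fun do rewrite ReJ.
by under eq_fun do rewrite ImJ; apply: measurable_funN.
Qed.

Lemma cmeasZ (z : C) f : cmeas f -> cmeas (fun t => z * f t).
Proof. by move=> ?; apply: cmeasM => //; apply: cmeas_cst. Qed.

Lemma cmeasN f : cmeas f -> cmeas (fun t => - f t).
Proof. by move=> ?; under eq_fun do rewrite -mulN1r; apply: cmeasZ. Qed.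

Lemma cmeasB f g : cmeas f -> cmeas g -> cmeas (fun t => f t - g t).
Proof. by move=> *; apply: cmeasD => //; apply: cmeasN. Qed.

Lemma cmeas_sum (I : Type) (r : seq I) (P : pred I) (F : I -> R -> C) :
  (forall i, cmeas (F i)) -> cmeas (fun t => \sum_(i <- r | P i) F i t).
Proof.
move=> h; elim: r => [|i r ih].
  by under eq_fun do rewrite big_nil; apply: cmeas_cst.
under eq_fun do rewrite big_cons; case: (P i) => //.
by apply: cmeasD.
Qed.

Lemma cmeas_real (p : R -> R) : rmeas p -> cmeas (fun t => (p t)%:C%C).
Proof. by move=> mp; split=> //=; apply: measurable_cst. Qed.

Lemma rmeas_sqrt (p : R -> R) : rmeas p -> rmeas (fun t => Num.sqrt (p t)).
Proof.
have m : measurable_fun setT (@Num.sqrt R).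
  by apply: continuous_measurable_fun; apply: sqrt_continuous.
by move=> mp; exact: (measurableT_comp m mp).
Qed.

Lemma rmeas_Re f : cmeas f -> rmeas (fun t => complex.Re (f t)).
Proof. by case. Qed.

Lemma rmeas_Im f : cmeas f -> rmeas (fun t => complex.Im (f t)).
Proof. by case. Qed.

Lemma rmeasD (p q : R -> R) : rmeas p -> rmeas q -> rmeas (fun t => p t + q t).
Proof. exact: measurable_funD. Qed.

Lemma rmeasB (p q : R -> R) : rmeas p -> rmeas q -> rmeas (fun t => p t - q t).
Proof. exact: measurable_funB. Qed.

Lemma rmeasM (p q : R -> R) : rmeas p -> rmeas q -> rmeas (fun t => p t * q t).
Proof. exact: measurable_funM. Qed.

Lemma rmeasX n (p : R -> R) : rmeas p -> rmeas (fun t => p t ^+ n).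
Proof. exact: measurable_funX. Qed.

Lemma rmeas_cst c : rmeas (fun=> c).
Proof. exact: measurable_cst. Qed.

Lemma rmeas_sum (I : Type) (r : seq I) (P : pred I) (F : I -> R -> R) :
  (forall i, rmeas (F i)) -> rmeas (fun t => \sum_(i <- r | P i) F i t).
Proof.
move=> h; elim: r => [|i r ih].
  by under eq_fun do rewrite big_nil; apply: rmeas_cst.
under eq_fun do rewrite big_cons; case: (P i) => //.
exact: rmeasD.
Qed.

Lemma rmeas_cabs f : cmeas f -> rmeas (fun t => cabs (f t)).
Proof.
move=> mf; apply: rmeas_sqrt.
by apply: rmeasD; apply: rmeasX; [exact: rmeas_Re|exact: rmeas_Im].
Qed.

Definition rint (p : R -> R) : Prop := mu.-integrable T (EFin \o (p : measurableTypeR R -> R)).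

Lemma rint_le (p q : R -> R) : rmeas p ->
  (forall t, T t -> `|p t| <= q t) -> rint q -> rint p.
Proof.
move=> mp h iq; apply: le_integrable iq => //; first exact/measurable_EFinP.
by move=> t Tt /=; rewrite lee_fin; apply: le_trans (h _ Tt) (ler_norm _).
Qed.

Lemma rint_ge0P (p : R -> R) : rmeas p -> (forall t, T t -> 0 <= p t) ->
  rint p <-> (\int[mu]_(t in T) (p t)%:E < +oo)%E.
Proof.
move=> mp p0; have E : (\int[mu]_(t in T) `|(EFin \o p) t| = \int[mu]_(t in T) (p t)%:E)%E.
  by apply: eq_integral => t /set_mem Tt /=; rewrite ger0_norm ?p0.
split=> [/integrableP[_]|h]; first by rewrite E.
by apply/integrableP; split; [exact/measurable_EFinP|rewrite E].
Qed.

Lemma rint_meas (p : R -> R) : rint p -> rmeas p.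
Proof. by move=> /(measurable_int mu)/measurable_EFinP. Qed.

Lemma rintD (p q : R -> R) : rint p -> rint q -> rint (fun t => p t + q t).
Proof.
move=> ip iq; have := integrableD measurable_T01 ip iq.
by apply: eq_integrable => // t _ /=; rewrite EFinD.
Qed.

Lemma rintZ c (p : R -> R) : rint p -> rint (fun t => c * p t).
Proof.
move=> ip; have := integrableZl measurable_T01 c ip.
by apply: eq_integrable => // t _ /=; rewrite EFinM.
Qed.

Lemma rint_sum (I : Type) (r : seq I) (P : pred I) (F : I -> R -> R) :
  (forall i, rint (F i)) -> rint (fun t => \sum_(i <- r | P i) F i t).
Proof.
move=> h; elim: r => [|i r ih].
  under eq_fun do rewrite big_nil; exact: integrable0.
under eq_fun do rewrite big_cons; case: (P i) => //.
exact: rintD.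
Qed.

Lemma rint_cst c : rint (fun=> c).
Proof.
apply/integrableP; split; first exact: measurable_cst.
under eq_integral do rewrite /=.
rewrite integral_cst //.
by rewrite [X in (_ * X)%E]mu_T01 mule1 ltry.
Qed.

Lemma EFin_Rintegral (p : R -> R) : rint p ->
  ((\int[mu]_(t in T) p t)%:E = \int[mu]_(t in T) (p t)%:E)%E.
Proof. by move=> ip; rewrite /Rintegral fineK //; apply: integrable_fin_num. Qed.

Lemma inL1P f : inL1 f <->
  rint (fun t => complex.Re (f t)) /\ rint (fun t => complex.Im (f t)).
Proof.
split=> [[[f1 f2] h]|[f1 f2]].
  have mf : cmeas f by split.
  have i : rint (fun t => cabs (f t)).
    by apply/rint_ge0P => //; [exact: rmeas_cabs|move=> t _; exact: cabs_ge0].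
  split; apply: (rint_le _ _ i) => // t _; [exact: cabs_ge_Re|exact: cabs_ge_Im].
have mf : cmeas f by split; apply: rint_meas.
split=> //; apply/rint_ge0P; first exact: rmeas_cabs.
  by move=> t _; apply: cabs_ge0.
have := rintD (integrable_norm f1) (integrable_norm f2).
apply: (rint_le (rmeas_cabs mf)) => t _.
by rewrite /= ger0_norm ?cabs_ge0 // cabs_le_ReIm.
Qed.

Lemma inL1_cmeas f : inL1 f -> cmeas f. Proof. by case. Qed.

Lemma inL1_rint_cabs f : inL1 f -> rint (fun t => cabs (f t)).
Proof.
by move=> [mf h]; apply/rint_ge0P => //; [exact: rmeas_cabs|move=> t _; exact: cabs_ge0].
Qed.

Lemma inL1_le f (p : R -> R) : cmeas f -> rint p ->
  (forall t, T t -> cabs (f t) <= p t) -> inL1 f.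
Proof.
move=> mf ip h; split=> //; apply/rint_ge0P; first exact: rmeas_cabs.
  by move=> t _; apply: cabs_ge0.
by apply: (rint_le (rmeas_cabs mf) _ ip) => t Tt; rewrite ger0_norm ?cabs_ge0 ?h.
Qed.

Lemma inL1_bddM f g (M : R) : cmeas g -> (forall t, T t -> cabs (g t) <= M) ->
  inL1 f -> inL1 (fun t => g t * f t).
Proof.
move=> mg h f1; apply: (inL1_le _ (rintZ M (inL1_rint_cabs f1))).
  by apply: cmeasM => //; case: f1.
by move=> t Tt; rewrite cabsM ler_wpM2r ?cabs_ge0 ?h.
Qed.

Lemma inL1D f g : inL1 f -> inL1 g -> inL1 (fun t => f t + g t).
Proof.
move=> f1 g1; apply: (inL1_le _ (rintD (inL1_rint_cabs f1) (inL1_rint_cabs g1))).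
  by apply: cmeasD; [case: f1|case: g1].
by move=> t _; apply: cabsD.
Qed.

Lemma inL1Z z f : inL1 f -> inL1 (fun t => z * f t).
Proof. by move=> f1; apply: (inL1_bddM (M := cabs z)) => //; apply: cmeas_cst. Qed.

Lemma inL1N f : inL1 f -> inL1 (fun t => - f t).
Proof. by move=> ?; under eq_fun do rewrite -mulN1r; apply: inL1Z. Qed.

Lemma inL1B f g : inL1 f -> inL1 g -> inL1 (fun t => f t - g t).
Proof. by move=> *; apply: inL1D => //; apply: inL1N. Qed.

Lemma inL1_0 : inL1 (fun=> 0 : C).
Proof. by apply: (inL1_le (cmeas_cst 0) (rint_cst 0)) => t _; rewrite cabs0. Qed.

Lemma inL1_sum (I : Type) (r : seq I) (P : pred I) (F : I -> R -> C) :
  (forall i, inL1 (F i)) -> inL1 (fun t => \sum_(i <- r | P i) F i t).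
Proof.
move=> h; elim: r => [|i r ih].
  under eq_fun do rewrite big_nil; exact: inL1_0.
under eq_fun do rewrite big_cons; case: (P i) => //.
exact: inL1D.
Qed.

Lemma Re_cint f : complex.Re (cint f) = \int[mu]_(t in T) complex.Re (f t).
Proof. by rewrite /cint ReD ReM /= mulr0 mul0r !subr0 addr0. Qed.

Lemma Im_cint f : complex.Im (cint f) = \int[mu]_(t in T) complex.Im (f t).
Proof. by rewrite /cint ImD ImM /= mulr0 mul1r !add0r. Qed.

Lemma eq_cint f g : (forall t, T t -> f t = g t) -> cint f = cint g.
Proof.
move=> h; apply: complex_ext; rewrite ?Re_cint ?Im_cint;
by apply: eq_Rintegral => t /set_mem Tt; rewrite h.
Qed.

Lemma ae_eq_cint f g : cmeas f -> cmeas g -> aeT (fun t => f t = g t) ->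
  cint f = cint g.
Proof.
move=> mf mg h; have [f1 f2] := mf; have [g1 g2] := mg; apply: complex_ext; rewrite ?Re_cint ?Im_cint /Rintegral; congr fine.
  apply: ae_eq_integral => //; try exact/measurable_EFinP.
  by apply: aeT_S h => t Tt /= ->.
apply: ae_eq_integral => //; try exact/measurable_EFinP.
by apply: aeT_S h => t Tt /= ->.
Qed.

Lemma cintD f g : inL1 f -> inL1 g -> cint (fun t => f t + g t) = cint f + cint g.
Proof.
move=> /inL1P[f1 f2] /inL1P[g1 g2]; apply: complex_ext.
  rewrite Re_cint ReD !Re_cint -RintegralD //; by apply: eq_Rintegral => t _; rewrite ReD.
rewrite Im_cint ImD !Im_cint -RintegralD //; by apply: eq_Rintegral => t _; rewrite ImD.
Qed.

Lemma cintZ z f : inL1 f -> cint (fun t => z * f t) = z * cint f.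
Proof.
move=> /inL1P[f1 f2]; apply: complex_ext.
  rewrite Re_cint ReM Re_cint Im_cint -!RintegralZl // -RintegralB //; try exact: rintZ.
  by apply: eq_Rintegral => t _; rewrite ReM.
rewrite Im_cint ImM Im_cint Re_cint -!RintegralZl // -RintegralD //; try exact: rintZ.
by apply: eq_Rintegral => t _; rewrite ImM.
Qed.

Lemma cintN f : inL1 f -> cint (fun t => - f t) = - cint f.
Proof.
by move=> f1; rewrite -mulN1r -cintZ //; apply: eq_cint => t _; rewrite mulN1r.
Qed.

Lemma cintB f g : inL1 f -> inL1 g -> cint (fun t => f t - g t) = cint f - cint g.
Proof. by move=> f1 g1; rewrite cintD ?cintN //; apply: inL1N. Qed.

Lemma cint0 : cint (fun=> 0 : C) = 0.
Proof.
have h := cintZ 0 inL1_0; rewrite (mul0r (cint _)) in h; rewrite -[RHS]h.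
by apply: eq_cint => t _; rewrite mul0r.
Qed.

Lemma cint_sum (I : Type) (r : seq I) (P : pred I) (F : I -> R -> C) :
  (forall i, inL1 (F i)) ->
  cint (fun t => \sum_(i <- r | P i) F i t) = \sum_(i <- r | P i) cint (F i).
Proof.
move=> h; elim: r => [|i r ih].
  by under eq_fun do rewrite big_nil; rewrite big_nil cint0.
under eq_fun do rewrite big_cons; rewrite big_cons; case: (P i) => //.
by rewrite cintD // ?ih //; apply: inL1_sum.
Qed.

Lemma cintJ f : inL1 f -> cint (fun t => ((f t)^*)%C) = ((cint f)^*)%C.
Proof.
move=> /inL1P[f1 f2]; apply: complex_ext.
  by rewrite ReJ !Re_cint; apply: eq_Rintegral => t _; rewrite ReJ.
rewrite ImJ !Im_cint -mulN1r -RintegralZl //.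
by apply: eq_Rintegral => t _; rewrite ImJ mulN1r.
Qed.

Lemma le_Rint (p q : R -> R) : rint p -> rint q -> aeT (fun t => p t <= q t) ->
  \int[mu]_(t in T) p t <= \int[mu]_(t in T) q t.
Proof.
move=> ip iq h; rewrite -subr_ge0 -RintegralB //.
have mm : rmeas (fun t => q t - p t) by apply: rmeasB; apply: rint_meas.
have m0 : rmeas (fun t => Num.max 0 (q t - p t)).
  by apply: measurable_maxr => //; apply: rmeas_cst.
rewrite /Rintegral.
have -> : (\int[mu]_(x in T) (q x - p x)%:E = \int[mu]_(x in T) (Num.max 0 (q x - p x))%:E)%E.
  apply: ae_eq_integral => //; try exact/measurable_EFinP.
  by apply: aeT_S h => t Tt /= ht; rewrite max_r // subr_ge0.
apply: fine_ge0; apply: integral_ge0 => t _.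
by rewrite lee_fin le_max lexx.
Qed.

(** Multiplying by the conjugate of the integral makes the integral real, so that comparing real
    parts suffices. *)
Lemma cabs_cint f : inL1 f -> cabs (cint f) <= \int[mu]_(t in T) cabs (f t).
Proof.
move=> f1; have [z0|zn] := eqVneq (cabs (cint f)) 0.
  by rewrite z0; apply: Rintegral_ge0 => t _; apply: cabs_ge0.
have zp : 0 < cabs (cint f) by rewrite lt0r zn cabs_ge0.
rewrite -(ler_pM2l zp) -expr2 -RintegralZl //; last exact: inL1_rint_cabs.
have -> : cabs (cint f) ^+ 2 = complex.Re (((cint f)^*)%C * cint f).
  by rewrite mulrC -sqr_cabsC.
rewrite -cintZ // Re_cint; apply: le_Rint.
- by have /inL1P[] := inL1Z ((cint f)^*)%C f1.
- exact/rintZ/inL1_rint_cabs.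
- apply: aeW => t _; apply: le_trans (ler_norm _) _; apply: le_trans (cabs_ge_Re _) _.
  by rewrite cabsM cabsJ.
Qed.

Lemma Rint_ge0_eq0 (p : R -> R) : rint p -> (forall t, T t -> 0 <= p t) ->
  \int[mu]_(t in T) p t <= 0 -> aeT (fun t => p t = 0).
Proof.
move=> ip p0 h.
have e0 : (\int[mu]_(t in T) `|(p t)%:E| = 0)%E.
  have -> : (\int[mu]_(t in T) `|(p t)%:E| = \int[mu]_(t in T) (p t)%:E)%E.
    by apply: eq_integral => t /set_mem Tt /=; rewrite ger0_norm ?p0.
  rewrite -EFin_Rintegral //; congr EFin; apply/eqP; rewrite eq_le h /=.
  exact: Rintegral_ge0.
have /(ae_eq_integral_abs mu measurable_T01 _) := e0.
move=> /(_ (measurable_int mu ip)).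
by apply: filterS => t ht Tt; have := ht Tt => -[].
Qed.

Definition echar (k : int) (t : R) : C := expi (2 * pi * k%:~R * t).

Lemma cabs_expi (x : R) : cabs (expi x) = 1.
Proof. by apply: eq_sqr_ge0; rewrite ?cabs_ge0 // sqr_cabs /= cos2Dsin2 expr1n. Qed.

Lemma expiD (x y : R) : expi (x + y) = expi x * expi y.
Proof. by apply: complex_ext; rewrite /= ?cosD ?sinD ?ReM ?ImM /= // addrC [cos x * _]mulrC. Qed.

Lemma expiN (x : R) : expi (- x) = ((expi x)^*)%C.
Proof. by apply: complex_ext; rewrite /= ?cosN ?sinN. Qed.

Lemma cabs_echar k t : cabs (echar k t) = 1.
Proof. exact: cabs_expi. Qed.

Lemma echarD k l t : echar (k + l) t = echar k t * echar l t.
Proof. by rewrite /echar -expiD rmorphD /= mulrDr mulrDl. Qed.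

Lemma echarN k t : echar (- k) t = ((echar k t)^*)%C.
Proof. by rewrite /echar -expiN rmorphN /= mulrN mulNr. Qed.

Lemma echar0 t : echar 0 t = 1.
Proof.
by rewrite /echar mulr0 mul0r; apply: complex_ext; rewrite /= ?cos0 ?sin0.
Qed.

Lemma echar_cancel k t : echar (- k) t * echar k t = 1.
Proof. by rewrite -echarD addNr echar0. Qed.

Lemma fourierE f k : fourier f k = cint (fun t => f t * echar (- k) t).
Proof. by apply: eq_cint => t _; rewrite /echar rmorphN /= mulrN mulNr. Qed.

Lemma cmeas_echar k : cmeas (echar k).
Proof.
have m : rmeas (fun t : R => 2 * pi * k%:~R * t).
  by apply: rmeasM; [apply: rmeas_cst|exact: measurable_id].
have c : measurable_fun setT (@cos R).
  by apply: continuous_measurable_fun; apply: continuous_cos.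
have d : measurable_fun setT (@sin R).
  by apply: continuous_measurable_fun; apply: continuous_sin.
by split; [exact: (measurableT_comp c m)|exact: (measurableT_comp d m)].
Qed.

Lemma inL1_echarM k f : inL1 f -> inL1 (fun t => f t * echar k t).
Proof.
move=> f1; under eq_fun do rewrite mulrC.
apply: (inL1_bddM (M := 1)) => //; first exact: cmeas_echar.
by move=> t _; rewrite cabs_echar.
Qed.

Lemma fourierB f g k : inL1 f -> inL1 g ->
  fourier (fun t => f t - g t) k = fourier f k - fourier g k.
Proof.
move=> f1 g1; rewrite !fourierE -cintB; try exact: inL1_echarM.
by apply: eq_cint => t _; rewrite mulrBl.
Qed.

Lemma fourier_sum (I : Type) (r : seq I) (P : pred I) (F : I -> R -> C) k :
  (forall i, inL1 (F i)) ->
  fourier (fun t => \sum_(i <- r | P i) F i t) k = \sum_(i <- r | P i) fourier (F i) k.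
Proof.
move=> h; rewrite fourierE; under eq_bigr do rewrite fourierE.
rewrite -cint_sum => [|i]; last exact: inL1_echarM.
by apply: eq_cint => t _; rewrite mulr_suml.
Qed.

Lemma fourier_shift f k l : fourier (fun t => f t * echar l t) k = fourier f (k - l).
Proof. by rewrite !fourierE; apply: eq_cint => t _; rewrite -mulrA -echarD opprB. Qed.

Lemma fourierJ f k : inL1 f -> fourier (fun t => ((f t)^*)%C) k = ((fourier f (- k))^*)%C.
Proof.
move=> f1; rewrite !fourierE -cintJ; last exact: inL1_echarM.
by apply: eq_cint => t _; rewrite conjcM opprK -echarN.
Qed.

Lemma ae_eq_fourier f g k : cmeas f -> cmeas g -> aeT (fun t => f t = g t) ->
  fourier f k = fourier g k.
Proof.
move=> mf mg h; rewrite !fourierE; apply: ae_eq_cint.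
- by apply: cmeasM => //; apply: cmeas_echar.
- by apply: cmeasM => //; apply: cmeas_echar.
- by apply: aeT_S h => t Tt ->.
Qed.

End ComplexIntegral.
#[export] Hint Resolve measurable_T01 : core.

(** * Injectivity of the Fourier transform on L1 *)

Section StepApproximation.
Variable R : realType.
Implicit Types (x y : R).

Lemma bernoulli_ineq n y : -1 <= y -> 1 + n%:R * y <= (1 + y) ^+ n.
Proof.
move=> y1; elim: n => [|n ih]; first by rewrite mul0r addr0 expr0.
rewrite exprS; apply: (@le_trans _ _ ((1 + y) * (1 + n%:R * y))); last first.
  by rewrite ler_wpM2l //; lra.
rewrite -natr1; have := mulr_ge0 (ler0n R n) (sqr_ge0 y); nra.
Qed.

Lemma expr_le_inv n y : 0 <= y <= 1 -> (1 - y) ^+ n <= (1 + n%:R * y)^-1.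
Proof.
move=> /andP[y0 y1].
have p : 0 < 1 + n%:R * y by have := mulr_ge0 (ler0n R n) y0; lra.
rewrite -[leRHS]mul1r ler_pdivlMr //.
apply: (@le_trans _ _ ((1 - y) ^+ n * (1 + y) ^+ n)).
  rewrite ler_wpM2l ?exprn_ge0 ?subr_ge0 //.
  by apply: bernoulli_ineq; lra.
rewrite -exprMn exprn_ile1 //; nra.
Qed.

(* Tends to 1 for [0 <= x < 1/2] and to 0 for [1/2 < x <= 1]. *)
Definition step_poly n x := (1 - x ^+ n) ^+ (2 ^ n)%N.

Lemma step_poly_bound n x : 0 <= x <= 1 -> 0 <= step_poly n x <= 1.
Proof.
move=> /andP[x0 x1]; have xn0 : 0 <= x ^+ n by exact: exprn_ge0.
have xn1 : x ^+ n <= 1 by exact: exprn_ile1.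
by rewrite exprn_ge0 ?exprn_ile1 //; lra.
Qed.

Lemma step_poly_left n x : 0 <= x <= 1 -> 1 - (2 * x) ^+ n <= step_poly n x.
Proof.
move=> /andP[x0 x1]; have xn1 : x ^+ n <= 1 by exact: exprn_ile1.
have := @bernoulli_ineq (2 ^ n)%N (- x ^+ n).
by rewrite lerN2 => /(_ xn1); rewrite mulrN natrX -exprMn.
Qed.

Lemma step_poly_right n x : 0 <= x <= 1 -> step_poly n x <= (1 + (2 * x) ^+ n)^-1.
Proof.
move=> /andP[x0 x1]; rewrite exprMn -natrX; apply: expr_le_inv.
by rewrite exprn_ge0 ?exprn_ile1.
Qed.

(* The threshold moves with [n] so that the step functions converge everywhere,
   including at the jump. *)
Definition step_arg (c : R) (n : nat) (z : R) := 2^-1 + (c + n.+1%:R^-1 - z) / 8.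
Definition step_seq (c : R) (n : nat) (z : R) := step_poly (n.+1 ^ 2)%N (step_arg c n z).

Lemma step_arg_bound c n z : -1 <= c <= 1 -> -1 <= z <= 1 -> 0 <= step_arg c n z <= 1.
Proof.
have h0 : (0 : R) < n.+1%:R^-1 by rewrite invr_gt0 ltr0n.
have h1 : n.+1%:R^-1 <= (1 : R) by rewrite invf_le1 ?ltr0n // ler1n.
rewrite /step_arg; set d := n.+1%:R^-1 in h0 h1 *; lra.
Qed.

Lemma step_seq_bound c n z : -1 <= c <= 1 -> -1 <= z <= 1 -> 0 <= step_seq c n z <= 1.
Proof. by move=> hc hz; apply/step_poly_bound/step_arg_bound. Qed.

(** For [z <= c] the moving threshold keeps [step_arg] at least [1 / (8 (n + 1))] above [1/2], and
    the exponent [(n + 1)^2] outgrows this gap: Bernoulli turns it into the rate [1 / (n + 1)]. At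
    [z = c] the limit is therefore 0, as the strict comparison demands. *)
Lemma step_seq_rate c z : -1 <= c <= 1 -> -1 <= z <= 1 ->
  exists K, forall n, `|step_seq c n z - (if c < z then 1 else 0)| <= K / n.+1%:R.
Proof.
move=> hc hz; have [cz|zc] := ltP c z.
  pose d := z - c; have d0 : 0 < d by rewrite /d; lra.
  exists (8 / d) => n; have n0 : (0 : R) < n.+1%:R by rewrite ltr0n.
  have hb := step_arg_bound n hc hz.
  have /andP[s0 s1] := step_seq_bound n hc hz.
  rewrite ler0_norm ?opprB; last by lra.
  (* For such small [n] the shift may hide the gap [d], but then the claimed bound [8 / (d (n + 1))]
     exceeds 1. *)
  have [nd|nd] := ltP (n.+1%:R * d) 2.
    apply: (@le_trans _ _ 1); first by lra.
    by rewrite -mulrA -invfM ler_pdivlMr ?mulr_gt0 // mul1r mulrC; lra.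
  have inv_le : n.+1%:R^-1 <= d / 2.
    by rewrite ler_pdivlMr // mulrC -ler_pdivlMr ?invr_gt0 // invrK mulrC.
  have x2 : 0 <= 1 - 2 * step_arg c n z <= 1.
    by move: hb inv_le; rewrite /step_arg /d; set e := n.+1%:R^-1; lra.
  have dx : d / 8 <= 1 - 2 * step_arg c n z.
    by move: inv_le; rewrite /step_arg /d; set e := n.+1%:R^-1; lra.
  apply: (@le_trans _ _ ((2 * step_arg c n z) ^+ (n.+1 ^ 2))).
    by have := step_poly_left (n.+1 ^ 2)%N hb; rewrite /step_seq; lra.
  have := expr_le_inv (n.+1 ^ 2)%N x2; rewrite subKr => /le_trans; apply.
  have h1 : n.+1%:R * (d / 8) <= (n.+1 ^ 2)%:R * (1 - 2 * step_arg c n z).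
    apply: ler_pM; rewrite ?ler0n //; first by lra.
    by rewrite ler_nat expnS leq_pmulr // expn_gt0.
  have p0 : 0 < n.+1%:R * (d / 8) by rewrite mulr_gt0 // divr_gt0.
  rewrite -(invrK (8 / d / n.+1%:R)) lef_pV2 ?posrE ?invr_gt0 ?divr_gt0 //; last by lra.
  have -> : (8 / d / n.+1%:R)^-1 = n.+1%:R * (d / 8).
    by field; rewrite !gt_eqF //= ?ltr0n.
  by lra.
(* The power is at least [1 + (n + 1) / 4], and the inverse of anything larger is below
   [4 / (n + 1)]. *)
exists 4 => n; have n0 : (0 : R) < n.+1%:R by rewrite ltr0n.
have hb := step_arg_bound n hc hz.
have /andP[s0 s1] := step_seq_bound n hc hz.
rewrite subr0 ger0_norm //.
apply: le_trans (step_poly_right _ hb) _.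
have x2 : 1 + n.+1%:R^-1 / 4 <= 2 * step_arg c n z.
  by rewrite /step_arg; set e := n.+1%:R^-1; lra.
have i0 : (0 : R) < n.+1%:R^-1 by rewrite invr_gt0.
have h : 1 + n.+1%:R / 4 <= (2 * step_arg c n z) ^+ (n.+1 ^ 2).
  apply: (@le_trans _ _ ((1 + n.+1%:R^-1 / 4) ^+ (n.+1 ^ 2))); last first.
    apply: lerXn2r; rewrite ?nnegrE //; last by move/andP: hb => [hb0 _]; rewrite mulr_ge0.
  have := @bernoulli_ineq (n.+1 ^ 2)%N (n.+1%:R^-1 / 4).
  have -> : (n.+1 ^ 2)%:R * (n.+1%:R^-1 / 4) = n.+1%:R / 4 :> R.
    by rewrite natrX; field; rewrite addrC natr1 gt_eqF ?ltr0n.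
  by apply; apply: (@le_trans _ _ 0); [lra|rewrite divr_ge0 // ltW].
rewrite -(invrK (4 / n.+1%:R)) lef_pV2 ?posrE ?invr_gt0 ?divr_gt0 //; last by lra.
rewrite invf_div; lra.
Qed.

End StepApproximation.

Section FourierUniqueness.
Variable R : realType.
Local Notation C := (R[i]).
Local Notation mu := (@lebesgue_measure R).
Local Notation T := (@T01 R).

Lemma ReM_realr (z : C) (x : R) : complex.Re (z * x%:C%C) = complex.Re z * x.
Proof. by rewrite ReM /= mulr0 subr0. Qed.

Lemma ImM_realr (z : C) (x : R) : complex.Im (z * x%:C%C) = complex.Im z * x.
Proof. by rewrite ImM /= mulr0 add0r. Qed.

Lemma cvg_of_rate (u : nat -> R) (l K : R) :
  (forall n, `|u n - l| <= K / n.+1%:R) -> u @ \oo --> l.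
Proof.
move=> h; apply/cvgrPdist_le => e e0.
near=> n; rewrite distrC; apply: le_trans (h n) _.
rewrite ler_pdivrMr ?ltr0n // mulrC -ler_pdivrMr //.
apply: (@le_trans _ _ n%:R); last by rewrite ler_nat.
by near: n; apply: nbhs_infty_ger.
Unshelve. all: by end_near.
Qed.

Lemma Rint_zero_limit (g : R -> R) (p : nat -> R -> R) (q : R -> R) (M : R) :
  rint g -> (forall n, rmeas (p n)) -> rmeas q ->
  (forall n t, T t -> `|p n t| <= M) ->
  (forall t, T t -> p ^~ t @ \oo --> q t) ->
  (forall n, \int[mu]_(t in T) (g t * p n t) = 0) ->
  \int[mu]_(t in T) (g t * q t) = 0.
Proof.
move=> ig mp mq pM pq h.
have mg : rmeas g by exact: rint_meas.
have [] := @dominated_convergence _ _ _ mu T (@measurable_T01 R)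
  (fun n t => (g t * p n t)%:E) (fun t => (g t * q t)%:E) (fun t => (M * `|g t|)%:E).
- by move=> n; apply/measurable_EFinP; apply: rmeasM.
- by apply/measurable_EFinP; apply: rmeasM.
- apply: aeW => t Tt; apply: cvg_EFin; first by near=> n.
  by apply: cvgMl_tmp; apply: pq.
- exact: (rintZ M (integrable_norm ig)).
- apply: aeW => t n Tt; rewrite /= lee_fin normrM mulrC.
  by rewrite ler_wpM2r // pM.
move=> ig2 _ hc; rewrite /Rintegral.
have -> : (\int[mu]_(t in T) (g t * q t)%:E = 0)%E; last by [].
have h0 n : (\int[mu]_(t in T) (g t * p n t)%:E = 0)%E.
  by rewrite -EFin_Rintegral ?h //; apply: (rint_le (rmeasM mg (mp n)) _ (rintZ M (integrable_norm ig))) => t Tt; rewrite /= normrM mulrC ler_wpM2r // pM.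
rewrite -(cvg_lim _ hc) //; under eq_fun do rewrite h0.
exact: lim_cst.
Unshelve. all: by end_near.
Qed.

Variable f : R -> C.
Hypotheses (f1 : inL1 f) (f0 : forall k, fourier f k = 0).

(* [W] is closed under bounded pointwise limits, hence contains the indicators of arcs,
   which are limits of step polynomials in a translate of [cos (2 pi t)]. *)
Let W (p : R -> R) : Prop := [/\ rmeas p, exists M, forall t, T t -> `|p t| <= M &
  forall k, cint (fun t => f t * echar k t * (p t)%:C%C) = 0].

Let W_inL1 p k : W p -> inL1 (fun t => f t * echar k t * (p t)%:C%C).
Proof.
move=> [mp [M hM] _]; under eq_fun do rewrite mulrC.
apply: (inL1_bddM (M := M)); first exact: cmeas_real.
  by move=> t Tt; rewrite cabsr hM.
exact: inL1_echarM.
Qed.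

Let W_1 : W (fun=> 1).
Proof.
split; first exact: rmeas_cst.
  by exists 1 => t _; rewrite normr1.
move=> k; have := f0 (- k); rewrite fourierE opprK => h.
by rewrite -[RHS]h; apply: eq_cint => t _; rewrite mulr1.
Qed.

Let W_lin a p q : W p -> W q -> W (fun t => a * p t + q t).
Proof.
move=> hp hq; case: (hp) => mp [M hM] p0; case: (hq) => mq [N hN] q0; split.
- by apply: rmeasD => //; apply: rmeasM => //; apply: rmeas_cst.
- exists (`|a| * M + N) => t Tt; apply: le_trans (ler_normD _ _) _.
  by rewrite normrM lerD ?hN // ler_wpM2l // hM.
move=> k; have := cintD (inL1Z a%:C%C (W_inL1 k hp)) (W_inL1 k hq).
rewrite cintZ ?p0 ?q0 ?mulr0 ?addr0; last exact: W_inL1.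
move=> h; rewrite -[RHS]h; apply: eq_cint => t _.
by rewrite rmorphD rmorphM /= mulrDr mulrCA.
Qed.

(** By Euler's formula the cosine is a combination of [echar 1] and [echar (-1)]: the integral for
    [k] reduces to those for [k + 1] and [k - 1]. Hence the quantification over all [k] in [W]. *)
Let W_cos s p : W p -> W (fun t => cos (2 * pi * (t - s)) * p t).
Proof.
move=> hp; case: (hp) => mp [M hM] p0; split.
- apply: rmeasM => //.
  have m : rmeas (fun t : R => 2 * pi * (t - s)).
    apply: rmeasM; first exact: rmeas_cst.
    by apply: rmeasB; [exact: measurable_id|exact: rmeas_cst].
  have c : measurable_fun setT (@cos R).
    by apply: continuous_measurable_fun; apply: continuous_cos.
  exact: (measurableT_comp c m).
- exists M => t Tt; rewrite normrM; apply: le_trans (hM _ Tt).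
  by rewrite ler_piMl // cos_max.
move=> k; pose a : C := 2^-1 * ((echar 1 s)^*)%C; pose b : C := 2^-1 * echar 1 s.
have := cintD (inL1Z a (W_inL1 (k + 1) hp)) (inL1Z b (W_inL1 (k - 1) hp)).
rewrite !cintZ ?p0 ?mulr0 ?addr0; try exact: W_inL1.
move=> h; rewrite -[RHS]h; apply: eq_cint => t _.
rewrite !echarD echarN.
have -> : (cos (2 * pi * (t - s)) * p t)%:C%C =
    (a * echar 1 t + b * ((echar 1 t)^*)%C) * (p t)%:C%C.
  rewrite realcM; congr (_ * _).
  have -> : cos (2 * pi * (t - s)) = complex.Re (((echar 1 s)^*)%C * echar 1 t).
    rewrite ReM /echar /= mulr1 mulrBr cosB.
    by rewrite mulNr opprK [cos _ * cos _]mulrC [sin _ * sin _]mulrC.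
  by rewrite ReJ_add conjcM conjcK /a /b; field.
by ring.
Qed.

Let W_lim p q M : (forall n, W (p n)) -> rmeas q ->
  (forall n t, T t -> `|p n t| <= M) -> (forall t, T t -> `|q t| <= M) ->
  (forall t, T t -> p ^~ t @ \oo --> q t) -> W q.
Proof.
move=> hp mq pM qM pq; have mp n : rmeas (p n) by case: (hp n).
split=> //; first by exists M.
move=> k; have /inL1P[i1 i2] := inL1_echarM k f1.
apply: complex_ext; rewrite ?Re_cint ?Im_cint /=.
  under eq_Rintegral do rewrite ReM_realr.
  apply: (Rint_zero_limit i1 mp mq pM pq) => n.
  case: (hp n) => _ _ /(_ k)/(congr1 (@complex.Re _)); rewrite Re_cint /= => h.
  by rewrite -[RHS]h; apply: eq_Rintegral => t _; rewrite ReM_realr.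
under eq_Rintegral do rewrite ImM_realr.
apply: (Rint_zero_limit i2 mp mq pM pq) => n.
case: (hp n) => _ _ /(_ k)/(congr1 (@complex.Im _)); rewrite Im_cint /= => h.
by rewrite -[RHS]h; apply: eq_Rintegral => t _; rewrite ImM_realr.
Qed.

Let W_step_arg c n s p : W p -> W (fun t => step_arg c n (cos (2 * pi * (t - s))) * p t).
Proof.
move=> hp; have := W_lin (2^-1 + (c + n.+1%:R^-1) / 8) hp (W_lin (- 8^-1) (W_cos s hp) (W_lin (-1) hp hp)).
by congr W; apply/funext => t; rewrite /step_arg; field; rewrite addrC natr1 pnatr_eq0.
Qed.

Let W_X (x : R -> R) m p : (forall p, W p -> W (fun t => x t * p t)) -> W p ->
  W (fun t => x t ^+ m * p t).
Proof.
move=> hx hp; elim: m => [|m ih].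
  by under eq_fun do rewrite expr0 mul1r.
under eq_fun do rewrite exprS -mulrA; exact: hx.
Qed.

Let W_step_seq c n s : W (fun t => step_seq c n (cos (2 * pi * (t - s)))).
Proof.
have hx p : W p -> W (fun t => (1 - step_arg c n (cos (2 * pi * (t - s))) ^+ (n.+1 ^ 2)) * p t).
  move=> hp; have := W_lin (-1) (W_X (n.+1 ^ 2) (W_step_arg c n s) hp) hp.
  by congr W; apply/funext => t; ring.
have := W_X (2 ^ n.+1 ^ 2)%N hx W_1.
by under eq_fun do rewrite mulr1.
Qed.

(** The arc is centred at [b / 2]. Cosine is decreasing on [[0, pi]] only, so the angle is replaced
    by its absolute value and, beyond [pi], by its reflection in [2 pi]. *)
Let cos_arc b t : 0 < b < 1 -> T t ->
  (cos (pi * b) < cos (2 * pi * (t - b / 2))) = (0 < t < b).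
Proof.
move=> /andP[b0 b1]; rewrite /T01 /= in_itv /= => /andP[t0 t1].
have p0 := pi_gt0 R.
have pb : pi * b < pi by rewrite -[ltRHS]mulr1 ltr_pM2l.
have pb0 : 0 < pi * b by rewrite mulr_gt0.
have main y : 0 <= y <= pi -> (cos (pi * b) < cos y) = (y < pi * b).
  move=> /andP[y0 y1].
  by rewrite (ltr_cos (x := y) (y := pi * b)) // in_itv /= ?y0 ?y1 // ltW //= ltW.
have -> : cos (2 * pi * (t - b / 2)) = cos `|2 * pi * t - pi * b|.
  by rewrite cos_norm; congr cos; field.
have [tb|bt] := ltP t b.
  have h : `|2 * pi * t - pi * b| <= pi * b.
    rewrite ler_norml; apply/andP; split; nra.
  rewrite main; last by rewrite normr_ge0 /=; lra.
  rewrite andbT ltr_norml.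
  by apply/andP/idP => [[h1 h2]|h1]; [nra|split; nra].
rewrite andbF; apply/negbTE; rewrite -leNgt.
have pt : pi * b <= pi * t by rewrite ler_pM2l.
have pt1 : pi * t <= pi by rewrite -[leRHS]mulr1 ler_pM2l.
rewrite ger0_norm; last by lra.
have [yp|py] := leP (2 * pi * t - pi * b) pi.
  by rewrite leNgt main ?yp; lra.
have -> : cos (2 * pi * t - pi * b) = cos (pi *+ 2 - (2 * pi * t - pi * b)).
  by rewrite -cosN -(cosD2pi (- _)) addrC.
by rewrite leNgt main; rewrite mulr2n; lra.
Qed.

Let cint_initial b : 0 < b < 1 ->
  cint (fun t => f t * (if 0 < t < b then 1 else 0)%:C%C) = 0.
Proof.
move=> b01; have hc : -1 <= cos (pi * b) <= 1 by rewrite cos_geN1 cos_le1.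
have hz (t : R) : -1 <= cos (2 * pi * (t - b / 2)) <= 1 by rewrite cos_geN1 cos_le1.
have lim t : T t -> (fun n => step_seq (cos (pi * b)) n (cos (2 * pi * (t - b / 2)))) @ \oo -->
    (if 0 < t < b then 1 else 0 : R).
  move=> Tt; have [K hK] := step_seq_rate hc (hz t).
  by apply: (@cvg_of_rate _ _ K) => n; rewrite -cos_arc.
have [] := @W_lim _ (fun t => if 0 < t < b then 1 else 0) 1 (fun n => W_step_seq (cos (pi * b)) n (b / 2)).
- apply: measurable_fun_cvg => [n|t]; last exact: lim.
  by case: (W_step_seq (cos (pi * b)) n (b / 2)).
- move=> n t Tt; have /andP[h0 h1] := step_seq_bound n hc (hz t).
  by rewrite ger0_norm.
- by move=> t _; case: ifP => _; rewrite ?normr1 ?normr0.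
- exact: lim.
move=> _ _ /(_ 0) h; rewrite -[RHS]h; apply: eq_cint => t _.
by rewrite echar0 mulr1.
Qed.

(** The hypothesis says that the primitive of [p] from 0 vanishes on []0, 1[]; at an interior
    Lebesgue point its derivative is both 0 and [p]. *)
Let real_zero (p : R -> R) : rint p ->
  (forall b, 0 < b < 1 -> \int[mu]_(t in T) (p t * (if 0 < t < b then 1 else 0)) = 0) ->
  aeT (fun t => p t = 0).
Proof.
move=> ip h.
pose g := p \_ T.
have lg : locally_integrable [set: R] g by apply: (integrable_locally (measurable_itv _) ip).
have ig : rint g.
  apply: eq_integrable ip => // t Tt; rewrite /g /= patchE.
  by rewrite Tt.
have n0 : aeT (fun t : R => t <> 0 /\ t <> 1).
  apply/aeT_negligible; apply: (@negligibleS _ _ _ mu [set 0; 1]).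
    move=> t [_ /= /not_andP[]/contrapT ->]; [by left|by right].
  apply/negligibleP; first exact: measurableU.
  exact/countable_lebesgue_measure0/finite_set_countable.
have hl' : aeT (fun t => lebesgue_pt g t).
  have := lebesgue_differentiation lg.
  by apply: (@filterS _ _ (ae_filter_ringOfSetsType mu)).
apply: aeT_S (aeT_I hl' n0) => x Tx [lx [x0 x1]].
have x01 : 0 < x < 1.
  move: Tx; rewrite /T01 /= in_itv /= => /andP[a1 a2].
  by rewrite !lt_neqAle a1 a2 !andbT; apply/andP; split; apply/eqP => // /esym.
have /andP[xp xl] := x01.
have gx : g x = p x by rewrite /g patchE mem_set.
have [|dF Fx] := FTC1_lebesgue_pt xl ig _ lx; first by rewrite /= lte_fin.
rewrite -gx -Fx derive1E.
rewrite (near_eq_derive (g := cst 0)) ?derive_cst //.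
near=> y.
have y01 : y \in `]0, 1[ by near: y; apply: near_in_itvoo; rewrite in_itv.
have := h y y01.
have -> : \int[mu]_(t in T) (p t * (if 0 < t < y then 1 else 0)) =
    \int[mu]_(t in T) (p \_ `]0, y[) t.
  apply: eq_Rintegral => t _; rewrite patchE; case: ifPn => [ty|/negbTE ty].
    by rewrite mulr1 mem_set //= in_itv.
  by rewrite mulr0 memNset //= in_itv /= ty.
rewrite -Rintegral_mkcondr => h0.
have sub : `]0, y[ `<=` (T : set R).
  move=> t /=; rewrite /T01 /= !in_itv /= => /andP[t0 ty].
  by move: y01; rewrite in_itv /= => /andP[_ y1]; rewrite !ltW // (lt_trans ty).
have ig0 (b c : bool) : mu.-integrable [set` Interval (BSide b 0) (BSide c y)] (EFin \o g).
  have sub' : [set` Interval (BSide b 0) (BSide c y)] `<=` (T : set R).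
    move: y01; rewrite in_itv /= => /andP[_ y1].
    by apply: subset_itv; rewrite bnd_simp; case: (b); case: (c); rewrite ?bnd_simp ?ltW.
  exact: (integrableS (measurable_T01 (R := R)) (measurable_itv _) sub' ig).
rewrite -Rintegral_itv_bndo_bndc // -Rintegral_itv_obnd_cbnd //.
rewrite -[RHS]h0 setIC setIidl //.
by apply: eq_Rintegral => t /set_mem ty; rewrite /g patchE mem_set //; apply: sub.
Unshelve. all: by end_near.
Qed.

Lemma fourier_inj : aeT (fun t => f t = 0).
Proof.
have /inL1P[i1 i2] := f1.
have r1 : aeT (fun t => complex.Re (f t) = 0).
  apply: real_zero => // b /cint_initial/(congr1 (@complex.Re _)); rewrite Re_cint /= => h.
  by rewrite -[RHS]h; apply: eq_Rintegral => t _; rewrite ReM_realr.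
have r2 : aeT (fun t => complex.Im (f t) = 0).
  apply: real_zero => // b /cint_initial/(congr1 (@complex.Im _)); rewrite Im_cint /= => h.
  by rewrite -[RHS]h; apply: eq_Rintegral => t _; rewrite ImM_realr.
by apply: aeT_S (aeT_I r1 r2) => t _ [h1 h2]; apply: complex_ext.
Qed.

End FourierUniqueness.

(** * Measurability of matrix norms and essential suprema *)

Section LipschitzMeasurability.
Variable R : realType.
Local Notation C := (R[i]).
Local Notation mu := (@lebesgue_measure R).
Local Notation T := (@T01 R).

Lemma cabs_subC (z w : C) : cabs (z - w) = cabs (w - z).
Proof. by rewrite -cabsN opprB. Qed.

Lemma entsum_subC m p (A B : 'M[C]_(m, p)) : entsum (A - B) = entsum (B - A).
Proof.
by apply: eq_bigr => i _; apply: eq_bigr => j _; rewrite !mxE cabs_subC.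
Qed.

Lemma rat_complex_dense (z : C) e : 0 < e ->
  exists a b : rat, cabs (z - Complex (ratr a) (ratr b)) <= e.
Proof.
move=> e0; have e2 : 0 < e / 2 by rewrite divr_gt0.
have d (x : R) : exists q : rat, `|x - ratr q| <= e / 2.
  have [q] := @rat_in_itvoo R (x - e / 2) (x + e / 2) ltac:(lra).
  by rewrite in_itv /= => /andP[h1 h2]; exists q; rewrite ler_norml; lra.
have [a ha] := d (complex.Re z); have [b hb] := d (complex.Im z).
exists a, b; apply: le_trans (cabs_le_ReIm _) _.
by rewrite ReD ImD ReN ImN /=; lra.
Qed.

Definition rat_mx m p (X : 'M[rat]_(m, p) * 'M[rat]_(m, p)) : 'M[C]_(m, p) :=
  \matrix_(i, j) Complex (ratr (X.1 i j)) (ratr (X.2 i j)).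

Lemma rat_mx_dense m p (A : 'M[C]_(m, p)) e : 0 < e ->
  exists X, entsum (A - rat_mx X) <= e.
Proof.
move=> e0; pose d := e / ((m * p)%:R + 1).
have d0 : 0 < d by rewrite divr_gt0 // ltr_wpDl.
have /choice [F hF] : forall ij : 'I_m * 'I_p, exists ab : rat * rat,
    cabs (A ij.1 ij.2 - Complex (ratr ab.1) (ratr ab.2)) <= d.
  by move=> ij; have [a [b h]] := rat_complex_dense (A ij.1 ij.2) d0; exists (a, b).
exists (\matrix_(i, j) (F (i, j)).1, \matrix_(i, j) (F (i, j)).2).
apply: (@le_trans _ _ (\sum_(i < m) \sum_(j < p) d)).
  apply: ler_sum => i _; apply: ler_sum => j _; rewrite /rat_mx !mxE /=.
  exact: (hF (i, j)).
rewrite !sumr_const !card_ord -mulrnA mulnC -mulr_natr.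
rewrite /d mulrAC ler_pdivrMr ?ltr_wpDl // ler_pM2l //.
by rewrite lerDl.
Qed.

(* A Lipschitz function is the supremum of its countably many lower cones with
   rational vertices. *)
Lemma rmeas_lipschitz m p (N : 'M[C]_(m, p) -> R) (L : R) (F : MF R m p) :
  0 <= L -> (forall A B, N A <= N B + L * entsum (A - B)) ->
  entrywise (@cmeas R) F -> rmeas (fun t => N (F t)).
Proof.
move=> L0 hN mF.
pose q (n : nat) : 'M[C]_(m, p) :=
  if unpickle n is Some X then rat_mx (X : 'M[rat]_(m, p) * 'M[rat]_(m, p)) else 0.
pose h (n : nat) (t : R) := N (q n) - L * entsum (F t - q n).
have hle n t : h n t <= N (F t).
  by rewrite /h lerBlDr entsum_subC hN.
have hub t : has_ubound (range (h ^~ t)) by exists (N (F t)) => _ [n _ <-].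
have mh n : rmeas (h n).
  apply: rmeasB; first exact: rmeas_cst.
  apply: rmeasM; first exact: rmeas_cst.
  apply: rmeas_sum => i; apply: rmeas_sum => j; apply: rmeas_cabs.
  under eq_fun do rewrite !mxE.
  by apply: cmeasB; [exact: mF|exact: cmeas_cst].
have -> : (fun t => N (F t)) = (fun t => sups (h ^~ t) 0).
  apply/funext => t; apply/le_anti/andP; split.
    apply/ler_addgt0Pl => e e0.
    have k0 : 0 < 2 * L + 1 by lra.
    have [X hX] := rat_mx_dense (F t) (divr_gt0 e0 k0).
    have hn : h (pickle X) t <= sups (h ^~ t) 0.
      apply: ub_le_sup; first by exists (N (F t)) => _ [n _ <-].
      by exists (pickle X).
    have := hN (F t) (q (pickle X)); rewrite -lerBlDr => h1.
    move: hn; rewrite /h; move: h1; rewrite /q pickleK.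
    set s := entsum _ in hX *; set x := sups _ _ => h1 h2.
    have : e / (2 * L + 1) * (2 * L + 1) = e by rewrite divfK // gt_eqF.
    set g := e / _ in hX *; have g0 : 0 < g by rewrite divr_gt0.
    move=> <-; have : L * s <= L * g by rewrite ler_wpM2l.
    by lra.
  apply: ge_sup; first by exists (h 0 t); exists 0.
  by move=> _ [n _ <-].
by apply: measurable_fun_sups => // t _.
Qed.

Lemma rmeas_opnorm m p (F : MF R m p) : entrywise (@cmeas R) F ->
  rmeas (fun t => opnorm (F t)).
Proof.
apply: (@rmeas_lipschitz _ _ _ 1) => // A B; rewrite mul1r.
apply: (@le_trans _ _ (opnorm B + opnorm (A - B))); last by rewrite lerD2l opnorm_entsum.
by rewrite -{1}(subrK B A) addrC opnormD.
Qed.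

Lemma sing_lipschitz m p j (A B : 'M[C]_(m, p)) : sing j A <= sing j B + entsum (A - B).
Proof. by apply: le_trans (sing_lip j A B) _; rewrite lerD2l opnorm_entsum. Qed.

Lemma rmeas_sing m p j (F : MF R m p) : entrywise (@cmeas R) F ->
  rmeas (fun t => sing j (F t)).
Proof. by apply: (@rmeas_lipschitz _ _ _ 1) => // A B; rewrite mul1r sing_lipschitz. Qed.

Lemma rmeas_trnorm m p (F : MF R m p) : entrywise (@cmeas R) F ->
  rmeas (fun t => trnorm (F t)).
Proof. by move=> mF; apply: rmeas_sum => j; apply: rmeas_sing. Qed.

Lemma cmeas_mulmx m p q (F : MF R m p) (G : MF R p q) :
  entrywise (@cmeas R) F -> entrywise (@cmeas R) G ->
  entrywise (@cmeas R) (fun t => F t *m G t).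
Proof.
move=> mF mG i j; under eq_fun do rewrite mxE.
by apply: cmeas_sum => k; apply: cmeasM.
Qed.

Lemma cmeas_trace m (F : MF R m m) : entrywise (@cmeas R) F -> cmeas (fun t => \tr (F t)).
Proof. by move=> mF; apply: cmeas_sum => i; apply: mF. Qed.

Lemma rmeas_vnorm p (v : MF R p 1) : entrywise (@cmeas R) v -> rmeas (fun t => vnorm (v t)).
Proof.
move=> mv; apply: rmeas_sqrt; apply: rmeas_sum => i.
by apply: rmeasX; apply: rmeas_cabs; apply: mv.
Qed.

Lemma ae_le_rint (p q : R -> R) : rmeas p -> rint q -> aeT (fun t => `|p t| <= q t) -> rint p.
Proof.
move=> mp iq h; have mq : rmeas q by exact: rint_meas.
apply/integrableP; split; first exact/measurable_EFinP.
have /integrableP[_] := iq; apply: le_lt_trans.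
apply: ae_ge0_le_integral => //.
- by apply/measurable_EFinP; apply: measurableT_comp.
- by apply/measurable_EFinP; apply: measurableT_comp.
- by apply: aeT_S h => t _ /= ht; rewrite lee_fin (le_trans ht) // ler_norm.
Qed.

Lemma measurable_superlevel (g : R -> R) (x : \bar R) : rmeas g ->
  @measurable _ (measurableTypeR R) (T `&` [set t | (x < (g t)%:E)%E]).
Proof.
move=> mg; case: x => [r| |].
- have := mg (@measurable_T01 R) _ (measurable_itv `]r, +oo[).
  congr (measurable (_ `&` _)); apply/seteqP; split=> t /=; by rewrite in_itv /= andbT lte_fin.
- rewrite [X in measurable X](_ : _ = set0) //.
  by apply/seteqP; split=> t // [_]; rewrite /= ltNge leey.
- rewrite [X in measurable X](_ : _ = T) //.
  by apply/seteqP; split=> t [] // Tt; split=> //=; rewrite ltNyr.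
Qed.

(** The infimum defining [esssup] is not assumed to be attained, so the bound is proved with
    [c + 1 / (n + 1)] and the countably many null sets are united. *)
Lemma esssup_ub (g : R -> R) (c : R) : rmeas g -> (esssup g <= c%:E)%E ->
  aeT (fun t => g t <= c).
Proof.
move=> mg hc.
have h n : aeT (fun t => g t <= c + n.+1%:R^-1).
  have n0 : (0 : R) < n.+1%:R^-1 by rewrite invr_gt0.
  have : (esssup g < (c + n.+1%:R^-1)%:E)%E.
    by apply: le_lt_trans hc _; rewrite lte_fin ltrDl.
  move=> /ereal_inf_lt[x /= hx xlt].
  apply/aeT_negligible; have mA : @measurable _ (measurableTypeR R) (T `&` [set t | (x < (g t)%:E)%E]).
    exact: measurable_superlevel.
  apply: (@negligibleS _ _ _ mu (T `&` [set t | (x < (g t)%:E)%E])).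
    move=> t [Tt /= /negP]; rewrite -ltNge => ht; split=> //=.
    by apply: lt_trans xlt _; rewrite lte_fin.
  by apply/negligibleP.
apply: aeT_S (aeT_nat h) => t _ ht; apply/ler_addgt0Pl => e e0.
have := ht (Num.truncn e^-1); rewrite addrC => /le_trans; apply; rewrite lerD2r.
rewrite invf_ple ?posrE ?ltr0n //; apply: ltW.
exact: truncnS_gt.
Qed.

Lemma esssup_le (g : R -> R) (c : R) : rmeas g -> aeT (fun t => g t <= c) -> (esssup g <= c%:E)%E.
Proof.
move=> mg h; apply: ereal_inf_lbound => /=.
have : mu.-negligible (T `&` [set t | (c%:E < (g t)%:E)%E]).
  apply: negligibleS ((aeT_negligible _).1 h) => t [Tt /=]; rewrite lte_fin => ht.
  by split=> //=; apply/negP; rewrite -ltNge.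
by move/negligibleP; apply; exact: measurable_superlevel.
Qed.

End LipschitzMeasurability.

(** * Completeness of vector-valued L2 *)

Section L2Completeness.
Variable R : realType.
Local Notation C := (R[i]).
Local Notation mu := (@lebesgue_measure R).
Local Notation T := (@T01 R).

(** By monotone convergence the sum of all [g j] has integral at most 2, hence is finite almost
    everywhere and dominates each term. Applied to squared errors with geometric weights, it
    upgrades fast convergence in mean to a pointwise geometric rate. *)
Lemma ae_bounded_of_summable (g : nat -> R -> R) :
  (forall j t, T t -> 0 <= g j t) -> (forall j, rint (g j)) ->
  (forall j, \int[mu]_(t in T) g j t <= 2^-1 ^+ j) ->
  aeT (fun t => exists K, forall j, g j t <= K).
Proof.
move=> g0 ig h.
have mg j : measurable_fun (T : set (measurableTypeR R)) (fun t => (g j t)%:E).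
  exact: (measurable_int mu (ig j)).
have ge0 j t : T t -> (0 <= (g j t)%:E)%E by move=> Tt; rewrite lee_fin g0.
have ms : measurable_fun (T : set (measurableTypeR R)) (fun t => \sum_(0 <= j <oo) (g j t)%:E)%E.
  by apply: ge0_emeasurable_sum => [j t Tt _|j _]; [exact: ge0|exact: mg].
have i2 : (\int[mu]_(t in T) \sum_(0 <= j <oo) (g j t)%:E <= 2%:E)%E.
  rewrite integral_nneseries //.
  apply: lime_le.
    by apply: is_cvg_nneseries => j _ _; apply: integral_ge0 => t Tt; exact: ge0.
  apply: nearW => n.
  rewrite (eq_bigr (fun j => (\int[mu]_(t in T) g j t)%:E)) => [|j _]; last by rewrite EFin_Rintegral.
  rewrite sumEFin lee_fin.
  apply: (@le_trans _ _ (\sum_(0 <= j < n) 2^-1 ^+ j)); first by apply: ler_sum => j _.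
  have := @geometric_le_lim R n 1 2^-1 ler01 _ _.
  rewrite /series /= (eq_bigr (fun j => 2^-1 ^+ j)) => [|j _]; last by rewrite mul1r.
  move=> /(_ _ _)/le_trans; apply; rewrite ?invr_gt0 //.
    by rewrite ger0_norm ?invr_ge0 // invf_lt1 // ltr1n.
  have -> : (1 : R) - 2^-1 = 2^-1 by lra.
  by rewrite mul1r invrK.
have is_ : mu.-integrable T (fun t => \sum_(0 <= j <oo) (g j t)%:E)%E.
  apply/integrableP; split=> //.
  have -> : (\int[mu]_(t in T) `|\sum_(0 <= j <oo) (g j t)%:E| =
      \int[mu]_(t in T) \sum_(0 <= j <oo) (g j t)%:E)%E.
    apply: eq_integral => t /set_mem Tt; rewrite gee0_abs //.
    by apply: nneseries_ge0 => j _ _; apply: ge0.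
  by apply: le_lt_trans i2 _; rewrite ltry.
have := integrable_ae (@measurable_T01 R) is_.
apply: aeT_S => t Tt ht.
exists (fine (\sum_(0 <= j <oo) (g j t)%:E)%E) => j.
rewrite -lee_fin fineK //.
apply: le_trans (nneseries_lim_ge j.+1 _); last by move=> i _ _; apply: ge0.
rewrite big_nat_recr //= leeDr // sume_ge0 // => i _; exact: ge0.
Qed.

Lemma cauchy_rate_cvg (v : nat -> R) (K : R) :
  (forall j, `|v j.+1 - v j| <= K * 2^-1 ^+ j) -> cvgn v.
Proof.
move=> h; have K0 : 0 <= K by have := h 0; rewrite expr0 mulr1; apply: le_trans.
(* The telescoped bound keeps its negative term so that the induction closes exactly. *)
have hd j n : `|v (j + n)%N - v j| <= 2 * K * 2^-1 ^+ j - 2 * K * 2^-1 ^+ (j + n).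
  elim: n => [|n ih]; first by rewrite addn0 !subrr normr0.
  rewrite addnS; apply: (@le_trans _ _ (`|v (j + n).+1 - v (j + n)%N| + `|v (j + n)%N - v j|)).
    by rewrite -{1}(subrK (v (j + n)%N) (v (j + n).+1)) -addrA ler_normD.
  have := h (j + n)%N; rewrite exprS; set e := 2^-1 ^+ (j + n) in ih *; lra.
apply/cauchy_cvgP/cauchy_exP => e e0 /=.
have : geometric (2 * K) 2^-1 @ \oo --> 0.
  by apply: cvg_geometric; rewrite ger0_norm ?invr_ge0 // invf_lt1 // ltr1n.
move/cvgrPdist_lt => /(_ _ e0)[N _ hN].
have hN' j : (N <= j)%N -> `|v j - v N| < e.
  move=> Nj; have := hd N (j - N)%N; rewrite subnKC // => /le_lt_trans; apply.
  have := hN N (leqnn N); rewrite /geometric /= sub0r normrN => h1.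
  apply: le_lt_trans (le_lt_trans (ler_norm _) h1).
  by rewrite gerBl !mulr_ge0 // exprn_ge0 ?invr_ge0.
exists (v N); exists N => // j /= Nj.
by rewrite /ball /= distrC; exact: hN'.
Qed.

Definition Q2 (f : R -> R) : R := \int[mu]_(t in T) (f t ^+ 2).

Lemma rint_sqrD (f g : R -> R) : rmeas f -> rmeas g ->
  rint (fun t => f t ^+ 2) -> rint (fun t => g t ^+ 2) -> rint (fun t => (f t + g t) ^+ 2).
Proof.
move=> mf mg i1 i2; apply: (rint_le _ _ (rintD (rintZ 2 i1) (rintZ 2 i2))).
  by apply: rmeasX; apply: rmeasD.
move=> t _; rewrite ger0_norm ?sqr_ge0 //; have := sqr_ge0 (f t - g t); nra.
Qed.

Lemma rint_sqrB (f g : R -> R) : rmeas f -> rmeas g ->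
  rint (fun t => f t ^+ 2) -> rint (fun t => g t ^+ 2) -> rint (fun t => (f t - g t) ^+ 2).
Proof.
move=> mf mg i1 i2; apply: (rint_sqrD mf).
- by have := rmeasM (rmeas_cst (-1)) mg; congr rmeas; apply/funext => t; rewrite mulN1r.
- by [].
- by under eq_fun do rewrite sqrrN.
Qed.

Lemma Q2D (f g h : R -> R) : rint (fun t => (f t - g t) ^+ 2) ->
  rint (fun t => (g t - h t) ^+ 2) -> rint (fun t => (f t - h t) ^+ 2) ->
  Q2 (fun t => f t - h t) <= 2 * Q2 (fun t => f t - g t) + 2 * Q2 (fun t => g t - h t).
Proof.
move=> i1 i2 i3; rewrite /Q2 -!RintegralZl // -RintegralD //; try exact: rintZ.
apply: le_Rint => //; first by apply: rintD; exact: rintZ.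
by apply: aeT_W => t _; have := sqr_ge0 ((f t - g t) - (g t - h t)); nra.
Qed.

(** Riesz-Fischer: a subsequence with gaps below [8^-j] converges almost everywhere, Fatou bounds
    its distance to the limit, and the Cauchy property brings in the whole sequence. *)
Lemma L2_complete (u : nat -> R -> R) :
  (forall i, rmeas (u i)) -> (forall i, rint (fun t => u i t ^+ 2)) ->
  (forall e, 0 < e -> exists N : nat, forall i j, (N <= i)%N -> (N <= j)%N ->
     Q2 (fun t => u i t - u j t) < e) ->
  exists l : R -> R, [/\ rmeas l, rint (fun t => l t ^+ 2) &
    forall e, 0 < e -> exists N : nat, forall i, (N <= i)%N -> Q2 (fun t => u i t - l t) < e].
Proof.
move=> mu_ iu hC.
have e8 (j : nat) : (0 : R) < 8^-1 ^+ j by rewrite exprn_gt0 // invr_gt0.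
have /choice[N hN] : forall j : nat, exists N : nat, forall a b, (N <= a)%N -> (N <= b)%N ->
    Q2 (fun t => u a t - u b t) < 8^-1 ^+ j by move=> j; exact: hC.
(* The maximum makes [M j] admissible for all tolerances up to the [j]-th, not just its own. *)
pose M j := (\max_(i < j.+1) N i)%N.
have NM i j : (i <= j)%N -> (N i <= M j)%N.
  by move=> ij; apply: (@leq_bigmax _ (fun i : 'I_j.+1 => N i) (Ordinal (ij : (i < j.+1)%N))).
pose v j := u (M j).
have hv i j k : (i <= j)%N -> (i <= k)%N -> Q2 (fun t => v j t - v k t) < 8^-1 ^+ i.
  by move=> ij ik; apply: hN; apply: NM.
have ivd i j : rint (fun t => (u i t - u j t) ^+ 2) by exact: rint_sqrB.
(* The weight [4^j] against [8^-j] leaves the summable [2^-j]. *)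
pose g j t := (2 ^+ j) ^+ 2 * (v j.+1 t - v j t) ^+ 2.
have : aeT (fun t => exists K, forall j, g j t <= K).
  apply: ae_bounded_of_summable => [j t _|j|j].
  - by rewrite mulr_ge0 ?sqr_ge0.
  - exact: (rintZ _ (ivd _ _)).
  rewrite RintegralZl //; last exact: ivd.
  have := hv j j.+1 j (leqnSn _) (leqnn _); rewrite /Q2 => /ltW h.
  apply: le_trans (ler_wpM2l (sqr_ge0 _) h) _.
  by rewrite exprAC -exprMn -natrX; rewrite (_ : (2 ^ 2)%:R * 8^-1 = 2^-1 :> R) //; field.
move=> hae; have hcv : aeT (fun t => cvgn (fun j => v j t)).
  apply: aeT_S hae => t _ [K hK].
  have K0 : 0 <= K by apply: le_trans (hK 0%N); rewrite mulr_ge0 ?sqr_ge0.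
  apply: (@cauchy_rate_cvg _ (K + 1)) => j.
  have p2 : (0 : R) < 2 ^+ j by rewrite exprn_gt0.
  rewrite exprVn ler_pdivlMr // mulrC -(ger0_norm (ltW p2)) -normrM.
  apply: le_sqr_ge0; rewrite ?normr_ge0 ?addr_ge0 // real_normK ?num_real // exprMn.
  apply: le_trans (hK j) _; nra.
have [B [mB B0 hB]] := hcv.
(* Setting everything to zero on the null set [B] makes the sequence converge at every point, whence
   a measurable limit. *)
pose D := T `\` B.
have mD : @measurable _ (measurableTypeR R) D by apply: measurableD.
have cvD t : D t -> cvgn (fun j => v j t).
  by move=> [Tt nB]; apply: contrapT => h; apply: nB; apply: hB => /= h'; apply: h; apply: h'.
pose w j := v j \_ D.
pose l := (fun t => limn (fun j => v j t)) \_ D.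
have cvw t : (w ^~ t) @ \oo --> l t.
  rewrite /w /l patchE; under eq_fun do rewrite patchE.
  case: ifPn => [/set_mem Dt|_].
    by apply: cvD.
  exact: cvg_cst.
have mw j : rmeas (w j).
  apply/(measurable_restrict _ mD (@measurable_T01 R)).
  rewrite setIidr; last by move=> t [].
  by apply: (measurable_funS (@measurable_T01 R)) (mu_ (M j)) => t [].
have ml : rmeas l by apply: (measurable_fun_cvg mw) => t _; exact: cvw.
have aeD : aeT D.
  apply/aeT_negligible; exists B; split=> // t [Tt nD]; apply: contrapT => nB.
  by apply: nD; split.
have iw j : rint (fun t => w j t ^+ 2).
  apply: (rint_le _ _ (iu (M j))); first exact: rmeasX.
  move=> t _; rewrite ger0_norm ?sqr_ge0 // /w patchE; case: ifP => // _.
  by rewrite expr0n sqr_ge0.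
have Qw i : rint (fun t => (w i t - l t) ^+ 2) /\ Q2 (fun t => w i t - l t) <= 8^-1 ^+ i.
  pose f m t := ((w i t - w m t) ^+ 2)%:E.
  have mf m : measurable_fun (T : set (measurableTypeR R)) (f m).
    by apply/measurable_EFinP; apply: rmeasX; apply: rmeasB.
  have f0 m t : T t -> (0 <= f m t)%E by move=> _; rewrite lee_fin sqr_ge0.
  have := fatou mu (@measurable_T01 R) mf f0.
  have -> : (\int[mu]_(t in T) limn_einf (f^~ t) = \int[mu]_(t in T) ((w i t - l t) ^+ 2)%:E)%E.
    apply: eq_integral => t _; apply: (cvg_limn_einf_sup _).1.
    apply: cvg_EFin; first exact: nearW.
    under eq_fun do rewrite /f /= expr2; rewrite expr2.
    by apply: cvgM; apply: cvgB; [exact: cvg_cst|exact: cvw|exact: cvg_cst|exact: cvw].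
  have fm m : (i <= m)%N -> (\int[mu]_(t in T) f m t <= (8^-1 ^+ i)%:E)%E.
    move=> im; rewrite /f -EFin_Rintegral; last exact: rint_sqrB.
    rewrite lee_fin; apply: le_trans (ltW (hv i i m (leqnn i) im)).
    apply: le_Rint; [exact: rint_sqrB|exact: ivd|].
    apply: aeT_W => t _; rewrite /w !patchE; case: ifP => // _.
    by rewrite subrr expr0n sqr_ge0.
  have hl : (limn_einf (fun m => \int[mu]_(t in T) f m t) <= (8^-1 ^+ i)%:E)%E.
    rewrite limn_einf_lim; apply: lime_le; first exact: is_cvg_einfs.
    near=> m; apply: le_trans (fm m _); last by near: m; exact: nbhs_infty_ge.
    by apply: ereal_inf_lbound; exists m => /=.
  move=> /le_trans/(_ hl) hI.
  have ri : rint (fun t => (w i t - l t) ^+ 2).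
    apply/rint_ge0P; first by apply: rmeasX; exact: rmeasB.
      by move=> t _; exact: sqr_ge0.
    by apply: le_lt_trans hI _; rewrite ltry.
  by split=> //; rewrite -lee_fin /Q2 EFin_Rintegral.
(* [l] is recovered as [w 0 - (w 0 - l)], a difference of two square integrable functions. *)
have il : rint (fun t => l t ^+ 2).
  have := rint_sqrB (mw 0%N) (rmeasB (mw 0%N) ml) (iw 0%N) (Qw 0%N).1.
  by congr rint; apply/funext => t; rewrite subKr.
exists l; split=> // e e0.
have wv : aeT (fun t => forall j, w j t = v j t).
  by apply: aeT_S aeD => t _ Dt j; rewrite /w patchE mem_set.
have ivl i : rint (fun t => (u i t - l t) ^+ 2) by exact: rint_sqrB.
have Qv j : Q2 (fun t => v j t - l t) <= 8^-1 ^+ j.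
  apply: le_trans (Qw j).2; apply: le_Rint; [exact: ivl|exact: (Qw j).1|].
  by apply: aeT_S wv => t _ ->.
have e4 : 0 < e / 4 by rewrite divr_gt0.
have [N1 hN1] := hC _ e4.
have : geometric 1 (8^-1 : R) @ \oo --> 0.
  by apply: cvg_geometric; rewrite ger0_norm ?invr_ge0 // invf_lt1 // ltr1n.
move/cvgrPdist_lt => /(_ _ e4)[N2 _ hN2].
pose j := maxn N1 N2.
have Mj : (N1 <= maxn N1 (M j))%N by rewrite leq_maxl.
have h8 : 8^-1 ^+ j < e / 4.
  have := hN2 j (leq_maxr _ _); rewrite /geometric /= sub0r normrN mul1r.
  by rewrite ger0_norm // exprn_ge0 // invr_ge0.
exists (maxn N1 (N j)) => i hi.
have h1 : Q2 (fun t => u i t - v j t) < 8^-1 ^+ j.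
  by apply: hN; [apply: leq_trans hi; rewrite leq_maxr|exact: NM].
have := Q2D (ivd i (M j)) (ivl (M j)) (ivl i).
have := Qv j; rewrite -/(v j); lra.
Unshelve. all: by end_near.
Qed.

End L2Completeness.

(** * The space of square integrable vector functions *)

Section VectorL2.
Variable R : realType.
Local Notation C := (R[i]).
Local Notation mu := (@lebesgue_measure R).
Local Notation T := (@T01 R).
Implicit Types (f g : R -> C).

Lemma inL2P f : inL2 f <-> cmeas f /\ rint (fun t => cabs (f t) ^+ 2).
Proof.
by split=> -[mf h]; split=> //; apply/(rint_ge0P (rmeasX 2 (rmeas_cabs mf))) => // t _; exact: sqr_ge0.
Qed.

Lemma inL2_cmeas f : inL2 f -> cmeas f. Proof. by case. Qed.

Lemma inL2_rint f : inL2 f -> rint (fun t => cabs (f t) ^+ 2).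
Proof. by move=> /inL2P[]. Qed.

Lemma inL2_ae_le f (p : R -> R) : cmeas f -> rint p ->
  aeT (fun t => cabs (f t) ^+ 2 <= p t) -> inL2 f.
Proof.
move=> mf ip h; apply/inL2P; split=> //.
apply: (ae_le_rint (rmeasX 2 (rmeas_cabs mf)) ip).
by apply: aeT_S h => t _; rewrite ger0_norm // sqr_ge0.
Qed.

Lemma inL2D f g : inL2 f -> inL2 g -> inL2 (fun t => f t + g t).
Proof.
move=> /inL2P[mf f2] /inL2P[mg g2].
apply: (inL2_ae_le _ (rintD (rintZ 2 f2) (rintZ 2 g2))); first exact: cmeasD.
by apply: aeT_W => t _; apply: sqr_cabsD.
Qed.

Lemma inL2_bddM f g (M : R) : cmeas g -> aeT (fun t => cabs (g t) <= M) ->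
  inL2 f -> inL2 (fun t => g t * f t).
Proof.
move=> mg h /inL2P[mf f2]; apply: (inL2_ae_le _ (rintZ (M ^+ 2) f2)); first exact: cmeasM.
apply: aeT_S h => t _ ht; rewrite cabsM exprMn ler_wpM2r ?sqr_ge0 //.
by rewrite lerXn2r ?nnegrE ?cabs_ge0 // (le_trans _ ht) ?cabs_ge0.
Qed.

Lemma inL2Z z f : inL2 f -> inL2 (fun t => z * f t).
Proof. by apply: (inL2_bddM (M := cabs z)); [exact: cmeas_cst|exact: aeT_W]. Qed.

Lemma inL2_echarM k f : inL2 f -> inL2 (fun t => echar k t * f t).
Proof.
apply: (inL2_bddM (M := 1)); first exact: cmeas_echar.
by apply: aeT_W => t _; rewrite cabs_echar.
Qed.

Lemma inL2_0 : inL2 (fun=> 0 : C).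
Proof.
apply: (inL2_ae_le (cmeas_cst 0) (rint_cst 0)); apply: aeT_W => t _.
by rewrite cabs0 expr0n.
Qed.

Lemma inL2N f : inL2 f -> inL2 (fun t => - f t).
Proof. by move=> ?; under eq_fun do rewrite -mulN1r; apply: inL2Z. Qed.

Lemma inL2J f : inL2 f -> inL2 (fun t => ((f t)^*)%C).
Proof.
move=> /inL2P[mf f2]; apply: (inL2_ae_le _ f2); first exact: cmeasJ.
by apply: aeT_W => t _; rewrite cabsJ.
Qed.

Lemma inL2_sum (I : Type) (r : seq I) (P : pred I) (F : I -> R -> C) :
  (forall i, inL2 (F i)) -> inL2 (fun t => \sum_(i <- r | P i) F i t).
Proof.
move=> h; elim: r => [|i r ih].
  by under eq_fun do rewrite big_nil; apply: inL2_0.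
by under eq_fun do rewrite big_cons; case: (P i) => //; apply: inL2D.
Qed.

Lemma inL2M f g : inL2 f -> inL2 g -> inL1 (fun t => f t * g t).
Proof.
move=> /inL2P[mf f2] /inL2P[mg g2].
apply: (inL1_le _ (rintD f2 g2)); first exact: cmeasM.
move=> t _; rewrite cabsM.
have := sqr_ge0 (cabs (f t) - cabs (g t)); have := mulr_ge0 (cabs_ge0 (f t)) (cabs_ge0 (g t)).
nra.
Qed.

Lemma inL2_inL1 f : inL2 f -> inL1 f.
Proof.
have h1 : inL2 (fun=> 1 : C).
  apply: (inL2_ae_le (cmeas_cst 1) (rint_cst 1)); apply: aeT_W => t _.
  by rewrite cabs1 expr1n.
by move=> /(inL2M h1); under eq_fun do rewrite mul1r.
Qed.

Lemma inL2_echar k : inL2 (@echar R k).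
Proof.
apply: (@inL2_ae_le (@echar R k) (fun=> 1)); [exact: cmeas_echar|exact: rint_cst|].
by apply: aeT_W => t _; rewrite cabs_echar expr1n.
Qed.

Lemma RintD (p q : R -> R) : rint p -> rint q ->
  \int[mu]_(t in T) (p t + q t) = \int[mu]_(t in T) p t + \int[mu]_(t in T) q t.
Proof. by move=> ip iq; rewrite RintegralD. Qed.

Lemma Rint_sum (I : Type) (r : seq I) (F : I -> R -> R) : (forall i, rint (F i)) ->
  \int[mu]_(t in T) (\sum_(i <- r) F i t) = \sum_(i <- r) \int[mu]_(t in T) F i t.
Proof.
move=> h; elim: r => [|i r ih].
  rewrite big_nil; under eq_Rintegral do rewrite big_nil.
  by rewrite Rintegral_cst // mul0r.
rewrite big_cons -ih -RintD //; last exact: rint_sum.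
by apply: eq_Rintegral => t _; rewrite big_cons.
Qed.

Section Vectors.
Variable n : nat.
Local Notation V := (R -> 'cV[C]_n).
Implicit Types (v w : V).

Definition L2v v : Prop := entrywise (@inL2 R) (v : MF R n 1).

Definition vip v w : C := cint (fun t => vdot (w t) (v t)).

Lemma L2v_cmeas v : L2v v -> entrywise (@cmeas R) (v : MF R n 1).
Proof. by move=> h i j; case: (h i j). Qed.

Lemma L2v_entry v i : L2v v -> inL2 (fun t => v t i 0).
Proof. by move=> h; apply: h. Qed.

Lemma L2vP v : (forall i, inL2 (fun t => v t i 0)) -> L2v v.
Proof. by move=> h i j; rewrite (ord1 j); exact: h. Qed.

Lemma vip_inL1 v w : L2v v -> L2v w -> inL1 (fun t => vdot (w t) (v t)).
Proof.
move=> hv hw; under eq_fun do rewrite vdotE.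
by apply: inL1_sum => i; apply: inL2M; [apply: inL2J|]; exact: L2v_entry.
Qed.

Lemma L2v_lin a v w : L2v v -> L2v w -> L2v (a *: v + w).
Proof.
move=> hv hw; apply: L2vP => i.
have := inL2D (inL2Z a (L2v_entry i hv)) (L2v_entry i hw).
by congr inL2; apply/funext => t; rewrite /= !mxE.
Qed.

Lemma L2v_0 : L2v 0.
Proof. by apply: L2vP => i; have := inL2_0; congr inL2; apply/funext => t; rewrite mxE. Qed.

Lemma vdotDr (x y z : 'cV[C]_n) a : vdot x (a *: y + z) = a * vdot x y + vdot x z.
Proof. by rewrite /vdot mulmxDr -scalemxAr !mxE. Qed.

Lemma vdotC (x y : 'cV[C]_n) : vdot y x = ((vdot x y)^*)%C.
Proof.
by rewrite !vdotE conjc_sum; apply: eq_bigr => i _; rewrite conjcM conjcK mulrC.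
Qed.

Lemma vip_semi_inner : semi_inner L2v vip.
Proof.
split.
- exact: L2v_0.
- exact: L2v_lin.
- move=> a u v w hu hv hw.
  rewrite /vip -cintZ; last exact: vip_inL1.
  rewrite -cintD; [|apply: inL1Z; exact: vip_inL1|exact: vip_inL1].
  by apply: eq_cint => t _; rewrite -vdotDr.
- move=> u v hu hv; rewrite /vip -cintJ; last exact: vip_inL1.
  by apply: eq_cint => t _; rewrite vdotC.
- move=> v hv; rewrite /vip Re_cint; apply: Rintegral_ge0 => t _.
  by rewrite vdotvv /= sqr_ge0.
Qed.

Lemma ipq_vip v : ipq vip v = \int[mu]_(t in T) (vnorm (v t) ^+ 2).
Proof. by rewrite /ipq /vip Re_cint; apply: eq_Rintegral => t _; rewrite vdotvv. Qed.

Lemma rint_sqr_vnorm v : L2v v -> rint (fun t => vnorm (v t) ^+ 2).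
Proof.
move=> hv; under eq_fun do rewrite sqr_vnorm.
by apply: rint_sum => i; apply: inL2_rint; exact: L2v_entry.
Qed.

Lemma L2v_vnorm v : entrywise (@cmeas R) (v : MF R n 1) ->
  rint (fun t => vnorm (v t) ^+ 2) -> L2v v.
Proof.
move=> mv iv; apply: L2vP => i; apply: (inL2_ae_le _ iv); first exact: mv.
apply: aeT_W => t _; rewrite lerXn2r ?nnegrE ?cabs_ge0 ?vnorm_ge0 //.
exact: cabs_le_vnorm.
Qed.

Lemma ipq_vip_eq0 v : L2v v -> ipq vip v <= 0 -> aeT (fun t => v t = 0).
Proof.
move=> hv; rewrite ipq_vip => h0.
have := Rint_ge0_eq0 (rint_sqr_vnorm hv) (fun t _ => sqr_ge0 (vnorm (v t))) h0.
by apply: aeT_S => t _ /eqP; rewrite sqrf_eq0 => /eqP/vnorm_eq0.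
Qed.

(** Completeness is inherited from the [2 n] real coordinates; [part] treats real and imaginary
    parts alike, as additive maps bounded by the modulus. *)
Lemma vip_complete : si_complete L2v vip.
Proof.
move=> u hu hC.
have H := vip_semi_inner.
have part (p : C -> R) (i : 'I_n) : (forall z, `|p z| <= cabs z) ->
    (forall z w : C, p (z - w) = p z - p w) ->
    (forall f, cmeas f -> rmeas (fun t => p (f t))) ->
    exists l : R -> R, [/\ rmeas l, rint (fun t => l t ^+ 2) &
      forall e, 0 < e -> exists N : nat, forall j, (N <= j)%N ->
        Q2 (fun t => p (u j t i 0) - l t) < e].
  move=> hp pB pm.
  have le2 z : p z ^+ 2 <= cabs z ^+ 2.
    by rewrite -real_normK ?num_real // lerXn2r ?nnegrE ?cabs_ge0.
  have mp j : rmeas (fun t => p (u j t i 0)) by apply: pm; exact: (L2v_cmeas (hu j)).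
  have ip j : rint (fun t => p (u j t i 0) ^+ 2).
    apply: (rint_le (rmeasX 2 (mp j)) _ (inL2_rint (L2v_entry i (hu j)))).
    by move=> t _; rewrite ger0_norm ?sqr_ge0.
  apply: L2_complete => // e e0; have [N hN] := hC e e0; exists N => j k hj hk.
  apply: le_lt_trans (hN j k hj hk); rewrite ipq_vip; apply: le_Rint.
  - exact: rint_sqrB.
  - by apply: rint_sqr_vnorm; exact: (siB H).
  apply: aeT_W => t _; rewrite -pB; apply: le_trans (le2 _) _.
  rewrite lerXn2r ?nnegrE ?cabs_ge0 ?vnorm_ge0 //.
  by apply: le_trans (cabs_le_vnorm _ i); rewrite !mxE.
have /choice[lr hr] : forall i, exists l : R -> R, [/\ rmeas l, rint (fun t => l t ^+ 2) &
    forall e, 0 < e -> exists N : nat, forall j, (N <= j)%N ->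
      Q2 (fun t => complex.Re (u j t i 0) - l t) < e].
  move=> i; apply: part; [exact: cabs_ge_Re|by move=> z w; rewrite ReD ReN|exact: rmeas_Re].
have /choice[li hi] : forall i, exists l : R -> R, [/\ rmeas l, rint (fun t => l t ^+ 2) &
    forall e, 0 < e -> exists N : nat, forall j, (N <= j)%N ->
      Q2 (fun t => complex.Im (u j t i 0) - l t) < e].
  move=> i; apply: part; [exact: cabs_ge_Im|by move=> z w; rewrite ImD ImN|exact: rmeas_Im].
pose l : V := fun t => \col_i Complex (lr i t) (li i t).
have Dl : L2v l.
  apply: L2vP => i; have [mr ir _] := hr i; have [mi ii _] := hi i.
  apply: (inL2_ae_le _ (rintD ir ii)).
    by split; [move: mr|move: mi]; congr rmeas; apply/funext => t; rewrite mxE.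
  by apply: aeT_W => t _; rewrite mxE sqr_cabs.
exists l => // e e0.
(* The [2 n] coordinate errors add up to at most [2 n d]; the [+ 1] keeps this strictly below [e]
   and covers [n = 0]. *)
pose d := e / (2 * (n%:R + 1)).
have d0 : 0 < d by rewrite divr_gt0 // mulr_gt0 // ltr_wpDl.
have /choice[N1 hN1] : forall i, exists N : nat, forall j, (N <= j)%N ->
    Q2 (fun t => complex.Re (u j t i 0) - lr i t) < d.
  by move=> i; have [_ _] := hr i; apply.
have /choice[N2 hN2] : forall i, exists N : nat, forall j, (N <= j)%N ->
    Q2 (fun t => complex.Im (u j t i 0) - li i t) < d.
  by move=> i; have [_ _] := hi i; apply.
exists (\max_i maxn (N1 i) (N2 i))%N => j hj.
have hj1 i : (N1 i <= j)%N.
  by apply: leq_trans hj; apply: leq_trans (leq_maxl _ (N2 i)) _; exact: (@leq_bigmax _ (fun i => maxn (N1 i) (N2 i))).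
have hj2 i : (N2 i <= j)%N.
  by apply: leq_trans hj; apply: leq_trans (leq_maxr (N1 i) _) _; exact: (@leq_bigmax _ (fun i => maxn (N1 i) (N2 i))).
have ire i : rint (fun t => (complex.Re (u j t i 0) - lr i t) ^+ 2).
  have [mr ir _] := hr i; apply: rint_sqrB => //.
    by apply: rmeas_Re; exact: (L2v_cmeas (hu j)).
  apply: (rint_le _ _ (inL2_rint (L2v_entry i (hu j)))).
    by apply: rmeasX; apply: rmeas_Re; exact: (L2v_cmeas (hu j)).
  by move=> t _; rewrite ger0_norm ?sqr_ge0 // sqr_cabs lerDl sqr_ge0.
have iim i : rint (fun t => (complex.Im (u j t i 0) - li i t) ^+ 2).
  have [mi ii _] := hi i; apply: rint_sqrB => //.
    by apply: rmeas_Im; exact: (L2v_cmeas (hu j)).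
  apply: (rint_le _ _ (inL2_rint (L2v_entry i (hu j)))).
    by apply: rmeasX; apply: rmeas_Im; exact: (L2v_cmeas (hu j)).
  by move=> t _; rewrite ger0_norm ?sqr_ge0 // sqr_cabs lerDr sqr_ge0.
have -> : ipq vip (u j - l) = \sum_i (Q2 (fun t => complex.Re (u j t i 0) - lr i t) +
    Q2 (fun t => complex.Im (u j t i 0) - li i t)).
  rewrite ipq_vip.
  have -> : \int[mu]_(t in T) vnorm ((u j - l) t) ^+ 2 =
     \int[mu]_(t in T) \sum_i ((complex.Re (u j t i 0) - lr i t) ^+ 2 + (complex.Im (u j t i 0) - li i t) ^+ 2).
    apply: eq_Rintegral => t _; rewrite sqr_vnorm; apply: eq_bigr => i _.
    by rewrite !mxE sqr_cabs ReD ImD ReN ImN.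
  rewrite (@Rint_sum _ _ (fun i t => (complex.Re (u j t i 0) - lr i t) ^+ 2 + (complex.Im (u j t i 0) - li i t) ^+ 2)).
    by apply: eq_bigr => i _; rewrite RintD.
  by move=> i; apply: rintD.
apply: (@le_lt_trans _ _ (\sum_(i < n) (d + d))).
  by apply: ler_sum => i _; apply: lerD; apply: ltW; [exact: hN1|exact: hN2].
rewrite sumr_const card_ord -mulr_natr.
have : d * (2 * (n%:R + 1)) = e by rewrite /d divfK // gt_eqF // mulr_gt0 // ltr_wpDl.
by have := ler0n R n; move: d0; nra.
Qed.

(** Approximants with squared error below [4^-j], weighted by [2^j], are summable, so the pointwise
    error tends to 0. Pointwise closed conditions shared by the elements of [A] thereby reach the
    closure. *)
Lemma si_cl_ae A v : subspace_of L2v A -> si_cl L2v vip A v ->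
  exists2 a : nat -> V, forall i, A (a i) &
    aeT (fun t => forall e, 0 < e -> exists i, vnorm (v t - a i t) <= e).
Proof.
move=> [A0 AL AD] [Dv hv]; have H := vip_semi_inner.
have e4 (j : nat) : (0 : R) < 4^-1 ^+ j by rewrite exprn_gt0 // invr_gt0.
have /choice[a ha] : forall j : nat, exists a, A a /\ ipq vip (v - a) < 4^-1 ^+ j.
  by move=> j; have [a Aa h] := hv _ (e4 j); exists a.
have Aa i : A (a i) by case: (ha i).
exists a => //.
have Dd i : L2v (v - a i) by apply: (siB H) => //; apply: AD.
have : aeT (fun t => exists K, forall j, 2 ^+ j * vnorm ((v - a j) t) ^+ 2 <= K).
  apply: ae_bounded_of_summable => [j t _|j|j].
  - by rewrite mulr_ge0 ?sqr_ge0 // exprn_ge0.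
  - by apply: rintZ; apply: rint_sqr_vnorm.
  rewrite RintegralZl //; last exact: rint_sqr_vnorm.
  rewrite -ipq_vip; have [_ /ltW h] := ha j.
  apply: le_trans (ler_wpM2l (exprn_ge0 _ _) h) _; first by [].
  by rewrite -exprMn (_ : 2 * 4^-1 = 2^-1 :> R) //; field.
apply: aeT_S => t _ [K hK] e e0.
have K0 : 0 <= K by apply: le_trans (hK 0%N); rewrite mulr_ge0 ?sqr_ge0 // exprn_ge0.
have : geometric K (2^-1 : R) @ \oo --> 0.
  by apply: cvg_geometric; rewrite ger0_norm ?invr_ge0 // invf_lt1 // ltr1n.
have e20 : 0 < e ^+ 2 by rewrite exprn_gt0.
move/cvgrPdist_lt => /(_ _ e20)[N _ /(_ N (leqnn N))].
rewrite /geometric /= sub0r normrN => hN; exists N.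
apply: le_sqr_ge0; [exact: vnorm_ge0|exact: ltW|].
apply: ltW; apply: le_lt_trans (le_lt_trans (ler_norm _) hN).
have := hK N; have p2 : (0 : R) < 2 ^+ N by rewrite exprn_gt0.
by rewrite exprVn ler_pdivlMr // mulrC.
Qed.

Definition vshift (k : int) v : V := fun t => echar k t *: v t.

Lemma vshift_L2v k v : L2v v -> L2v (vshift k v).
Proof.
move=> hv; apply: L2vP => i; have := inL2_echarM k (L2v_entry i hv).
by congr inL2; apply/funext => t; rewrite mxE.
Qed.

Lemma vshiftK k v : vshift (- k) (vshift k v) = v.
Proof. by apply/funext => t; rewrite /vshift scalerA echar_cancel scale1r. Qed.

Lemma vshiftD k l v : vshift (k + l) v = vshift k (vshift l v).
Proof. by apply/funext => t; rewrite /vshift scalerA echarD. Qed.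

Lemma vshift0 v : vshift 0 v = v.
Proof. by apply/funext => t; rewrite /vshift echar0 scale1r. Qed.

Lemma vshift_lin k a v w : vshift k (a *: v + w) = a *: vshift k v + vshift k w.
Proof.
apply/funext => t.
transitivity (a *: (echar k t *: v t) + echar k t *: w t); last by [].
by rewrite /vshift -[(a *: v + w) t]/(a *: v t + w t) scalerDr !scalerA mulrC.
Qed.

Lemma vip_shift k v w : vip (vshift k v) w = vip v (vshift (- k) w).
Proof.
rewrite /vip; apply: eq_cint => t _; rewrite !vdotE; apply: eq_bigr => i _.
by rewrite !mxE echarN conjcM conjcK; ring.
Qed.

Lemma ipq_vshift k v : ipq vip (vshift k v) = ipq vip v.
Proof. by rewrite /ipq vip_shift vshiftK. Qed.

End Vectors.
End VectorL2.

(** * Shift-invariant subspaces *)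

Section AnalyticSpan.
Variable R : realType.
Local Notation C := (R[i]).
Local Notation mu := (@lebesgue_measure R).
Local Notation T := (@T01 R).

Section Span.
Variables (n : nat) (I : Type) (u : I -> R -> 'cV[C]_n).
Hypothesis hu : forall i, L2v (u i).
Local Notation V := (R -> 'cV[C]_n).
Implicit Types (v w : V).

Inductive analytic_span : V -> Prop :=
| analytic_span0 : analytic_span 0
| analytic_spanS c (j : nat) i v :
    analytic_span v -> analytic_span (c *: vshift j%:Z (u i) + v).

Definition shifted_span v : Prop := exists2 w, analytic_span w & v = vshift 1 w.

Lemma analytic_span_L2v v : analytic_span v -> L2v v.
Proof.
elim=> [|c j i w _ ih]; first exact: L2v_0.
by apply: L2v_lin => //; apply: vshift_L2v.
Qed.

Lemma analytic_span_lin a v w :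
  analytic_span v -> analytic_span w -> analytic_span (a *: v + w).
Proof.
move=> hv hw; elim: hv => [|c j i v' _ ih]; first by rewrite scaler0 add0r.
by rewrite scalerDr scalerA -addrA; apply: analytic_spanS.
Qed.

Lemma analytic_span_subspace : subspace_of (@L2v R n) analytic_span.
Proof.
split; [exact: analytic_span0|exact: analytic_span_lin|exact: analytic_span_L2v].
Qed.

Lemma vshift_0 k : vshift k (0 : V) = 0.
Proof. by apply/funext => t; rewrite /vshift scaler0. Qed.

Lemma analytic_span_shift v : analytic_span v -> analytic_span (vshift 1 v).
Proof.
elim=> [|c j i w _ ih]; first by rewrite vshift_0; apply: analytic_span0.
by rewrite vshift_lin -vshiftD -PoszD add1n; apply: analytic_spanS.
Qed.

Lemma shifted_span_subspace : subspace_of (@L2v R n) shifted_span.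
Proof.
split.
- by exists 0; [exact: analytic_span0|rewrite vshift_0].
- move=> a _ _ [v hv ->] [w hw ->]; exists (a *: v + w); last by rewrite vshift_lin.
  exact: analytic_span_lin.
- by move=> _ [v hv ->]; apply/vshift_L2v/analytic_span_L2v.
Qed.

Lemma analytic_span_gen i : analytic_span (u i).
Proof.
have := analytic_spanS 1 0 i analytic_span0.
by rewrite vshift0 scale1r addr0.
Qed.

Lemma analytic_span_orth w : L2v w ->
  (forall (j : nat) i, vip (vshift j%:Z (u i)) w = 0) ->
  forall a, analytic_span a -> vip a w = 0.
Proof.
move=> hw h a; elim=> [|c j i v hv ih].
  by rewrite (ip0l (@vip_semi_inner R n)).
rewrite (si_lin (@vip_semi_inner R n)) // ?h ?ih ?mulr0 ?addr0 //.
  exact: vshift_L2v.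
exact: analytic_span_L2v.
Qed.

Local Notation M := (si_cl (@L2v R n) (@vip R n) analytic_span).
Local Notation SM := (si_cl (@L2v R n) (@vip R n) shifted_span).

Lemma vshiftB k v w : vshift k (v - w) = vshift k v - vshift k w.
Proof. by rewrite -scaleN1r addrC vshift_lin scaleN1r addrC. Qed.

(** Multiplication by [z] is isometric. Together with [cl_unshift], this identifies the closure of
    the shifted span with [z] times the closure of the span. *)
Lemma cl_shift v : M v -> SM (vshift 1 v).
Proof.
move=> [Dv hv]; split=> [|e e0]; first exact: vshift_L2v.
have [a Aa ha] := hv e e0; exists (vshift 1 a); first by exists a.
by rewrite -vshiftB ipq_vshift.
Qed.

Lemma cl_unshift v : SM v -> M (vshift (-1) v).
Proof.
move=> [Dv hv]; split=> [|e e0]; first exact: vshift_L2v.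
have [b [a Aa eb] ha] := hv e e0; exists a; first exact: Aa.
rewrite eb in ha; rewrite -(ipq_vshift 1) vshiftB -vshiftD.
by rewrite (_ : 1 + -1 = 0 :> int) ?vshift0 ?subrr.
Qed.

Lemma shifted_span_sub v : shifted_span v -> analytic_span v.
Proof. by move=> [w hw ->]; apply: analytic_span_shift. Qed.

Lemma shifted_cl_sub v : SM v -> M v.
Proof.
move=> [Dv hv]; split=> // e e0; have [a Aa ha] := hv e e0.
by exists a => //; apply: shifted_span_sub.
Qed.

Lemma cl_shift_nat (j : nat) v : M v -> M (vshift j%:Z v).
Proof.
move=> hv; elim: j => [|j ih]; first by rewrite vshift0.
have -> : Posz j.+1 = 1 + Posz j by rewrite -PoszD add1n.
by rewrite vshiftD; apply/shifted_cl_sub/cl_shift.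
Qed.

Lemma cl_shift_succ (j : nat) v : M v -> SM (vshift j.+1%:Z v).
Proof. move=> hv; have -> : Posz j.+1 = 1 + Posz j by rewrite -PoszD add1n.
by rewrite vshiftD; apply/cl_shift/cl_shift_nat. Qed.

End Span.

(** * Orthogonality of the characters and the pairing of H2 with H2_0 *)

Lemma Rint_derive (f F : R -> R) : continuous f ->
  (forall x : R, is_derive x 1 F (f x)) ->
  \int[mu]_(t in T) f t = F 1 - F 0.
Proof.
move=> cf dF; rewrite /Rintegral.
have cF : continuous F.
  move=> x; apply: differentiable_continuous; apply/derivable1_diffP.
  by have [] := dF x.
rewrite (@continuous_FTC2 _ f F 0 1) ?ltr01 //.
- by apply: continuous_subspaceT.
- split.
  + by move=> x _; have [] := dF x.
  + by apply: cvg_at_right_filter; apply: cF.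
  + by apply: cvg_at_left_filter; apply: cF.
- by move=> x _; rewrite derive1E; have [_ ->] := dF x.
Qed.

Lemma echar_1 (k : int) : echar k (1 : R) = 1.
Proof.
have pos (m : nat) : echar m%:Z (1 : R) = 1.
  have e : 2 * pi * (m%:Z)%:~R * 1 = 0 + (pi *+ 2) *+ m :> R.
    by rewrite mulr1 add0r -[(m%:Z)%:~R]/(m%:R) mulr_natr mulr2n mulrDl mul1r.
  apply: complex_ext; rewrite /echar /expi /= e.
    by rewrite (periodicn (@cosD2pi R)) cos0.
  by rewrite (periodicn (@sinD2pi R)) sin0.
by case: k => m; rewrite ?NegzE ?echarN pos ?conjc1.
Qed.

Lemma cint_echar (k : int) : k != 0 -> cint (@echar R k) = 0.
Proof.
move=> k0; pose c : R := 2 * pi * k%:~R.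
have c0 : c != 0 by rewrite !mulf_neq0 ?intr_eq0 // ?gt_eqF ?pi_gt0.
have e1 := echar_1 k.
have cosc : cos c = 1 by have /(congr1 (@complex.Re _)) := e1; rewrite /= mulr1.
have sinc : sin c = 0 by have /(congr1 (@complex.Im _)) := e1; rewrite /= mulr1.
have cl : continuous (fun t : R => c * t) by exact: mulrl_continuous.
have dl (x : R) : is_derive x 1 (fun t : R => c * t) c.
  by apply: (is_derive_eq (is_deriveZ c (is_derive_id x 1))); exact: mulr1.
have d1 (x : R) : is_derive x 1 (fun t => c^-1 * sin (c * t)) (cos (c * x)).
  have h := is_derive1_comp (is_derive_sin (c * x)) (dl x).
  apply: (is_derive_eq (is_deriveZ c^-1 h)).
  by rewrite /GRing.scale /= mulrCA mulVf // mulr1.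
have d2 (x : R) : is_derive x 1 (fun t => - c^-1 * cos (c * t)) (sin (c * x)).
  have h := is_derive1_comp (is_derive_cos (c * x)) (dl x).
  apply: (is_derive_eq (is_deriveZ (- c^-1) h)).
  by rewrite /GRing.scale /= [- sin _ * c]mulrC mulrA mulNr mulVf // mulN1r opprK.
have c1 : continuous (fun t : R => cos (c * t)).
  by move=> x; apply: continuous_comp; [exact: cl|exact: continuous_cos].
have c2 : continuous (fun t : R => sin (c * t)).
  by move=> x; apply: continuous_comp; [exact: cl|exact: continuous_sin].
apply: complex_ext; rewrite ?Re_cint ?Im_cint /=.
  by apply: etrans (Rint_derive c1 d1) _; rewrite mulr1 mulr0 sin0 sinc subrr.
by apply: etrans (Rint_derive c2 d2) _; rewrite mulr1 mulr0 cos0 cosc subrr.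
Qed.

Definition inH20 (f : R -> C) : Prop :=
  inL2 f /\ forall k : int, k <= 0 -> fourier f k = 0.

(* Analytic polynomials are dense in H2, so the pairing vanishes because it does
   on each character. *)
Lemma cint_H2_H20 (f g : R -> C) : inH2 f -> inH20 g -> cint (fun t => f t * g t) = 0.
Proof.
move=> [f2 f0] [g2 g0].
pose u (_ : unit) : R -> 'cV[C]_1 := fun=> const_mx 1.
have scal (p : R -> C) : inL2 p -> L2v (fun t => (const_mx (p t) : 'cV[C]_1)).
  by move=> p2; apply: L2vP => i; under eq_fun do rewrite mxE.
have hu i : L2v (u i).
  apply: scal; have := inL2_echar R 0; congr inL2; apply/funext => t; exact: echar0.
pose fv : R -> 'cV[C]_1 := fun t => const_mx (f t).
(* The conjugation makes the sesquilinear [vip] with [w] the bilinear pairing with [g]. *)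
pose w : R -> 'cV[C]_1 := fun t => const_mx ((g t)^*)%C.
have Dw : L2v w by apply/scal/inL2J.
have Df : L2v fv by exact: scal.
have H := @vip_semi_inner R 1.
have sA := analytic_span_subspace hu.
have vipE (p q : R -> C) : vip (fun t => (const_mx (p t) : 'cV[C]_1)) (fun t => const_mx (q t)) =
    cint (fun t => p t * ((q t)^*)%C).
  by apply: eq_cint => t _; rewrite vdotE big_ord1 !mxE mulrC.
have shiftE (j : int) : vshift j (u tt) = fun t => const_mx (echar j t).
  by apply/funext => t; apply/matrixP => a b; rewrite !mxE mulr1.
have orth : forall a, analytic_span u a -> vip a w = 0.
  apply: analytic_span_orth => // j []; rewrite shiftE vipE.
  have := g0 (- j%:Z); rewrite oppr_le0 => /(_ isT); rewrite fourierE opprK => h.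
  by rewrite -[RHS]h; apply: eq_cint => t _; rewrite conjcK mulrC.
have [y cly hy] := si_projection H sA (@vip_complete R 1) Df.
have Dy : L2v y by case: cly.
have Dr : L2v (fv - y) by exact: (siB H).
(* The residual of the projection has no Fourier coefficients: those with [k >= 0] vanish by
   orthogonality, those with [k < 0] because neither [fv] nor the closed span has any. *)
have r0 : aeT (fun t => (fv - y) t 0 0 = 0).
  apply: fourier_inj; first exact/inL2_inL1/L2v_entry.
  move=> k.
  have -> : fourier (fun t => (fv - y) t 0 0) k = vip (fv - y) (vshift k (u tt)).
    rewrite fourierE shiftE; apply: eq_cint => t _.
    by rewrite vdotE big_ord1 [const_mx _ 0 0]mxE echarN mulrC.
  have Dk : L2v (vshift k (u tt)) by exact: vshift_L2v.
  have [k0|k0] := leP 0 k.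
    apply: hy; rewrite -(gez0_abs k0).
    have := analytic_spanS 1 `|k|%N tt (analytic_span0 u).
    by rewrite addr0 scale1r.
  rewrite (ipBl H Df Dy Dk).
  have -> : vip fv (vshift k (u tt)) = 0.
    rewrite shiftE vipE -[RHS](f0 _ k0) fourierE; apply: eq_cint => t _.
    by rewrite echarN.
  have -> : vip y (vshift k (u tt)) = 0; last by rewrite subr0.
  apply: (cl_orth H sA Dk _ cly); apply: analytic_span_orth; [exact: hu|exact: Dk|].
  move=> j []; rewrite !shiftE vipE -[RHS](@cint_echar (j%:Z - k)).
    by apply: eq_cint => t _; rewrite -echarN -echarD.
  by rewrite gt_eqF // subr_gt0 (lt_le_trans k0).
have hw : vip y w = 0 by exact: (cl_orth H sA Dw orth cly).
rewrite -[RHS]hw; apply: ae_eq_cint.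
- by apply: cmeasM; apply: inL2_cmeas.
- by apply: inL1_cmeas; exact: vip_inL1.
apply: aeT_S r0 => t _; rewrite !mxE => /eqP; rewrite subr_eq0 => /eqP ->.
by rewrite vdotE big_ord1 [w t 0 0]mxE conjcK mulrC.
Qed.

Lemma inH20_shift f (k : int) : inH20 f -> 0 <= k -> inH20 (fun t => f t * echar k t).
Proof.
move=> [f2 f0] k0; split=> [|l l0]; first by under eq_fun do rewrite mulrC; exact: inL2_echarM.
by rewrite fourier_shift f0 // subr_le0 (le_trans l0).
Qed.

End AnalyticSpan.

(** * Factorization of H1 matrix functions of rank k *)

Section Factorization.
Variable R : realType.
Local Notation C := (R[i]).
Local Notation mu := (@lebesgue_measure R).
Local Notation T := (@T01 R).

Lemma sum_mulr_delta (S : pzSemiRingType) (I : finType) (c : I -> S) (b : I) :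
  \sum_a c a * (a == b)%:R = c b.
Proof.
rewrite (bigD1 b) //= eqxx mulr1 big1 ?addr0 // => a ab.
by rewrite (negbTE ab) mulr0.
Qed.

Lemma opnorm_adj m p (A : 'M[C]_(m, p)) : opnorm (adjmx A) <= opnorm A.
Proof.
apply: opnorm_le => [|v]; first exact: opnorm_ge0.
have [x0|xn] := eqVneq (vnorm (adjmx A *m v)) 0.
  by rewrite x0 mulr_ge0 ?opnorm_ge0 ?vnorm_ge0.
have xp : 0 < vnorm (adjmx A *m v) by rewrite lt0r xn vnorm_ge0.
rewrite -(ler_pM2l xp) -expr2 -[leLHS]ger0_norm ?sqr_ge0 // -cabsr -vdotvv.
rewrite -vdot_adj; apply: le_trans (cabs_vdot _ _) _.
rewrite mulrC mulrCA [leRHS]mulrA; apply: ler_wpM2r; first exact: vnorm_ge0.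
by apply: le_trans (vnorm_mulmx _ _) _.
Qed.

Variables (n k : nat) (Psi : MF R n n).
Hypotheses (Psi_H : entrywise (@inH1_0 R) Psi) (Psi_rk : aeT (fun t => (\rank (Psi t) <= k)%N)).
Local Notation V := (R -> 'cV[C]_n).

Let s t := Num.sqrt (opnorm (Psi t)).
(** The columns of [U] are square integrable although [Psi] is only integrable. Where [s t = 0] the
    inverse is 0 by convention and [Psi t] vanishes, so [s U = Psi] holds at every point. *)
Let U t := (s t)^-1%:C%C *: Psi t.
Let u (i : 'I_n) : V := fun t => col i (U t).

Let Psi_cmeas : entrywise (@cmeas R) Psi.
Proof. by move=> i j; have [/inL1_cmeas] := Psi_H i j. Qed.

Let s_ge0 t : 0 <= s t. Proof. exact: sqrtr_ge0. Qed.

Let sqr_s t : s t ^+ 2 = opnorm (Psi t).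
Proof. by rewrite sqr_sqrtr ?opnorm_ge0. Qed.

Let s_meas : rmeas s. Proof. by apply: rmeas_sqrt; apply: rmeas_opnorm. Qed.

Let s2_rint : rint (fun t => s t ^+ 2).
Proof.
under eq_fun do rewrite sqr_s.
have i : rint (fun t => entsum (Psi t)).
  apply: rint_sum => i; apply: rint_sum => j; apply: inL1_rint_cabs.
  by have [] := Psi_H i j.
apply: (rint_le (rmeas_opnorm Psi_cmeas) _ i) => t _.
by rewrite ger0_norm ?opnorm_ge0 ?opnorm_entsum.
Qed.

Let s0_Psi t : s t = 0 -> Psi t = 0.
Proof. by move=> h; apply: opnorm_eq0; rewrite -sqr_s h expr0n. Qed.

Let sU t : (s t)%:C%C *: U t = Psi t.
Proof.
rewrite /U scalerA -realcM; have [/s0_Psi ->|sn] := eqVneq (s t) 0.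
  by rewrite scaler0.
by rewrite mulfV // scale1r.
Qed.

Let opU t : opnorm (U t) <= s t.
Proof.
rewrite /U opnormZ cabsr ger0_norm ?invr_ge0 // -sqr_s expr2 mulrA.
have [->|sn] := eqVneq (s t) 0; first by rewrite mulr0.
by rewrite mulVf // mul1r.
Qed.

Let U_cmeas : entrywise (@cmeas R) U.
Proof.
have m1 : rmeas (fun t => (s t)^-1).
  have -> : (fun t => (s t)^-1) = (fun t => powR (s t) (-1)).
    by apply/funext => t; rewrite powR_inv1.
  exact: (measurableT_comp (measurable_powR (-1)) s_meas).
move=> i j; under eq_fun do rewrite mxE.
by apply: cmeasM; [exact: cmeas_real|exact: Psi_cmeas].
Qed.

Let u_norm i t : vnorm (u i t) <= s t.
Proof.
rewrite /u colE; apply: le_trans (vnorm_mulmx _ _) _.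
have -> : vnorm (delta_mx i 0 : 'cV[C]_n) = 1.
  apply: eq_sqr_ge0; rewrite ?vnorm_ge0 // expr1n sqr_vnorm (bigD1 i) //= big1 ?addr0 => [|j ji].
    by rewrite mxE !eqxx cabs1 expr1n.
  by rewrite mxE (negbTE ji) cabs0 expr0n.
by rewrite mulr1.
Qed.

Let u_cmeas i : entrywise (@cmeas R) (u i : MF R n 1).
Proof. by move=> a b; under eq_fun do rewrite mxE; apply: U_cmeas. Qed.

Let u_L2 i : L2v (u i).
Proof.
apply: L2v_vnorm; first exact: u_cmeas.
apply: (rint_le _ _ s2_rint); first by apply: rmeasX; apply: rmeas_vnorm; exact: u_cmeas.
by move=> t _; rewrite ger0_norm ?sqr_ge0 // lerXn2r ?nnegrE ?vnorm_ge0.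
Qed.

Let s_L2 : inL2 (fun t => (s t)%:C%C).
Proof.
apply: (inL2_ae_le (cmeas_real s_meas) s2_rint); apply: aeT_W => t _.
by rewrite cabsr ger0_norm.
Qed.

Local Notation A0 := (analytic_span u).
Local Notation SA0 := (shifted_span u).
Local Notation M := (si_cl (@L2v R n) (@vip R n) A0).
Local Notation SM := (si_cl (@L2v R n) (@vip R n) SA0).
Let H := @vip_semi_inner R n.
Let sA : subspace_of (@L2v R n) A0 := analytic_span_subspace u_L2.
Let sSA : subspace_of (@L2v R n) SA0 := shifted_span_subspace u_L2.

Let M_L2 v : M v -> L2v v. Proof. by case. Qed.

(* [s u_i] is a column of [Psi], hence in [H^1_0]. *)
Let M_fourier m l (j : int) : M m -> j <= 0 -> fourier (fun t => (s t)%:C%C * m t l 0) j = 0.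
Proof.
(* Pairing with [s z^j e_l] computes the [j]-th coefficient of [s m_l]; being an inner product, it
   is continuous and passes from the span to its closure. *)
move=> hm j0; pose w : V := fun t => (s t)%:C%C *: (echar j t *: delta_mx l 0).
have wE t i : w t i 0 = (s t)%:C%C * (echar j t * (i == l)%:R).
  by rewrite !mxE eqxx andbT.
have Dw : L2v w.
  apply: L2vP => i; under eq_fun do rewrite wE mulrC.
  apply: (inL2_bddM (M := 1)); last exact: s_L2.
    by apply: cmeasM; [exact: cmeas_echar|exact: cmeas_cst].
  apply: aeT_W => t _; rewrite cabsM cabs_echar mul1r.
  by case: (i == l); rewrite ?cabs1 ?cabs0.
have vw v : vip v w = fourier (fun t => (s t)%:C%C * v t l 0) j.
  rewrite fourierE; apply: eq_cint => t _; rewrite vdotE (bigD1 l) //= big1 ?addr0.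
    by rewrite wE eqxx mulr1 echarN conjcM conjc_real; ring.
  by move=> i il; rewrite wE (negbTE il) !mulr0 conjc0 mul0r.
rewrite -vw; apply: (cl_orth H sA Dw _ hm); apply: analytic_span_orth; [exact: u_L2|exact: Dw|].
move=> a i; rewrite vw.
have -> : fourier (fun t => (s t)%:C%C * vshift a%:Z (u i) t l 0) j = fourier (fun t => Psi t l i) (j - a%:Z).
  rewrite -fourier_shift !fourierE; apply: eq_cint => t _.
  have -> : Psi t l i = (s t)%:C%C * u i t l 0 by rewrite -[in LHS](sU t) !mxE.
  by rewrite [vshift _ _ _ _ _]mxE; ring.
have [_] := Psi_H l i; apply.
by rewrite subr_le0 (le_trans j0).
Qed.

(** Membership in the column space of [U t] is the closed condition [K x = 0] for a cokernel matrix
    [K]; the approximants satisfy it, and it survives the pointwise limit. *)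
Let M_range m : M m -> aeT (fun t => exists c : 'cV_n, m t = U t *m c).
Proof.
move=> hm; have [a ha] := si_cl_ae sA hm; apply: aeT_S => t _ ht.
have hr v : A0 v -> exists c : 'cV_n, v t = U t *m c.
  elim=> [|c j i w _ [d wd]]; first by exists 0; rewrite mulmx0.
  exists ((c * echar j%:Z t) *: delta_mx i 0 + d).
  rewrite mulmxDr -scalemxAr -colE -wd.
  transitivity (c *: (echar j%:Z t *: col i (U t)) + w t); last by rewrite scalerA.
  by [].
pose K := (cokermx (U t)^T)^T.
have KU : K *m U t = 0.
  by apply: trmx_inj; rewrite trmx0 trmx_mul trmxK mulmx_coker.
have Ka i : K *m a i t = 0.
  by have [c ->] := hr _ (ha i); rewrite mulmxA KU mul0mx.
have Km : K *m m t = 0.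
  apply: vnorm_eq0; apply/le_anti; rewrite vnorm_ge0 andbT.
  apply: le0_eps => e e0.
  have k0 : 0 < opnorm K + 1 by have := opnorm_ge0 K; lra.
  have [i hi] := ht _ (divr_gt0 e0 k0).
  have -> : K *m m t = K *m (m t - a i t) by rewrite mulmxBr Ka subr0.
  apply: le_trans (vnorm_mulmx _ _) _.
  apply: le_trans (ler_wpM2l (opnorm_ge0 K) hi) _.
  by rewrite mulrA ler_pdivrMr // mulrC ler_pM2l //; lra.
have /submxP[D hD] : ((m t)^T <= (U t)^T)%MS.
  by rewrite submxE; apply/eqP; apply: trmx_inj; rewrite trmx_mul trmxK trmx0.
by exists D^T; apply: trmx_inj; rewrite trmx_mul trmxK.
Qed.

(** The wandering subspace of [M]. Orthogonality is demanded only against the span [SA0]; [cl_orth]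
    extends it to the closure. *)
Let E v : Prop := M v /\ forall a, SA0 a -> vip a v = 0.

Let E_L2 v : E v -> L2v v. Proof. by case=> /M_L2. Qed.

Let E_lin a v w : E v -> E w -> E (a *: v + w).
Proof.
move=> [Mv hv] [Mw hw]; split; first exact: (cl_lin H sA).
move=> b hb; have Db : L2v b by case: sSA => _ _; apply.
rewrite (ipDr H (siZ H a (M_L2 Mv)) (M_L2 Mw) Db) (ipZr H a (M_L2 Mv) Db).
by rewrite (hv b hb) (hw b hb) mulr0 addr0.
Qed.

Let E_shift e e' (j : nat) : M e -> E e' -> vip (vshift j.+1%:Z e) e' = 0.
Proof.
move=> Me Ee; have [_ h] := Ee.
exact: (cl_orth H sSA (E_L2 Ee) h (cl_shift_succ j Me)).
Qed.

(** Only [e'] has to lie in [E]. With [e] in [E] too this gives pointwise orthonormality, and with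
    [e] a column of [U] the analyticity of the second factor. *)
Let dot_fourier e e' (j : int) : M e -> E e' -> j < 0 ->
  fourier (fun t => vdot (e' t) (e t)) j = 0.
Proof.
move=> Me Ee j0; have -> : fourier (fun t => vdot (e' t) (e t)) j = vip (vshift (- j) e) e'.
  rewrite fourierE; apply: eq_cint => t _.
  by rewrite !vdotE mulr_suml; apply: eq_bigr => i _; rewrite !mxE; ring.
case: j j0 => // j _; rewrite NegzE opprK; exact: E_shift.
Qed.

(* The nonzero Fourier coefficients vanish because [E] is orthogonal to [z^j M], [j > 0]. *)
Let E_dot e e' : E e -> E e' -> aeT (fun t => vdot (e' t) (e t) = vip e e').
Proof.
move=> Ee Ee'; have De := E_L2 Ee; have De' := E_L2 Ee'.
have i1 : inL1 (fun t => vdot (e' t) (e t)) by exact: vip_inL1.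
have i2 : inL1 (fun t : R => vip e e').
  apply: (inL1_le (cmeas_cst _) (rint_cst (cabs (vip e e')))) => t _; exact: lexx.
have : aeT (fun t => vdot (e' t) (e t) - vip e e' = 0); last first.
  by apply: aeT_S => t _ /eqP; rewrite subr_eq0 => /eqP.
apply: fourier_inj; first exact: inL1B.
move=> j; rewrite fourierB //.
have cf : fourier (fun t : R => vip e e') j = vip e e' * cint (@echar R (- j)).
  by rewrite fourierE cintZ //; exact/inL2_inL1/inL2_echar.
have [jn|jp|j0] := ltrgtP j 0.
- rewrite cf cint_echar ?mulr0 ?subr0; last by rewrite oppr_eq0 lt_eqF.
  by apply: dot_fourier => //; case: Ee.
- rewrite cf cint_echar ?mulr0 ?subr0; last by rewrite oppr_eq0 gt_eqF.
  have -> : fourier (fun t => vdot (e' t) (e t)) j =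
      ((fourier (fun t => vdot (e t) (e' t)) (- j))^*)%C.
    rewrite -fourierJ; last exact: vip_inL1.
    by apply: eq_cint => t _; rewrite vdotC.
  by rewrite dot_fourier ?conjc0 ?oppr_lt0 //; case: Ee'.
rewrite cf j0 fourierE oppr0.
have -> : cint (@echar R 0) = 1.
  have -> : cint (@echar R 0) = cint (fun=> 1 : C) by apply: eq_cint => t _; exact: echar0.
  apply: complex_ext; rewrite ?Re_cint ?Im_cint /= (Rintegral_cst _ (@measurable_T01 R)).
    by rewrite [X in fine X]mu_T01 mulr1.
  by rewrite mul0r.
rewrite mulr1; apply/eqP; rewrite subr_eq0; apply/eqP.
by apply: eq_cint => t _; rewrite echar0 mulr1.
Qed.

(** The family is indexed by [nat] so that its length can grow without a change of type. *)
Let ON (r : nat) (th : nat -> V) : Prop :=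
  (forall a, (a < r)%N -> E (th a)) /\
  forall a b, (a < r)%N -> (b < r)%N -> vip (th a) (th b) = (a == b)%:R.

Let ON_dot r th : ON r th ->
  aeT (fun t => forall a b : 'I_r, vdot (th a t) (th b t) = (a == b)%:R).
Proof.
move=> [hE ho]; apply: aeT_fin => a; apply: aeT_fin => b.
apply: aeT_S (E_dot (hE b (ltn_ord b)) (hE a (ltn_ord a))) => t _ ->.
by rewrite ho // eq_sym.
Qed.

(** One good point [t] suffices: there the family is orthonormal and lies in the column space of
    [U t], whose dimension is at most [k]. *)
Let ON_rank r th : ON r th -> (r <= k)%N.
Proof.
move=> hON; have [hE _] := hON.
have hr : aeT (fun t => forall a : 'I_r, exists c : 'cV_n, th a t = U t *m c).
  by apply: aeT_fin => a; apply: M_range; have [] := hE a (ltn_ord a).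
have [t _ [[h1 h2] h3]] := aeT_ex (aeT_I (aeT_I (ON_dot hON) hr) Psi_rk).
pose Th : 'M[C]_(n, r) := \matrix_(l, a) th a t l 0.
have ThTh : adjmx Th *m Th = 1%:M.
  apply/matrixP => a b; rewrite !mxE -h1 vdotE; apply: eq_bigr => l _.
  by rewrite !mxE.
have /choice[c hc] := h2.
have ThU : Th = U t *m (\matrix_(i, a) c a i 0).
  apply/matrixP => l a; rewrite [LHS]mxE hc !mxE; apply: eq_bigr => i _.
  by rewrite !mxE.
apply: leq_trans h3; rewrite -[r in (r <= _)%N](mxrank1 C r) -ThTh.
apply: leq_trans (mxrankM_maxr _ _) _; rewrite ThU.
apply: leq_trans (mxrankM_maxl _ _) _; rewrite /U.
apply: mxrankS; apply: scalemx_sub; exact: submx_refl.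
Qed.

Let ON_max : exists r th, ON r th /\ forall th', ~ ON r.+1 th'.
Proof.
pose P r := `[< exists th, ON r th >].
have P0 : exists r, P r by exists 0%N; apply/asboolP; exists (fun=> 0); split=> // a b.
have Pk r : P r -> (r <= k)%N by move=> /asboolP[th]; apply: ON_rank.
case: (ex_maxnP P0 Pk) => r /asboolP[th hth] hmax; exists r, th; split=> // th' h.
have Pr : P r.+1 by apply/asboolP; exists th'.
by have := hmax _ Pr; rewrite ltnn.
Qed.

Section WithBasis.
Variables (r : nat) (th : nat -> V).
Hypotheses (hON : ON r th) (hmax : forall th', ~ ON r.+1 th').

Let thE (a : 'I_r) : E (th a). Proof. by case: hON => h _; apply: h. Qed.
Let th_L2 (a : 'I_r) : L2v (th a). Proof. exact: E_L2. Qed.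

Let sum_E (I : Type) (q : seq I) (c : I -> C) (f : I -> 'I_r) :
  E (\sum_(i <- q) c i *: th (f i)).
Proof.
elim: q => [|i q ih]; last by rewrite big_cons; exact: (E_lin (c i) (thE (f i)) ih).
rewrite big_nil; split; first by apply: (sub_cl H sA); exact: analytic_span0.
move=> b hb; apply: (ip0r H); by case: sSA => _ _; apply.
Qed.

(** If the residual of [e] had positive norm, its normalization placed at index [r] would lengthen
    the family, against maximality. *)
Let E_expand e : E e -> aeT (fun t => e t = \sum_(a < r) vip e (th a) *: th a t).
Proof.
move=> Ee; have De := E_L2 Ee.
pose p : V := \sum_(a < r) vip e (th a) *: th a.
have Ep : E p by exact: (sum_E (index_enum _) _ id).
have Dp := E_L2 Ep.
have Ed : E (e - p) by rewrite -scaleN1r addrC; exact: (E_lin (-1) Ep Ee).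
have Dd := E_L2 Ed.
have pth (b : 'I_r) : vip p (th b) = vip e (th b).
  have gen (q : seq 'I_r) : vip (\sum_(a <- q) vip e (th a) *: th a) (th b) =
      \sum_(a <- q) vip e (th a) * (a == b)%:R.
    elim: q => [|a q ih]; first by rewrite !big_nil (ip0l H (th_L2 b)).
    rewrite !big_cons (si_lin H _ (th_L2 a) (E_L2 (sum_E q _ id)) (th_L2 b)) ih.
    by have [_ ->] := hON.
  transitivity (\sum_(a < r) vip e (th a) * (a == b)%:R); first exact: gen.
  exact: sum_mulr_delta.
have orth (b : 'I_r) : vip (e - p) (th b) = 0.
  by rewrite (ipBl H De Dp (th_L2 b)) pth subrr.
have q0 : ipq (@vip R n) (e - p) <= 0.
  rewrite leNgt; apply/negP => qp.
  pose nr : R := (Num.sqrt (ipq (@vip R n) (e - p)))^-1.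
  have nr0 : 0 <= nr by rewrite invr_ge0 sqrtr_ge0.
  pose d : V := nr%:C%C *: (e - p).
  have Edd : E d.
    have E0 : E 0 by have := sum_E [::] (fun=> 0) id; rewrite big_nil.
    by rewrite /d -[_ *: _]addr0; exact: (E_lin _ Ed E0).
  have dd : vip d d = 1.
    rewrite (ip_diag H (E_L2 Edd)) (ipqZ H _ Dd) cabsr ger0_norm // exprVn.
    by rewrite sqr_sqrtr ?ltW // mulVf // gt_eqF.
  have dth (b : 'I_r) : vip d (th b) = 0.
    by rewrite (ipZl H _ Dd (th_L2 b)) orth mulr0.
  have thd (b : 'I_r) : vip (th b) d = 0.
    by rewrite (si_herm H (E_L2 Edd) (th_L2 b)) dth conjc0.
  apply: (hmax (th' := fun a => if a == r then d else th a)); split.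
    move=> a; rewrite ltnS leq_eqVlt; case: eqP => [//|_ /= ar].
    exact: (thE (Ordinal ar)).
  have lt_r c : (c < r.+1)%N -> c != r -> (c < r)%N.
    by move=> c1 cr; rewrite ltn_neqAle cr -ltnS.
  move=> a b ar br; case: (eqVneq a r) => [ea|anr]; case: (eqVneq b r) => [eb|bnr].
  - by rewrite ea eb eqxx dd.
  - by rewrite (dth (Ordinal (lt_r b br bnr))) ea eq_sym (negbTE bnr).
  - by rewrite (thd (Ordinal (lt_r a ar anr))) eb (negbTE anr).
  - by have [_ ->] := hON; [|exact: lt_r|exact: lt_r].
have pE t : p t = \sum_(a < r) vip e (th a) *: th a t.
  rewrite /p; elim: (index_enum _) => [|a q ih]; first by rewrite !big_nil.
  by rewrite !big_cons -ih.
apply: aeT_S (ipq_vip_eq0 Dd q0) => t _ /eqP; rewrite -[(e - p) t]/(e t - p t) subr_eq0.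
by move=> /eqP ->; rewrite pE.
Qed.

(* [Tr m] is the defect of [m]: [Tr m = z^j Tr m_j] with [m_j] in [M] for all [j], so
   all the Fourier coefficients of [s Tr m], an H1 function, vanish. *)
Let Tr (m : V) : V := fun t => m t - \sum_(a < r) vdot (th a t) (m t) *: th a t.

Let Tr_shift (j : int) m t : Tr (vshift j m) t = echar j t *: Tr m t.
Proof.
rewrite /Tr scalerBr scaler_sumr; congr (_ - _); apply: eq_bigr => a _.
by rewrite /vdot /vshift -scalemxAr mxE scalerA.
Qed.

Let Tr_add m m' t : Tr (m + m') t = Tr m t + Tr m' t.
Proof.
rewrite /Tr -[(m + m') t]/(m t + m' t) addrACA -opprD -big_split /=; congr (_ - _).
by apply: eq_bigr => a _; rewrite -scalerDl /vdot mulmxDr mxE.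
Qed.

Let Tr_E e : E e -> aeT (fun t => Tr e t = 0).
Proof.
move=> Ee; have hd : aeT (fun t => forall a : 'I_r, vdot (th a t) (e t) = vip e (th a)).
  by apply: aeT_fin => a; exact: (E_dot Ee (thE a)).
apply: aeT_S (aeT_I (E_expand Ee) hd) => t _ [he hd'].
rewrite /Tr; under eq_bigr do rewrite hd'.
by rewrite -he subrr.
Qed.

(** Write [m = (m - y) + y] with [y] the projection of [m] to [z M]. The first summand lies in [E],
    which [Tr] kills, and [z] can be extracted from the second. *)
Let Tr_step m : M m -> exists2 m', M m' & aeT (fun t => Tr m t = echar 1 t *: Tr m' t).
Proof.
move=> Mm; have Dm := M_L2 Mm.
have [y cly hy] := si_projection H sSA (@vip_complete R n) Dm.
have My : M y by exact: (shifted_cl_sub cly).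
exists (vshift (-1) y); first exact: (cl_unshift cly).
have Ee : E (m - y).
  split; first by rewrite -scaleN1r addrC; apply: (cl_lin H sA).
  move=> a ha; have Da : L2v a by case: sSA => _ _; apply.
  by rewrite (si_herm H (siB H Dm (M_L2 My)) Da) hy // conjc0.
apply: aeT_S (Tr_E Ee) => t _ h0.
have {1}-> : m = (m - y) + y by rewrite subrK.
rewrite Tr_add h0 add0r -Tr_shift; congr (Tr _ t).
by rewrite -[LHS](vshiftK (-1)) opprK.
Qed.

Let Tr_iter (j : nat) m : M m ->
  exists2 m', M m' & aeT (fun t => Tr m t = echar j%:Z t *: Tr m' t).
Proof.
move=> Mm; elim: j => [|j [m' Mm' h]].
  by exists m => //; apply: aeT_W => t _; rewrite echar0 scale1r.
have [m2 Mm2 h2] := Tr_step Mm'; exists m2; first exact: Mm2.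
apply: aeT_S (aeT_I h h2) => t _ [-> ->].
by rewrite scalerA -echarD -PoszD addn1.
Qed.

(** Pointwise orthonormality makes the columns bounded, so their products with [s] and with elements
    of [M] remain square integrable. *)
Let th_bound (a : 'I_r) : aeT (fun t => forall l, cabs (th a t l 0) <= 1).
Proof.
apply: aeT_S (ON_dot hON) => t _ h l; apply: le_trans (cabs_le_vnorm _ l) _.
apply: le_sqr_ge0; rewrite ?vnorm_ge0 // expr1n -lecR -vdotvv h eqxx; exact: lexx.
Qed.

Let sth_H20 (a : 'I_r) l : inH20 (fun t => (s t)%:C%C * th a t l 0).
Proof.
split=> [|j j0]; last by apply: M_fourier => //; case: (thE a).
under eq_fun do rewrite mulrC.
apply: (inL2_bddM (M := 1)) => //; first exact: (L2v_cmeas (th_L2 a)).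
by apply: aeT_S (th_bound a) => t _; apply.
Qed.

Let dot_H2 (a : 'I_r) m : M m -> inH2 (fun t => vdot (th a t) (m t)).
Proof.
move=> Mm; split; last by move=> j j0; apply: dot_fourier.
have Dm := M_L2 Mm; under eq_fun do rewrite vdotE.
apply: inL2_sum => l; apply: (inL2_bddM (M := 1)); last exact: L2v_entry.
  by apply: cmeasJ; exact: (L2v_cmeas (th_L2 a)).
by apply: aeT_S (th_bound a) => t _ h; rewrite cabsJ.
Qed.

Let sTr_inL1 m l : M m -> inL1 (fun t => (s t)%:C%C * Tr m t l 0).
Proof.
move=> Mm; apply: inL2M => //.
under eq_fun do rewrite /Tr !mxE.
apply: inL2D; first by apply: L2v_entry; exact: M_L2.
under eq_fun do rewrite summxE; apply: inL2N; apply: inL2_sum => a.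
under eq_fun do rewrite mxE mulrC.
apply: (inL2_bddM (M := 1)); first exact: (L2v_cmeas (th_L2 a)).
  by apply: aeT_S (th_bound a) => t _; apply.
by have [] := dot_H2 a Mm.
Qed.

(** The part [s m] is covered by [M_fourier]; each subtracted term is an H2_0 function [s th] times
    an H2 function, to which the vanishing pairing applies. *)
Let sTr_fourier m l (j : int) : M m -> j <= 0 -> fourier (fun t => (s t)%:C%C * Tr m t l 0) j = 0.
Proof.
move=> Mm j0.
have E1 t : (s t)%:C%C * Tr m t l 0 = (s t)%:C%C * m t l 0 -
    \sum_(a < r) ((s t)%:C%C * th a t l 0) * vdot (th a t) (m t).
  rewrite /Tr !mxE summxE mulrBr; congr (_ - _); rewrite mulr_sumr.
  by apply: eq_bigr => a _; rewrite mxE; ring.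
have i1 : inL1 (fun t => (s t)%:C%C * m t l 0).
  by apply: inL2M => //; apply: L2v_entry; exact: M_L2.
have i2 (a : 'I_r) : inL1 (fun t => ((s t)%:C%C * th a t l 0) * vdot (th a t) (m t)).
  by apply: inL2M; [have [] := sth_H20 a l|have [] := dot_H2 a Mm].
under eq_fun do rewrite E1.
rewrite fourierB //; last exact: inL1_sum.
rewrite (M_fourier l Mm j0) sub0r fourier_sum // big1 ?oppr0 // => a _.
rewrite fourierE.
have j0' : 0 <= - j by rewrite oppr_ge0.
rewrite -[RHS](cint_H2_H20 (dot_H2 a Mm) (inH20_shift (sth_H20 a l) j0')).
by apply: eq_cint => t _; ring.
Qed.

Let Tr_zero m : M m -> aeT (fun t => (s t)%:C%C *: Tr m t = 0).
Proof.
move=> Mm; have hl l : aeT (fun t => (s t)%:C%C * Tr m t l 0 = 0).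
  apply: fourier_inj; first exact: sTr_inL1.
  (* Extracting [z] to the power [|j|] moves the coefficient of index [j] to [j - |j|], which is at
     most 0. *)
  move=> j; have [m' Mm' h] := Tr_iter `|j|%N Mm.
  have -> : fourier (fun t => (s t)%:C%C * Tr m t l 0) j =
      fourier (fun t => (s t)%:C%C * Tr m' t l 0) (j - `|j|%N%:Z).
    rewrite -fourier_shift; apply: ae_eq_fourier.
    - by apply: inL1_cmeas; exact: sTr_inL1.
    - by apply: inL1_cmeas; apply: inL1_echarM; exact: sTr_inL1.
    by apply: aeT_S h => t _ ->; rewrite mxE; ring.
  apply: sTr_fourier => //.
  by rewrite subr_le0 abszE ler_norm.
apply: aeT_S (aeT_fin hl) => t _ h; apply/matrixP => l b.
by rewrite (ord1 b) [LHS]mxE h mxE.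
Qed.

Let u_expand : aeT (fun t => forall i, u i t = \sum_(a < r) vdot (th a t) (u i t) *: th a t).
Proof.
apply: aeT_fin => i; have Mu : M (u i) by apply: (sub_cl H sA); exact: analytic_span_gen.
apply: aeT_S (Tr_zero Mu) => t _ h; apply/eqP; rewrite -subr_eq0 -/(Tr (u i) t).
(* [Tr_zero] leaves a factor [s]: it is cancelled where nonzero, and where it vanishes so does
   [U]. *)
have [s0|sn] := eqVneq (s t) 0.
  have u0 : u i t = 0 by rewrite /u /U (s0_Psi s0) scaler0 col0.
  by rewrite /Tr u0 big1 ?subr0 // => a _; rewrite /vdot mulmx0 mxE scale0r.
move/eqP: h; rewrite scaler_eq0 => /orP[/eqP/(congr1 (@complex.Re _))/= s0|//].
by rewrite s0 eqxx in sn.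
Qed.

(** The maximal family may be shorter than [k]. Padding with zero columns gives [Theta] its [k]
    columns, at the price of being only a partial isometry. *)
Let thx (a : nat) : V := if (a < r)%N then th a else fun=> 0.
Let Theta t : 'M[C]_(n, k) := \matrix_(l, a) thx a t l 0.

Let Theta_gram : aeT (fun t => adjmx (Theta t) *m Theta t = \matrix_(a, b) ((a == b) && (a < r)%N)%:R).
Proof.
apply: aeT_S (ON_dot hON) => t _ h; apply/matrixP => a b; rewrite [RHS]mxE [LHS]mxE.
transitivity (vdot (thx a t) (thx b t)).
  by rewrite vdotE; apply: eq_bigr => l _; rewrite !mxE.
rewrite /thx; case: (ltnP a r) => [ar|ra]; last first.
  by rewrite andbF vdotE big1 // => l _; rewrite mxE conjc0 mul0r.
case: (ltnP b r) => [br|rb]; first by rewrite (h (Ordinal ar) (Ordinal br)) andbT.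
rewrite vdotE big1 => [|l _]; last by rewrite mxE mulr0.
by case: eqP => [ab|//]; move: rb; rewrite -ab leqNgt ar.
Qed.

Let Theta_opnorm : aeT (fun t => opnorm (Theta t) <= 1).
Proof.
apply: aeT_S Theta_gram => t _ h; apply: opnorm_le => // v; rewrite mul1r.
apply: le_sqr_ge0; rewrite ?vnorm_ge0 // -lecR -vdotvv vdot_adj mulmxA h sqr_vnorm.
rewrite vdotE realc_sum; apply: ler_sum => a _.
rewrite mxE (bigD1 a) //= big1 => [|b ba]; last by rewrite mxE eq_sym (negbTE ba) mul0r.
rewrite mxE eqxx addr0 sqr_cabsC mulrC /=.
case: (a < r)%N; rewrite ?mul1r //.
by rewrite mul0r conjc0 mulr0 -sqr_cabsC lecR sqr_ge0.
Qed.

Let Theta_mul : aeT (fun t => Theta t *m (adjmx (Theta t) *m U t) = U t).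
Proof.
have rk : (r <= k)%N by exact: ON_rank hON.
apply: aeT_S u_expand => t _ h; apply/matrixP => l i.
have -> : U t l i = u i t l 0 by rewrite [RHS]mxE.
rewrite h summxE mxE.
rewrite (big_ord_widen k (fun a => (vdot (th a t) (u i t) *: th a t) l 0) rk) [RHS]big_mkcond /=.
apply: eq_bigr => a _.
have -> : Theta t l a = thx a t l 0 by rewrite mxE.
rewrite [(_ *m _) a i]mxE /thx.
case: (ltnP a r) => ar; last by rewrite mxE mul0r.
rewrite [RHS]mxE mulrC; congr (_ * _); rewrite vdotE; apply: eq_bigr => b _.
by rewrite !mxE /thx ar.
Qed.

Lemma factorization_with_basis : exists (F : MF R n k) (G : MF R k n),
  [/\ entrywise (@inH2 R) F, entrywise (@inH20 R) G,
      aeT (fun t => F t *m G t = Psi t),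
      aeT (fun t => opnorm (F t) ^+ 2 <= opnorm (Psi t)) &
      aeT (fun t => opnorm (G t) ^+ 2 <= opnorm (Psi t))].
Proof.
(* [s Theta] has no coefficient of index 0 and can afford [z^-1], whereas the adjoint of [Theta]
   times [U] may have one and needs [z]; the two powers cancel in the product. *)
pose F : MF R n k := fun t => (echar (-1) t * (s t)%:C%C) *: Theta t.
pose G : MF R k n := fun t => echar 1 t *: (adjmx (Theta t) *m U t).
exists F, G; split.
- move=> l a; rewrite /F; under eq_fun do rewrite !mxE /thx.
  case: (ltnP a r) => ar; last first.
    have -> : (fun t => echar (-1) t * (s t)%:C%C * (0 : 'cV[C]_n) l 0) = fun=> 0.
      by apply/funext => t; rewrite mxE mulr0.
    by split; [exact: inL2_0|move=> j _; rewrite fourierE -[RHS](@cint0 R); apply: eq_cint => t _; rewrite mul0r].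
  have [h1 h2] := sth_H20 (Ordinal ar) l.
  under eq_fun do rewrite -mulrA.
  split; first exact: inL2_echarM.
  move=> j j0; under eq_fun do rewrite mulrC.
  by rewrite fourier_shift h2 // opprK lezD1.
- move=> a i; rewrite /G.
  case: (ltnP a r) => [ar|ra]; last first.
    have -> : (fun t => (echar 1 t *: (adjmx (Theta t) *m U t)) a i) = fun=> 0.
      apply/funext => t; rewrite mxE [X in _ * X]mxE big1 ?mulr0 // => l _.
      by rewrite !mxE /thx ltnNge ra /= mxE conjc0 mul0r.
    by split; [exact: inL2_0|move=> j _; rewrite fourierE -[RHS](@cint0 R); apply: eq_cint => t _; rewrite mul0r].
  have Mu : M (u i) by apply: (sub_cl H sA); exact: analytic_span_gen.
  have [h1 h2] := dot_H2 (Ordinal ar) Mu.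
  have -> : (fun t => (echar 1 t *: (adjmx (Theta t) *m U t)) a i) =
      fun t => echar 1 t * vdot (th (Ordinal ar) t) (u i t).
    apply/funext => t; rewrite mxE [X in _ * X]mxE vdotE; congr (_ * _).
    by apply: eq_bigr => l _; rewrite !mxE /thx ar.
  split; first exact: inL2_echarM.
  move=> j j0; under eq_fun do rewrite mulrC.
  by rewrite fourier_shift h2 // subr_lt0 (le_lt_trans j0).
- apply: aeT_S Theta_mul => t _ h; rewrite /F /G -scalemxAl -scalemxAr h scalerA.
  by rewrite mulrAC -echarD echar0 mul1r.
- apply: aeT_S Theta_opnorm => t _ h; rewrite -sqr_s lerXn2r ?nnegrE ?opnorm_ge0 //.
  rewrite /F opnormZ cabsM cabs_echar mul1r cabsr ger0_norm //.
  exact: ler_piMr.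
- apply: aeT_S Theta_opnorm => t _ h; rewrite -sqr_s lerXn2r ?nnegrE ?opnorm_ge0 //.
  rewrite /G opnormZ cabs_echar mul1r; apply: le_trans (opnormM _ _) _.
  rewrite -[leRHS]mul1r; apply: ler_pM; rewrite ?opnorm_ge0 //.
  exact: le_trans (opnorm_adj _) h.
Qed.

End WithBasis.

Lemma factorization : exists (F : MF R n k) (G : MF R k n),
  [/\ entrywise (@inH2 R) F, entrywise (@inH20 R) G,
      aeT (fun t => F t *m G t = Psi t),
      aeT (fun t => opnorm (F t) ^+ 2 <= opnorm (Psi t)) &
      aeT (fun t => opnorm (G t) ^+ 2 <= opnorm (Psi t))].
Proof.
by have [r [th [hON hmax]]] := ON_max; exact: (factorization_with_basis hON hmax).
Qed.

End Factorization.

(** * Pairing with H1 matrix functions *)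

Section Duality.
Variable R : realType.
Local Notation C := (R[i]).
Local Notation mu := (@lebesgue_measure R).
Local Notation T := (@T01 R).

Lemma esssup_ge0 (g : R -> R) : (forall t, T t -> 0 <= g t) -> (0 <= esssup g)%E.
Proof.
move=> g0; apply: le_ereal_inf_tmp => x /= hx; rewrite leNgt; apply/negP => x0.
have TE : T `&` [set t | (x < (g t)%:E)%E] = T.
  by apply/setIidl => t Tt /=; apply: (lt_le_trans x0); rewrite lee_fin g0.
by move: hx; rewrite TE mu_T01 => /eqP; rewrite onee_eq0.
Qed.

Lemma ae_le_fine_esssup (g : R -> R) : rmeas g -> (forall t, T t -> 0 <= g t) ->
  (esssup g < +oo)%E -> aeT (fun t => g t <= fine (esssup g)).
Proof.
move=> mg g0 hg; apply: esssup_ub => //.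
by rewrite fineK // ge0_fin_numE // esssup_ge0.
Qed.

Lemma fine_esssup_le (g : R -> R) (c : R) : rmeas g -> (forall t, T t -> 0 <= g t) ->
  aeT (fun t => g t <= c) -> fine (esssup g) <= c.
Proof.
move=> mg g0 hg; have h := esssup_le mg hg; rewrite -lee_fin fineK //.
by rewrite ge0_fin_numE ?esssup_ge0 // (le_lt_trans h) // ltry.
Qed.

(** No measurability is asked for: the measure is given on all sets by an outer measure. This
    matters for the rank set in [Acal]. *)
Lemma mu_le (A B : set R) : A `<=` B -> (mu A <= mu B)%E.
Proof.
move=> AB; rewrite /lebesgue_measure /lebesgue_stieltjes_measure /measure_extension /=.
exact: le_outer_measure.
Qed.

Lemma inLinf_bound (f : R -> C) : inLinf f -> exists K, aeT (fun t => cabs (f t) <= K).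
Proof.
move=> [mf hf]; exists (fine (esssup (fun t => cabs (f t)))).
by apply: ae_le_fine_esssup => // [|t _]; [exact: rmeas_cabs|exact: cabs_ge0].
Qed.

Definition Linf_bounded m p (F : MF R m p) :=
  entrywise (@cmeas R) F /\ exists K, aeT (fun t => entsum (F t) <= K).

Lemma entrywise_inLinf m p (F : MF R m p) : entrywise (@inLinf R) F -> Linf_bounded F.
Proof.
move=> hF; split=> [i j|]; first by have [] := hF i j.
have h i j : exists K, aeT (fun t => cabs (F t i j) <= K) by exact: inLinf_bound.
have /choice[K hK] : forall ij : 'I_m * 'I_p, exists K, aeT (fun t => cabs (F t ij.1 ij.2) <= K).
  by move=> [i j]; exact: h.
exists (\sum_i \sum_j K (i, j)); apply: aeT_S (aeT_fin hK) => t _ hk.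
by apply: ler_sum => i _; apply: ler_sum => j _; exact: (hk (i, j)).
Qed.

Lemma entsumB m p (A B : 'M[C]_(m, p)) : entsum (A - B) <= entsum A + entsum B.
Proof.
rewrite /entsum -big_split /=; apply: ler_sum => i _.
rewrite -big_split /=; apply: ler_sum => j _.
by rewrite !mxE -(cabsN (B i j)) cabsD.
Qed.

Lemma Linf_boundedB m p (F G : MF R m p) :
  Linf_bounded F -> Linf_bounded G -> Linf_bounded (fun t => F t - G t).
Proof.
move=> [mF [K hK]] [mG [L hL]]; split=> [i j|].
  by under eq_fun do rewrite !mxE; exact: cmeasB.
exists (K + L); apply: aeT_S (aeT_I hK hL) => t _ [h1 h2].
by apply: le_trans (entsumB _ _) _; exact: lerD.
Qed.

Lemma cabs_le_entsum m p (A : 'M[C]_(m, p)) i j : cabs (A i j) <= entsum A.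
Proof. exact: le_trans (cabs_le_opnorm _ _ _) (opnorm_entsum _). Qed.

Lemma inHinf_inH2 (f : R -> C) : inHinf f -> inH2 f.
Proof.
move=> [hf h0]; split=> //; have [K hK] := inLinf_bound hf.
apply: (inL2_ae_le _ (rint_cst (K ^+ 2))); first by case: hf.
apply: aeT_S hK => t _ h; rewrite lerXn2r ?nnegrE ?cabs_ge0 //.
exact: le_trans (cabs_ge0 _) h.
Qed.

(** For [k < 0] the coefficient is the pairing of [g] with [f z^-k], and this strictly positive
    power of [z] puts the second function in H2_0. *)
Lemma inH2_Hinf_mul (f g : R -> C) : inHinf f -> inH2 g -> inH2 (fun t => f t * g t).
Proof.
move=> hf [g2 g0]; have [K hK] := inLinf_bound (proj1 hf).
have [f2 f0] := inHinf_inH2 hf.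
split; first by apply: (inL2_bddM _ hK) => //; exact: inL2_cmeas.
move=> k k0; rewrite fourierE.
have h : inH20 (fun t => f t * echar (- k) t).
  split; first by under eq_fun do rewrite mulrC; exact: inL2_echarM.
  move=> j j0; rewrite fourier_shift f0 // opprK.
  by rewrite -[ltRHS](addr0 0) ler_ltD.
rewrite -[RHS](cint_H2_H20 (conj g2 g0) h); apply: eq_cint => t _; ring.
Qed.

Lemma entrywise_mulmx_Hinf m p q (F : MF R m p) (G : MF R p q) :
  entrywise (@inHinf R) F -> entrywise (@inH2 R) G ->
  entrywise (@inH2 R) (fun t => F t *m G t).
Proof.
move=> hF hG i j; under eq_fun do rewrite mxE.
have h l : inH2 (fun t => F t i l * G t l j) by exact: inH2_Hinf_mul.
split; first by apply: inL2_sum => l; case: (h l).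
move=> k k0; rewrite fourier_sum => [|l]; last by apply: inL2_inL1; case: (h l).
by apply: big1 => l _; case: (h l) => _; apply.
Qed.

Lemma inL1_tr_H2_H20 m p (A : MF R m p) (B : MF R p m) :
  entrywise (@inH2 R) A -> entrywise (@inH20 R) B -> inL1 (fun t => \tr (A t *m B t)).
Proof.
move=> hA hB; apply: inL1_sum => i; under eq_fun do rewrite mxE.
by apply: inL1_sum => j; apply: inL2M; [case: (hA i j)|case: (hB j i)].
Qed.

Lemma cint_tr_H2_H20 m p (A : MF R m p) (B : MF R p m) :
  entrywise (@inH2 R) A -> entrywise (@inH20 R) B -> cint (fun t => \tr (A t *m B t)) = 0.
Proof.
move=> hA hB.
have h i j : inL1 (fun t => A t i j * B t j i).
  by apply: inL2M; [case: (hA i j)|case: (hB j i)].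
have -> : (fun t => \tr (A t *m B t)) = fun t => \sum_i \sum_j A t i j * B t j i.
  by apply/funext => t; apply: eq_bigr => i _; rewrite mxE.
rewrite cint_sum => [|i]; last exact: inL1_sum.
rewrite big1 // => i _; rewrite cint_sum // big1 // => j _.
exact: cint_H2_H20.
Qed.

Lemma rint_opnorm m p (F : MF R m p) : entrywise (@inL1 R) F -> rint (fun t => opnorm (F t)).
Proof.
move=> hF; have i : rint (fun t => entsum (F t)).
  by apply: rint_sum => i; apply: rint_sum => j; exact: inL1_rint_cabs.
have mF : entrywise (@cmeas R) F by move=> a b; exact: inL1_cmeas.
apply: (rint_le (rmeas_opnorm mF) _ i) => t _.
by rewrite ger0_norm ?opnorm_ge0 ?opnorm_entsum.
Qed.

Lemma inL1_ae_le (f : R -> C) (p : R -> R) : cmeas f -> rint p ->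
  aeT (fun t => cabs (f t) <= p t) -> inL1 f.
Proof.
move=> mf ip hp; split=> //; apply/rint_ge0P; [exact: rmeas_cabs|by move=> t _; exact: cabs_ge0|].
apply: (ae_le_rint _ ip); first exact: rmeas_cabs.
by apply: aeT_S hp => t _; rewrite ger0_norm ?cabs_ge0.
Qed.

Lemma cabs_cint_tr_le m p (A : MF R m p) (B : MF R p m) (c : R) :
  entrywise (@cmeas R) A -> entrywise (@inL1 R) B ->
  aeT (fun t => cabs (\tr (A t *m B t)) <= c * opnorm (B t)) ->
  inL1 (fun t => \tr (A t *m B t)) /\
  cabs (cint (fun t => \tr (A t *m B t))) <= c * \int[mu]_(t in T) opnorm (B t).
Proof.
move=> mA iB h; have io := rint_opnorm iB.
have mB : entrywise (@cmeas R) B by move=> a b; exact: inL1_cmeas.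
have itr : inL1 (fun t => \tr (A t *m B t)).
  by apply: (inL1_ae_le _ (rintZ c io) h); apply: cmeas_trace; exact: cmeas_mulmx.
split=> //; apply: le_trans (cabs_cint itr) _.
rewrite -RintegralZl //; apply: le_Rint => //; [exact: inL1_rint_cabs|exact: rintZ].
Qed.

Lemma trnormE n (A : 'M[C]_n) : trnorm A = \sum_(j < n) sing j A.
Proof. by rewrite /trnorm minnn. Qed.

Lemma trnorm_le_entsum m p (A : 'M[C]_(m, p)) : trnorm A <= (minn m p)%:R * entsum A.
Proof.
apply: (@le_trans _ _ (\sum_(j < minn m p) entsum A)).
  by apply: ler_sum => j _; exact: le_trans (sing_opnorm _ _) (opnorm_entsum _).
by rewrite sumr_const card_ord mulr_natl.
Qed.

Lemma trnorm_mulmx n p (A : 'M[C]_n) (B : 'M[C]_(n, p)) :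
  trnorm (A *m B) <= trnorm A * opnorm B.
Proof.
rewrite trnormE mulr_suml /trnorm (big_ord_widen n (fun j => sing j (A *m B))) ?geq_minl //.
rewrite big_mkcond /=; apply: ler_sum => j _; case: ifP => _; first exact: sing_mulmx.
by rewrite mulr_ge0 ?sing_ge0 ?opnorm_ge0.
Qed.

Lemma cabs_tr_le_trnorm n p (A : 'M[C]_(n, p)) (B : 'M[C]_(p, n)) : (p <= n)%N ->
  cabs (\tr (A *m B)) <= trnorm A * opnorm B.
Proof. by move=> pn; rewrite /trnorm (minn_idPr pn); exact: cabs_tr_le. Qed.

Lemma L2nrmE m p (N : 'M[C]_(m, p) -> R) (F : MF R m p) :
  L2nrm N F = Num.sqrt (\int[mu]_(t in T) (N (F t) ^+ 2)).
Proof. by []. Qed.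

Lemma rint_sqr_le m p (N : 'M[C]_(m, p) -> R) (K : R) (F : MF R m p) :
  rmeas (fun t => N (F t)) -> (forall A, 0 <= N A <= K * entsum A) ->
  entrywise (@inL2 R) F -> rint (fun t => N (F t) ^+ 2).
Proof.
move=> mN hN hF.
have i : rint (fun t => K ^+ 2 * entsum (F t) ^+ 2).
  apply: rintZ.
  have : inL2 (fun t => (entsum (F t))%:C%C).
    have -> : (fun t => (entsum (F t))%:C%C) = fun t => \sum_i \sum_j (cabs (F t i j))%:C%C.
      apply/funext => t; rewrite realc_sum; apply: eq_bigr => i _; exact: realc_sum.
    apply: inL2_sum => i; apply: inL2_sum => j; apply/inL2P.
    split; first by apply: cmeas_real; apply: rmeas_cabs; exact: inL2_cmeas.
    under eq_fun do rewrite cabsr ger0_norm ?cabs_ge0 //.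
    exact: inL2_rint.
  move=> /inL2_rint; congr rint; apply/funext => t.
  by rewrite cabsr ger0_norm // entsum_ge0.
apply: (rint_le _ _ i); first exact: rmeasX.
move=> t _; have /andP[h0 h1] := hN (F t).
by rewrite ger0_norm ?sqr_ge0 // -exprMn lerXn2r ?nnegrE // (le_trans h0).
Qed.

Lemma rint_sqr_opnorm m p (F : MF R m p) : entrywise (@inL2 R) F ->
  rint (fun t => opnorm (F t) ^+ 2).
Proof.
move=> hF; apply: (rint_sqr_le (K := 1)) => // [|A].
  by apply: rmeas_opnorm => i j; exact: inL2_cmeas.
by rewrite mul1r opnorm_ge0 opnorm_entsum.
Qed.

Lemma rint_sqr_trnorm m p (F : MF R m p) : entrywise (@inL2 R) F ->
  rint (fun t => trnorm (F t) ^+ 2).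
Proof.
move=> hF; apply: (rint_sqr_le (K := (minn m p)%:R)) => // [|A].
  by apply: rmeas_trnorm => i j; exact: inL2_cmeas.
by rewrite trnorm_ge0 trnorm_le_entsum.
Qed.

Lemma inL2_mulmx_bounded m p q (F : MF R m p) (G : MF R p q) :
  Linf_bounded F -> entrywise (@inL2 R) G -> entrywise (@inL2 R) (fun t => F t *m G t).
Proof.
move=> [mF [K hK]] hG i j; under eq_fun do rewrite mxE.
apply: inL2_sum => l; apply: (inL2_bddM (M := K)) => //.
by apply: aeT_S hK => t _; apply: le_trans; exact: cabs_le_entsum.
Qed.

Lemma entrywise_inL2B m p (F G : MF R m p) : entrywise (@inL2 R) F ->
  entrywise (@inL2 R) G -> entrywise (@inL2 R) (fun t => F t - G t).
Proof.
move=> hF hG i j; under eq_fun do rewrite !mxE.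
by apply: inL2D; [exact: hF|apply: inL2N; exact: hG].
Qed.

(** The measurable set where [sing k] is positive lies inside the rank set, hence is null; off it
    [rank_sing0] bounds the rank. *)
Lemma rank_aeT m p (F : MF R m p) k : entrywise (@cmeas R) F ->
  mu (T `&` [set t | (k < \rank (F t))%N]) = 0%E -> aeT (fun t => (\rank (F t) <= k)%N).
Proof.
move=> mF h0.
have m0 : mu (T `&` [set t | (0%:E < (sing k (F t))%:E)%E]) = 0%E.
  apply/le_anti/andP; split; last exact: measure_ge0.
  rewrite -h0; apply: mu_le => t [Tt /=]; rewrite lte_fin => st; split=> //=.
  by rewrite ltnNge; apply/negP => /sing_rank s0; rewrite s0 ltxx in st.
have : aeT (fun t => sing k (F t) <= 0).
  apply/aeT_negligible; exists (T `&` [set t | (0%:E < (sing k (F t))%:E)%E]); split=> //.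
    by apply: measurable_superlevel; exact: rmeas_sing.
  by move=> t [Tt /= /negP]; rewrite -ltNge => h; split=> //=; rewrite lte_fin.
by apply: aeT_S => t _ h; apply: rank_sing0; apply/le_anti; rewrite h sing_ge0.
Qed.

Lemma le_sum_ord (f : nat -> R) a b : (forall j, 0 <= f j) -> (a <= b)%N ->
  \sum_(j < a) f j <= \sum_(j < b) f j.
Proof.
move=> f0 ab; rewrite (big_ord_widen b f ab) big_mkcond /=; apply: ler_sum => j _.
by case: ifP.
Qed.

(** The supremum of the empty set is 0 by convention, so [0 <= c] takes the place of
    nonemptiness. *)
Lemma sup_le_ge0 (A : set R) c : 0 <= c -> (forall x, A x -> x <= c) -> sup A <= c.
Proof.
move=> c0 h; have [->|/set0P ne] := eqVneq A set0; first by rewrite sup0.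
exact: ge_sup.
Qed.

Lemma inH2_0 : inH2 (fun=> 0 : R[i]).
Proof.
split; first exact: inL2_0.
by move=> j _; rewrite fourierE -[RHS](@cint0 R); apply: eq_cint => t _; rewrite mul0r.
Qed.

Lemma inHinf_0 : inHinf (fun=> 0 : R[i]).
Proof.
split; last by case: inH2_0.
split; first exact: cmeas_cst.
apply: le_lt_trans (ltry 0); apply: esssup_le; first exact: rmeas_cabs (cmeas_cst _).
by apply: aeT_W => t _; rewrite cabs0.
Qed.

End Duality.

(** * Superoptimal singular values and the upper bound for the pairing *)

Section SuperoptimalValues.
Variable R : realType.
Variables (n : nat) (Phi : MF R n n).
Hypotheses (n0 : (0 < n)%N) (Phi_inf : entrywise (@inLinf R) Phi).
Hypothesis Phi_vba : very_badly_approximable Phi.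

(** Both functions minimize over the same set at every level up to [m]. Hence the values in [tsv] do
    not depend on the approximant picked by [epsilon]. *)
Lemma Omega_esssup m F G : Omega Phi m F -> Omega Phi m G -> forall j, (j <= m)%N ->
  esssup (fun t => sing j (Phi t - F t)) = esssup (fun t => sing j (Phi t - G t)).
Proof.
elim: m => [|m ih] /= [h1 h2] [h3 h4] j.
  rewrite leqn0 => /eqP ->; apply/le_anti.
  by apply/andP; split; [exact: h2|exact: h4].
rewrite leq_eqVlt ltnS => /predU1P[->|jm]; last exact: ih.
by apply/le_anti/andP; split; [exact: h2|exact: h4].
Qed.

(** The zero function lies in [Omega Phi n.-1] and may replace the chosen approximant. That settles
    indices below [n]; from [n] on both sides vanish, matrices of size [n] having rank at most
    [n]. *)
Lemma tsvE j : tsv Phi j = fine (esssup (fun t => sing j (Phi t))).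
Proof.
have h : Omega Phi n.-1 (ClassicalEpsilon.epsilon (inhabits (fun _ => 0)) (Omega Phi n.-1)).
  by apply: ClassicalEpsilon.epsilon_spec; exists (fun=> 0); exact: Phi_vba.
rewrite /tsv; set F := ClassicalEpsilon.epsilon _ _ in h *; move: F h => F h; apply: (@congr1 _ _ (@fine R)).
have [jn|nj] := ltnP j n.
  have jn1 : (j <= n.-1)%N by rewrite -ltnS prednK.
  apply: etrans (Omega_esssup h Phi_vba jn1) _.
  by apply: congr1; apply/funext => t; rewrite subr0.
by apply: congr1; apply/funext => t; rewrite !sing_rank // (leq_trans (rank_leq_row _)).
Qed.

Lemma sing_le_tsv : aeT (fun t => forall j, sing j (Phi t) <= tsv Phi j).
Proof.
have [mPhi [K hK]] := entrywise_inLinf Phi_inf.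
apply: aeT_nat => j; rewrite tsvE.
have ms : rmeas (fun t => sing j (Phi t)) by exact: rmeas_sing.
apply: ae_le_fine_esssup => // [t _|]; first exact: sing_ge0.
apply: le_lt_trans (ltry K); apply: esssup_le => //.
by apply: aeT_S hK => t _; apply: le_trans; exact: le_trans (sing_opnorm _ _) (opnorm_entsum _).
Qed.

Lemma tsv_ge0 j : 0 <= tsv Phi j.
Proof.
have [t _ h] := aeT_ex sing_le_tsv; exact: le_trans (sing_ge0 _ _) (h j).
Qed.

Lemma cabs_cint_tr_tsv l Psi : Acal l Psi ->
  inL1 (fun t => \tr (Phi t *m Psi t)) /\
  cabs (cint (fun t => \tr (Phi t *m Psi t))) <= \sum_(j < l) tsv Phi j.
Proof.
move=> [H1 [n1 rk]].
have L1 : entrywise (@inL1 R) Psi by move=> a b; case: (H1 a b).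
have rk' : aeT (fun t => (\rank (Psi t) <= l)%N).
  by apply: rank_aeT => // a b; exact: inL1_cmeas.
have h : aeT (fun t => cabs (\tr (Phi t *m Psi t)) <= (\sum_(j < l) tsv Phi j) * opnorm (Psi t)).
  apply: aeT_S (aeT_I sing_le_tsv rk') => t _ [hs hr].
  apply: le_trans (cabs_tr_le_rank _ hr) _; apply: ler_wpM2r; first exact: opnorm_ge0.
  by apply: ler_sum.
have mPhi : entrywise (@cmeas R) Phi by case: (entrywise_inLinf Phi_inf).
have [i hi] := cabs_cint_tr_le mPhi L1 h; split=> //; apply: le_trans hi _.
apply: ler_piMr; last exact: n1.
by apply: sumr_ge0 => j _; exact: tsv_ge0.
Qed.

Lemma sigma_le l : sigma l Phi <= \sum_(j < l) tsv Phi j.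
Proof.
apply: sup_le_ge0; first by apply: sumr_ge0 => j _; exact: tsv_ge0.
by move=> _ [Psi hPsi <-]; case: (cabs_cint_tr_tsv hPsi).
Qed.

(** * Consequences of an extremal function of rank at most k *)

Section Extremal.
Variables (k : nat) (Psi : MF R n n).
Hypotheses (k0 : (0 < k)%N) (kn : (k <= n)%N) (hPsi : Acal k Psi).
Hypothesis Psi_ext :
  cint (fun t => \tr (Phi t *m Psi t)) = (\sum_(j < n.+1) tsv Phi j)%:C%C.
Hypothesis tk : 0 < tsv Phi k.-1.

Let S := \sum_(j < k) tsv Phi j.

(** The pairing with [Psi] equals the full sum, yet the rank of [Psi] bounds it by the first [k]
    terms. The form with [m] serves the trace norm at [m = n] and the extremal value at
    [m = n + 1]. *)
Lemma sum_tsv_eq m : (k <= m)%N -> (m <= n.+1)%N -> \sum_(j < m) tsv Phi j = S.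
Proof.
move=> km mn; apply/le_anti; rewrite (le_sum_ord tsv_ge0 km) andbT.
apply: le_trans (le_sum_ord tsv_ge0 mn) _; have [_] := cabs_cint_tr_tsv hPsi.
rewrite Psi_ext cabsr ger0_norm; first exact: id.
by apply: sumr_ge0 => j _; exact: tsv_ge0.
Qed.

Lemma cint_tr_extremal : cint (fun t => \tr (Phi t *m Psi t)) = S%:C%C.
Proof. by rewrite Psi_ext sum_tsv_eq // leqW. Qed.

Lemma sum_tsv_gt0 : 0 < S.
Proof.
rewrite /S -(prednK k0) big_ord_recr /=; apply: ltr_wpDl => //.
by apply: sumr_ge0 => j _; exact: tsv_ge0.
Qed.

Lemma sum_tsv_ge0 : 0 <= S. Proof. exact: ltW sum_tsv_gt0. Qed.

Lemma ae_trnorm_le : aeT (fun t => trnorm (Phi t) <= S).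
Proof.
apply: aeT_S sing_le_tsv => t _ h; rewrite trnormE -(sum_tsv_eq kn (leqW (leqnn n))).
by apply: ler_sum => j _; exact: h.
Qed.

Lemma Linfnrm_trnorm_le : Linfnrm (@trnorm R n n) Phi <= S.
Proof.
apply: fine_esssup_le ae_trnorm_le => [|t _]; last exact: trnorm_ge0.
by apply: rmeas_trnorm; case: (entrywise_inLinf Phi_inf).
Qed.

Lemma sum_tsv_lt l : (l < k)%N -> \sum_(j < l) tsv Phi j < S.
Proof.
move=> lk; apply: (@le_lt_trans _ _ (\sum_(j < k.-1) tsv Phi j)).
  by apply: (le_sum_ord tsv_ge0); rewrite -ltnS prednK.
by rewrite /S -(prednK k0) big_ord_recr /= ltrDl.
Qed.

Let Psi_L1 : entrywise (@inL1 R) Psi.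
Proof. by case: hPsi => H1 _ a b; case: (H1 a b). Qed.

Let Psi_rk : aeT (fun t => (\rank (Psi t) <= k)%N).
Proof.
case: hPsi => _ [_ h]; apply: rank_aeT h => a b; exact: inL1_cmeas.
Qed.

Let Psi_int : \int[@lebesgue_measure R]_(t in @T01 R) opnorm (Psi t) <= 1.
Proof. by case: hPsi => _ []. Qed.

Let Phi_cmeas : entrywise (@cmeas R) Phi.
Proof. by case: (entrywise_inLinf Phi_inf). Qed.

Section WithFactors.
Variables (F : MF R n k) (G : MF R k n).
Hypotheses (F_H2 : entrywise (@inH2 R) F) (G_H20 : entrywise (@inH20 R) G).
Hypothesis FG : aeT (fun t => F t *m G t = Psi t).
Hypothesis F_le : aeT (fun t => opnorm (F t) ^+ 2 <= opnorm (Psi t)).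
Hypothesis G_le : aeT (fun t => opnorm (G t) ^+ 2 <= opnorm (Psi t)).

(** The factors reappear here: [tr (Q Psi) = tr ((Q F) G)] pairs the H2 function [Q F] with [G] in
    H2_0, so its integral is 0 and [S] is still the pairing of [Phi - Q] with [Psi]. *)
Lemma Linfnrm_sub_Hinf_ge (Q : MF R n n) : entrywise (@inHinf R) Q ->
  S <= Linfnrm (@trnorm R n n) (fun t => Phi t - Q t).
Proof.
move=> hQ; have bQ : Linf_bounded Q by apply: entrywise_inLinf => a b; case: (hQ a b).
have bD := Linf_boundedB (entrywise_inLinf Phi_inf) bQ.
have [mD [K hK]] := bD; have mQ : entrywise (@cmeas R) Q by case: bQ.
have mt := rmeas_trnorm mD.
have ht : aeT (fun t => trnorm (Phi t - Q t) <= Linfnrm (@trnorm R n n) (fun t => Phi t - Q t)).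
  apply: ae_le_fine_esssup => // [t _|]; first exact: trnorm_ge0.
  apply: le_lt_trans (ltry ((minn n n)%:R * K)); apply: esssup_le => //.
  apply: aeT_S hK => t _ h; apply: le_trans (trnorm_le_entsum _) _.
  exact: ler_wpM2l.
have h2 : aeT (fun t => cabs (\tr ((Phi t - Q t) *m Psi t)) <=
    Linfnrm (@trnorm R n n) (fun t => Phi t - Q t) * opnorm (Psi t)).
  apply: aeT_S ht => t _ h; apply: le_trans (cabs_tr_le_trnorm _ _ (leqnn n)) _.
  by apply: ler_wpM2r => //; exact: opnorm_ge0.
have [i hi] := cabs_cint_tr_le mD Psi_L1 h2.
have c0 : 0 <= Linfnrm (@trnorm R n n) (fun t => Phi t - Q t).
  by have [t _] := aeT_ex ht; apply: le_trans; exact: trnorm_ge0.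
have QFG : entrywise (@inH2 R) (fun t => Q t *m F t) by exact: entrywise_mulmx_Hinf.
have [iPhi _] := cabs_cint_tr_tsv hPsi.
apply: le_trans (le_trans hi (ler_piMr c0 Psi_int)).
rewrite (_ : cint _ = S%:C%C) ?cabsr ?ger0_norm ?sum_tsv_ge0 //.
rewrite -cint_tr_extremal -[RHS]subr0 -(cint_tr_H2_H20 QFG G_H20) -cintB //; last first.
  exact: inL1_tr_H2_H20.
apply: ae_eq_cint; first exact: inL1_cmeas.
  by apply: inL1_cmeas; apply: inL1B => //; exact: inL1_tr_H2_H20.
by apply: aeT_S FG => t _ h; rewrite -mulmxA h mulmxBl raddfB.
Qed.

Let F_L2 : entrywise (@inL2 R) F. Proof. by move=> a b; case: (F_H2 a b). Qed.
Let G_L2 : entrywise (@inL2 R) G. Proof. by move=> a b; case: (G_H20 a b). Qed.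

Lemma L2nrm_factor_le : L2nrm (@opnorm R n k) F <= 1.
Proof.
rewrite L2nrmE -[leRHS]sqrtr1; apply: ler_wsqrtr; apply: le_trans Psi_int.
by apply: le_Rint F_le; [exact: rint_sqr_opnorm|exact: rint_opnorm].
Qed.

Lemma L2nrm_trnorm_mulmx_le (X : MF R n k) : entrywise (@inL2 R) X ->
  L2nrm (@trnorm R n k) (fun t => Phi t *m X t) <= S * L2nrm (@opnorm R n k) X.
Proof.
move=> hX; rewrite !L2nrmE.
have ro := rint_sqr_opnorm hX.
rewrite -[S in leRHS]ger0_norm ?sum_tsv_ge0 // -sqrtr_sqr -sqrtrM ?sqr_ge0 //.
apply: ler_wsqrtr; rewrite -RintegralZl //; apply: le_Rint.
- by apply: rint_sqr_trnorm; apply: inL2_mulmx_bounded => //; exact: entrywise_inLinf.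
- exact: rintZ.
apply: aeT_S ae_trnorm_le => t _ h; rewrite -exprMn lerXn2r ?nnegrE ?trnorm_ge0 //.
  by rewrite mulr_ge0 ?opnorm_ge0 // sum_tsv_ge0.
by apply: le_trans (trnorm_mulmx _ _) _; apply: ler_wpM2r => //; exact: opnorm_ge0.
Qed.

Lemma L2nrm_coset_ge (Q : MF R n k) : entrywise (@inH2 R) Q ->
  S <= L2nrm (@trnorm R n k) (fun t => Phi t *m F t - Q t).
Proof.
move=> hQ; pose D : MF R n k := fun t => Phi t *m F t - Q t.
have Q_L2 : entrywise (@inL2 R) Q by move=> a b; case: (hQ a b).
have D_L2 : entrywise (@inL2 R) D.
  by apply: entrywise_inL2B => //; apply: inL2_mulmx_bounded => //; exact: entrywise_inLinf.
have [iPhi _] := cabs_cint_tr_tsv hPsi.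
have iQ := inL1_tr_H2_H20 hQ G_H20.
have iD : inL1 (fun t => \tr (D t *m G t)).
  apply: inL1_sum => i; under eq_fun do rewrite mxE.
  by apply: inL1_sum => j; apply: inL2M.
have eD : cint (fun t => \tr (D t *m G t)) = S%:C%C.
  rewrite -cint_tr_extremal -[RHS]subr0 -(cint_tr_H2_H20 hQ G_H20) -cintB //.
  apply: ae_eq_cint; [exact: inL1_cmeas|by apply: inL1_cmeas; exact: inL1B|].
  by apply: aeT_S FG => t _ h; rewrite /D mulmxBl -mulmxA h raddfB.
have rD := rint_sqr_trnorm D_L2; have rG := rint_sqr_opnorm G_L2.
pose I := \int[@lebesgue_measure R]_(t in @T01 R) (trnorm (D t) ^+ 2).
pose J := \int[@lebesgue_measure R]_(t in @T01 R) (opnorm (G t) ^+ 2).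
have J1 : J <= 1.
  by apply: le_trans Psi_int; apply: le_Rint G_le; [|exact: rint_opnorm].
(* A weighted mean inequality replaces Cauchy-Schwarz for integrals. The weights balance when
   [I = S ^+ 2] and [J = 1], so [J <= 1] yields [S ^+ 2 <= I]. *)
have SI : S <= (2 * S)^-1 * I + 2^-1 * S * J.
  have -> : S = cabs (cint (fun t => \tr (D t *m G t))).
    by rewrite eD cabsr ger0_norm // sum_tsv_ge0.
  rewrite {1}eD -eD.
  apply: le_trans (cabs_cint iD) _.
  rewrite eD cabsr ger0_norm ?sum_tsv_ge0 // /I /J -!RintegralZl // -RintD; [|exact: rintZ|exact: rintZ].
  apply: le_Rint; [exact: inL1_rint_cabs|by apply: rintD; exact: rintZ|].
  apply: aeT_W => t _; apply: le_trans (cabs_tr_le_trnorm _ _ kn) _.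
  have s0 := sum_tsv_gt0.
  (* AM-GM: [2 S x y <= x^2 + S^2 y^2] *)
  have : 0 <= (2 * S)^-1 * (trnorm (D t) - S * opnorm (G t)) ^+ 2.
    by rewrite mulr_ge0 ?sqr_ge0 // invr_ge0 mulr_ge0 // ltW.
  move=> h; rewrite -subr_ge0; apply: le_trans h _; rewrite le_eqVlt; apply/orP; left.
  by apply/eqP; field; rewrite gt_eqF.
have s0 := sum_tsv_gt0; have I2 : S ^+ 2 <= I.
  have : 2^-1 * S * J <= 2^-1 * S by rewrite ler_piMr // mulr_ge0 ?invr_ge0 // ltW.
  have -> : I = 2 * S * ((2 * S)^-1 * I) by field; rewrite gt_eqF.
  by nra.
rewrite L2nrmE -[leLHS](ger0_norm sum_tsv_ge0) -sqrtr_sqr.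
exact: ler_wsqrtr.
Qed.

Lemma coset_lbound (X : MF R n k) :
  has_lbound [set L2nrm (@trnorm R n k) (fun t => Phi t *m X t - Q t) | Q in @entrywise R (@inH2 R) n k].
Proof. by exists 0 => _ [Q _ <-]; exact: sqrtr_ge0. Qed.

Lemma entrywise_inH2_0 : entrywise (@inH2 R) (fun=> 0 : 'M[R[i]]_(n, k)).
Proof. by move=> a b; under eq_fun do rewrite mxE; exact: inH2_0. Qed.

Lemma Hk_qnorm_le (X : MF R n k) : entrywise (@inH2 R) X ->
  Hk_qnorm Phi X <= S * L2nrm (@opnorm R n k) X.
Proof.
move=> hX; apply: (@le_trans _ _ (L2nrm (@trnorm R n k) (fun t => Phi t *m X t))).
  apply: ge_inf; first exact: coset_lbound.
  exists (fun=> 0); first exact: entrywise_inH2_0.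
  by under eq_fun do rewrite subr0.
by apply: L2nrm_trnorm_mulmx_le => a b; case: (hX a b).
Qed.

Lemma Hk_qnorm_factor_ge : S <= Hk_qnorm Phi F.
Proof.
apply: lb_le_inf; last by move=> _ [Q hQ <-]; exact: L2nrm_coset_ge.
exists (L2nrm (@trnorm R n k) (fun t => Phi t *m F t - 0)).
by exists (fun=> 0) => //; exact: entrywise_inH2_0.
Qed.

(** The factorization gives only norm at most 1; equality follows from
    [S <= Hk_qnorm Phi F <= S * L2nrm F] and [S > 0], and it shows that [F] is not zero. *)
Lemma L2nrm_factor : L2nrm (@opnorm R n k) F = 1.
Proof.
apply/le_anti; rewrite L2nrm_factor_le -(ler_pM2l sum_tsv_gt0) mulr1.
exact: le_trans Hk_qnorm_factor_ge (Hk_qnorm_le F_H2).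
Qed.

Lemma Hk_qnorm_factor : Hk_qnorm Phi F = S.
Proof.
apply/le_anti; rewrite Hk_qnorm_factor_ge andbT.
by have := Hk_qnorm_le F_H2; rewrite L2nrm_factor mulr1.
Qed.

Lemma Hk_norm_eq : Hk_norm k Phi = S.
Proof.
have ub x : [set Hk_qnorm Phi F | F in [set F : MF R n k | entrywise (@inH2 R) F /\
    L2nrm (@opnorm R n k) F <= 1]] x -> x <= S.
  move=> [X [hX X1] <-]; apply: le_trans (Hk_qnorm_le hX) _.
  by apply: ler_piMr => //; exact: ltW sum_tsv_gt0.
apply/le_anti/andP; split; first by apply: sup_le_ge0 => //; exact: ltW sum_tsv_gt0.
rewrite -{1}Hk_qnorm_factor; apply: ub_le_sup; first by exists S => x /ub.
by exists F => //; split=> //; exact: L2nrm_factor_le.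
Qed.

Lemma maximizing_vector_factor : maximizing_vector Phi F.
Proof.
split=> //; split; first by rewrite L2nrm_factor; apply/eqP; exact: oner_neq0.
by rewrite Hk_qnorm_factor Hk_norm_eq L2nrm_factor mulr1.
Qed.

End WithFactors.

Lemma entrywise_inHinf_0 : entrywise (@inHinf R) (fun=> 0 : 'M[R[i]]_n).
Proof. by move=> a b; under eq_fun do rewrite mxE; exact: inHinf_0. Qed.

Lemma distS1_eq (F : MF R n k) (G : MF R k n) : entrywise (@inH2 R) F -> entrywise (@inH20 R) G ->
  aeT (fun t => F t *m G t = Psi t) -> distS1 Phi = S.
Proof.
move=> hF hG FG; apply/le_anti/andP; split; last first.
  apply: lb_le_inf; last by move=> _ [Q hQ <-]; exact: (Linfnrm_sub_Hinf_ge hF hG FG).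
  exists (Linfnrm (@trnorm R n n) (fun t => Phi t - 0)), (fun=> 0) => //.
  exact: entrywise_inHinf_0.
apply: le_trans Linfnrm_trnorm_le; apply: ge_inf.
  by exists S => _ [Q hQ <-]; exact: (Linfnrm_sub_Hinf_ge hF hG FG).
exists (fun=> 0); first exact: entrywise_inHinf_0.
by under eq_fun do rewrite subr0.
Qed.

Lemma sigma_eq : sigma k Phi = S.
Proof.
apply/le_anti; rewrite sigma_le /=; apply: ub_le_sup.
  by exists S => _ [X hX <-]; case: (cabs_cint_tr_tsv hX).
by exists Psi => //; rewrite cint_tr_extremal cabsr ger0_norm // sum_tsv_ge0.
Qed.

Lemma has_order_extremal : has_order Phi k /\
  (forall F : MF R n n, entrywise (@inHinf R) F ->
     Linfnrm (@trnorm R n n) Phi <= Linfnrm (@trnorm R n n) (fun t => Phi t - F t)).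
Proof.
have H1 : entrywise (@inH1_0 R) Psi by case: hPsi.
have [F [G [hF hG FG F_le G_le]]] := factorization H1 Psi_rk.
have dS := distS1_eq hF hG FG.
split; last first.
  move=> Q hQ; apply: le_trans Linfnrm_trnorm_le _.
  exact: (Linfnrm_sub_Hinf_ge hF hG FG).
split=> //; split.
  split; last by rewrite dS sigma_eq.
  by exists F; exact: (maximizing_vector_factor hF hG FG F_le G_le).
(* For [l < k] it is the equality of [sigma l Phi] with the distance that fails, since
   [tsv Phi k.-1 > 0] is missing from the sum bounding [sigma l Phi]. *)
move=> l _ lk [_]; rewrite dS => sS.
by have := le_lt_trans (sigma_le l) (sum_tsv_lt lk); rewrite sS ltxx.
Qed.

End Extremal.
End SuperoptimalValues.

Theorem theorem4p10 (R : realType) (n k : nat) (Phi : MF R n n) :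
  (1 < n)%N -> (1 <= k)%N -> (k <= n)%N ->
  entrywise (@inLinf R) Phi ->
  admissible Phi ->
  very_badly_approximable Phi ->
  (exists Psi : MF R n n, Acal k Psi /\
     cint (fun t => \tr (Phi t *m Psi t)) = (\sum_(j < n.+1) tsv Phi j)%:C%C) ->
  0 < tsv Phi k.-1 ->
  has_order Phi k /\
  (forall F : MF R n n, entrywise (@inHinf R) F ->
     Linfnrm (@trnorm R n n) Phi <= Linfnrm (@trnorm R n n) (fun t => Phi t - F t)).
Proof.
move=> n1 k1 kn hPhi _ vba [Psi [hPsi ext]] tk.
exact: (has_order_extremal (ltnW n1) hPhi vba k1 kn hPsi ext tk).
Qed.
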